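(* Let $\Bbbk$ be an algebraically closed field with $\operatorname{char}(\Bbbk)=0$, let $i\in\Bbbk$ with $i^2=-1$, and let $\gamma\in\Bbbk^\times$. Let $\mathfrak L(\gamma)\subset\mathbb P^5$ be the line scheme of the algebra $\mathcal A(\gamma)$ and let $\mathfrak L'(\gamma)$ denote its reduced variety (the variety of its closed points). If $\gamma^2\neq 16$, then $\mathfrak L'(\gamma)$ is the union, in $\mathbb P^5$, of the following seven irreducible components: (I) $\mathfrak L_1=\mathcal V(M_{13},\ M_{24},\ M_{14}M_{23}+M_{12}M_{34},\ M_{12}^2+M_{34}^2+\gamma M_{14}M_{23}-M_{14}^2-M_{23}^2)$, which is a nonplanar elliptic curve in a $\mathbb P^3$; (II) $\mathfrak L_2=\mathcal V(M_{13},\ M_{14},\ M_{34},\ M_{12}^3-M_{12}M_{23}^2-iM_{23}M_{24}^2)$, which is a planar elliptic curve; (III) $\mathfrak L_3=\mathcal V(M_{12},\ M_{13},\ M_{23},\ M_{34}^3-M_{14}^2M_{34}+iM_{14}M_{24}^2)$, which is a planar elliptic curve; (IV) $\mathfrak L_4=\mathcal V(M_{12},\ M_{14},\ M_{24},\ M_{23}^2M_{34}+i\gamma M_{13}^2M_{23}-M_{34}^3)$, which is a planar elliptic curve; (V) $\mathfrak L_5=\mathcal V(M_{23},\ M_{24},\ M_{34},\ M_{12}M_{14}^2-i\gamma M_{13}^2M_{14}-M_{12}^3)$, which is a planar elliptic curve; (VIa) $\mathfrak L_{6a}=\mathcal V(M_{14},\ M_{23},\ M_{12}M_{34}-M_{13}M_{24},\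 M_{12}+iM_{34})$, which is a nonsingular conic; (VIb) $\mathfrak L_{6b}=\mathcal V(M_{14},\ M_{23},\ M_{12}M_{34}-M_{13}M_{24},\ M_{12}-iM_{34})$, which is a nonsingular conic. If $\gamma=4$, then $\mathfrak L'(\gamma)$ is the union, in $\mathbb P^5$, of eight irreducible components, six of which are $\mathfrak L_2,\mathfrak L_3,\mathfrak L_4,\mathfrak L_5,\mathfrak L_{6a},\mathfrak L_{6b}$ (given by the formulas above) and two of which are \[ \mathfrak L_{1a}=\mathcal V(M_{13},\ M_{24},\ M_{14}M_{23}+M_{12}M_{34},\ M_{12}+M_{14}-M_{23}-M_{34}), \] \[ \mathfrak L_{1b}=\mathcal V(M_{13},\ M_{24},\ M_{14}M_{23}+M_{12}M_{34},\ M_{12}-M_{14}+M_{23}-M_{34}), \] which are nonsingular conics.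
   Context: For $\gamma\in\Bbbk^\times$, $\mathcal A(\gamma)$ is the $\Bbbk$-algebra on generators $x_1,\dots,x_4$ with defining relations $x_4x_1=ix_1x_4$, $x_3^2=x_1^2$, $x_3x_1=x_1x_3-x_2^2$, $x_3x_2=ix_2x_3$, $x_4^2=x_2^2$, $x_4x_2=x_2x_4-\gamma x_1^2$, where $i^2=-1$. $\mathcal V(S)$ denotes the zero locus in $\mathbb P^5$ of a set $S$ of homogeneous polynomials. The homogeneous coordinates on $\mathbb P^5$ are the Plücker coordinates $M_{12},M_{13},M_{14},M_{23},M_{24},M_{34}$, and $P=M_{12}M_{34}-M_{13}M_{24}+M_{14}M_{23}$ is the Plücker polynomial. Line scheme as a closed subscheme of $\mathbb P^5$: let \[ \mathcal M(\gamma)=\begin{bmatrix} 0&u_1&0&0&0&v_1&0&0\\ u_2&0&0&0&v_2&0&0&0\\ 0&0&0&u_3&0&0&0&v_3\\ 0&0&u_4&0&0&0&v_4&0\\ u_3&0&u_1&0&v_3&0&v_1&0\\ 0&u_4&0&u_2&0&v_4&0&v_2\\ -u_4&0&0&iu_1&-v_4&0&0&iv_1\\ 0&-u_3&iu_2&0&0&-v_3&iv_2&0\\ u_1&0&u_3&\gamma u_2&v_1&0&v_3&\gamma v_2\\ 0&u_2&u_1&u_4&0&v_2&v_1&v_4 \end{bmatrix}. \] Each of its forty-five $8\times 8$ minors can be written as a homogeneous quartic polynomial in the quantities $N_{ij}=u_iv_j-u_jv_i$, $1\le i<j\le 4$ (uniquely modulo the Plücker relation $N_{12}N_{34}-N_{13}N_{24}+N_{14}N_{23}=0$).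 Substituting $N_{12}\mapsto M_{34}$, $N_{13}\mapsto -M_{24}$, $N_{14}\mapsto M_{23}$, $N_{23}\mapsto M_{14}$, $N_{24}\mapsto -M_{13}$, $N_{34}\mapsto M_{12}$ gives forty-five quartic polynomials in the $M_{ij}$. The line scheme $\mathfrak L(\gamma)$ of $\mathcal A(\gamma)$ is the closed subscheme of $\mathbb P^5$ defined by these forty-five polynomials together with $P$. *)

(* Defs.v *)
From HB Require Import structures.
From mathcomp Require Import all_boot all_order all_algebra.
From mathcomp Require Import mpoly.

Set Implicit Arguments.
Unset Strict Implicit.
Unset Printing Implicit Defensive.

Import GRing.Theory.
Local Open Scope ring_scope.

Section ProjectiveSets.
Variables (k : closedFieldType) (n : nat).

(* A point of P^n is given by a nonzero row of homogeneous coordinates, and a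
   subset of P^n by the set of all such coordinate rows of its points. *)
Definition pset := 'rV[k]_n.+1 -> Prop.

Implicit Types (X Y Z : pset) (f : {mpoly k[n.+1]}).

Definition psub X Y := forall p, X p -> Y p.
Definition peq X Y := forall p, X p <-> Y p.

Definition evalp f (p : 'rV[k]_n.+1) : k := f.@[fun j => p 0 j].

Definition homogeneous f := exists d : nat, f \is d.-homog.

Definition zeros (S : {mpoly k[n.+1]} -> Prop) : pset :=
  fun p => p != 0 /\ forall f, S f -> evalp f p = 0.

Definition zlocus (s : seq {mpoly k[n.+1]}) : pset := zeros (fun f => f \in s).

Definition zclosed X :=
  exists S, (forall f, S f -> homogeneous f) /\ peq X (zeros S).

Definition irreducible X :=
  [/\ zclosed X, exists p, X p &
      forall Y Z, zclosed Y -> zclosed Z ->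
        (forall p, X p -> Y p \/ Z p) -> psub X Y \/ psub X Z].

Definition irreducible_component X Z :=
  [/\ irreducible Z, psub Z X &
      forall Y, irreducible Y -> psub Z Y -> psub Y X -> psub Y Z].

(* X is the union of its irreducible components, and these are exactly the m
   pairwise distinct members of C. *)
Definition decomposes_into m X (C : m.-tuple pset) :=
  [/\ forall p, X p <-> exists j, tnth C j p,
      forall Z, irreducible_component X Z <-> exists j, peq Z (tnth C j) &
      forall i j, peq (tnth C i) (tnth C j) -> i = j].

Definition has_chain X r :=
  exists Z : nat -> pset,
    (forall j, (j <= r)%N -> irreducible (Z j) /\ psub (Z j) X) /\
    (forall j, (j < r)%N -> psub (Z j) (Z j.+1) /\ ~ psub (Z j.+1) (Z j)).

Definition has_dim X r := has_chain X r /\ ~ has_chain X r.+1.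

Definition vanishes_on f X := forall p, X p -> evalp f p = 0.

(* The embedded projective tangent space of X at each point, cut out by the
   linear forms sum_j (df/dx_j)(p) x_j for f in the homogeneous ideal of X, is
   an r-dimensional linear subspace, where r is the dimension of X. *)
Definition nonsingular X :=
  exists2 r, has_dim X r &
    forall p, X p -> exists W : 'M[k]_n.+1, \rank W = r.+1 /\
      forall v : 'rV[k]_n.+1, (v <= W)%MS <->
        (forall f, homogeneous f -> vanishes_on f X ->
           \sum_(j < n.+1) evalp (f^`M(j)) p * v 0 j = 0).

(* The degree-d part of the homogeneous coordinate ring of X has dimension m
   over k: the classes of the b_j form a basis. *)
Definition hilbert_value X (d m : nat) :=
  exists b : 'I_m -> {mpoly k[n.+1]}, (forall j, b j \is d.-homog) /\
    forall f, f \is d.-homog ->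
      exists! c : 'rV[k]_m, vanishes_on (f - \sum_(j < m) c 0 j *: b j) X.

Definition hilbert_polynomial X (h : {poly rat}) :=
  exists d0 : nat, forall d, (d0 <= d)%N ->
    exists2 m, hilbert_value X d m & h.[d%:R] = m%:R.

Definition has_degree X (e : nat) :=
  exists r h, [/\ has_dim X r, hilbert_polynomial X h & h`_r * (r`!)%:R = e%:R].

Definition has_arith_genus X (g : int) :=
  exists r h, [/\ has_dim X r, hilbert_polynomial X h &
                  (-1) ^+ r * (h.[0] - 1) = g%:~R].

Definition in_linear_subspace X r :=
  exists W : 'M[k]_n.+1, \rank W = r.+1 /\ forall p, X p -> (p <= W)%MS.

Definition planar X := in_linear_subspace X 2.

Definition projective_curve X := irreducible X /\ has_dim X 1.

(* For a nonsingular projective curve the genus is the arithmetic genus. *)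
Definition elliptic_curve X :=
  [/\ projective_curve X, nonsingular X & has_arith_genus X 1].

Definition nonsingular_conic X :=
  [/\ projective_curve X, planar X, has_degree X 2 & nonsingular X].

End ProjectiveSets.

Section LineScheme.
Variables (k : closedFieldType) (i gamma : k).

Definition M12 : {mpoly k[6]} := 'X_(Ordinal (isT : 0 < 6)%N).
Definition M13 : {mpoly k[6]} := 'X_(Ordinal (isT : 1 < 6)%N).
Definition M14 : {mpoly k[6]} := 'X_(Ordinal (isT : 2 < 6)%N).
Definition M23 : {mpoly k[6]} := 'X_(Ordinal (isT : 3 < 6)%N).
Definition M24 : {mpoly k[6]} := 'X_(Ordinal (isT : 4 < 6)%N).
Definition M34 : {mpoly k[6]} := 'X_(Ordinal (isT : 5 < 6)%N).

Definition plucker : {mpoly k[6]} := M12 * M34 - M13 * M24 + M14 * M23.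

Let u1 : {mpoly k[8]} := 'X_(Ordinal (isT : 0 < 8)%N).
Let u2 : {mpoly k[8]} := 'X_(Ordinal (isT : 1 < 8)%N).
Let u3 : {mpoly k[8]} := 'X_(Ordinal (isT : 2 < 8)%N).
Let u4 : {mpoly k[8]} := 'X_(Ordinal (isT : 3 < 8)%N).
Let v1 : {mpoly k[8]} := 'X_(Ordinal (isT : 4 < 8)%N).
Let v2 : {mpoly k[8]} := 'X_(Ordinal (isT : 5 < 8)%N).
Let v3 : {mpoly k[8]} := 'X_(Ordinal (isT : 6 < 8)%N).
Let v4 : {mpoly k[8]} := 'X_(Ordinal (isT : 7 < 8)%N).

Definition line_matrix_rows : seq (seq {mpoly k[8]}) :=
  [:: [:: 0; u1; 0; 0; 0; v1; 0; 0];
      [:: u2; 0; 0; 0; v2; 0; 0; 0];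
      [:: 0; 0; 0; u3; 0; 0; 0; v3];
      [:: 0; 0; u4; 0; 0; 0; v4; 0];
      [:: u3; 0; u1; 0; v3; 0; v1; 0];
      [:: 0; u4; 0; u2; 0; v4; 0; v2];
      [:: - u4; 0; 0; i *: u1; - v4; 0; 0; i *: v1];
      [:: 0; - u3; i *: u2; 0; 0; - v3; i *: v2; 0];
      [:: u1; 0; u3; gamma *: u2; v1; 0; v3; gamma *: v2];
      [:: 0; u2; u1; u4; 0; v2; v1; v4]].

Definition line_matrix : 'M[{mpoly k[8]}]_(10, 8) :=
  \matrix_(r < 10, c < 8) nth 0 (nth [::] line_matrix_rows r) c.

(* N12, N13, N14, N23, N24, N34, where Nij = ui vj - uj vi. *)
Definition Ncoords : 6.-tuple {mpoly k[8]} :=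
  [tuple u1 * v2 - u2 * v1; u1 * v3 - u3 * v1; u1 * v4 - u4 * v1;
         u2 * v3 - u3 * v2; u2 * v4 - u4 * v2; u3 * v4 - u4 * v3].

(* The images of N12, N13, N14, N23, N24, N34. *)
Definition dual_coords : 6.-tuple {mpoly k[6]} :=
  [tuple M34; - M24; M23; M14; - M13; M12].

(* The maximal minors correspond to the increasing choices s of eight rows.
   The quartic F expressing a minor in the Nij exists by generalized Laplace
   expansion along the column pairs (c, c + 4). It is unique only modulo the
   Pluecker relation, so all such F are kept; as the Pluecker polynomial is
   also an equation, this does not change the ideal they generate. *)
Definition line_scheme_equation (G : {mpoly k[6]}) :=
  G = plucker \/
  exists s : 'I_8 -> 'I_10, exists F : {mpoly k[6]},
    [/\ forall a b : 'I_8, (a < b)%N -> (s a < s b)%N,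
        F \is 4.-homog,
        F \mPo Ncoords = \det (rowsub s line_matrix) &
        G = F \mPo dual_coords].

(* k being algebraically closed, the closed points of the line scheme are the
   common zeros of its equations in P^5. *)
Definition reduced_line_scheme : pset k 5 := zeros line_scheme_equation.

Definition L1 : pset k 5 :=
  zlocus [:: M13; M24; M14 * M23 + M12 * M34;
             M12 ^+ 2 + M34 ^+ 2 + gamma *: (M14 * M23) - M14 ^+ 2 - M23 ^+ 2].

Definition L2 : pset k 5 :=
  zlocus [:: M13; M14; M34;
             M12 ^+ 3 - M12 * M23 ^+ 2 - i *: (M23 * M24 ^+ 2)].

Definition L3 : pset k 5 :=
  zlocus [:: M12; M13; M23;
             M34 ^+ 3 - M14 ^+ 2 * M34 + i *: (M14 * M24 ^+ 2)].

Definition L4 : pset k 5 :=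
  zlocus [:: M12; M14; M24;
             M23 ^+ 2 * M34 + (i * gamma) *: (M13 ^+ 2 * M23) - M34 ^+ 3].

Definition L5 : pset k 5 :=
  zlocus [:: M23; M24; M34;
             M12 * M14 ^+ 2 - (i * gamma) *: (M13 ^+ 2 * M14) - M12 ^+ 3].

Definition L6a : pset k 5 :=
  zlocus [:: M14; M23; M12 * M34 - M13 * M24; M12 + i *: M34].

Definition L6b : pset k 5 :=
  zlocus [:: M14; M23; M12 * M34 - M13 * M24; M12 - i *: M34].

Definition L1a : pset k 5 :=
  zlocus [:: M13; M24; M14 * M23 + M12 * M34; M12 + M14 - M23 - M34].

Definition L1b : pset k 5 :=
  zlocus [:: M13; M24; M14 * M23 + M12 * M34; M12 - M14 + M23 - M34].

End LineScheme.

Arguments L1a k : clear implicits.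
Arguments L1b k : clear implicits.

(* Main.v *)
Require Import Defs.
From HB Require Import structures.
From mathcomp Require Import all_boot all_order all_algebra all_fingroup.
From mathcomp Require Import mpoly.
From mathcomp Require Import ring zify.
From Stdlib Require Import Classical FunctionalExtensionality PropExtensionality.

Set Implicit Arguments.
Unset Strict Implicit.
Unset Printing Implicit Defensive.

Import GRing.Theory.
Local Open Scope ring_scope.

(** The closed points of the line scheme are found by duality between kernels and
    tensors. Grouping the columns of the 10 x 8 matrix in the pairs [(u_j, v_j)] and
    averaging the determinant over the swaps of these pairs writes its maximal minors
    as quartics in the [N_jl] ([laplace_column_pairs]), so a point of the
    Grassmannian lies on the line scheme exactly when the matrix has a nonzero kernel
    vector [(a, b)] at two points [u], [v] that span the corresponding line. The rows
    of the matrix say that the tensor [u a + v b] belongs to a space of tensors with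
    six parameters, and conversely a tensor of this space comes from a kernel vector
    when its columns lie on the line. Hence a line belongs to the line scheme exactly
    when some nonzero tensor of this space has its columns on it ([line_schemeP]).
    This condition is a system of sixteen equations, bilinear in the Pluecker
    coordinates and the six parameters. It is elementary to solve: four products of a
    coordinate with a parameter vanish, and in each of the resulting cases elimination
    leaves the equation of one of the curves ([relation_locus]); conversely each curve
    carries an explicit tensor ([locus_relation]). For [gamma = 4] the quadric of the
    first curve splits into two linear factors modulo the other quadric.

    The geometry of the curves reduces to three models by linear embeddings: the conic
    [x^2 = y z], the plane cubic [x^3 = x y^2 + c y z^2], and the space quartic
    [q^2 = al p^2 + be r^2], [s^2 = be p^2 + al r^2], in which the quadrics through the
    first curve are diagonal. Each model is finite over a line, and its coordinate ring
    is a free module over the binary forms on that line with a short basis of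
    monomials. Computing this normal form modulo the ideal of the forms that vanish to
    first order on the curve ([homog_has_normal_form]) settles several questions
    together. Uniqueness of the normal form gives the Hilbert function, hence the degree
    and the arithmetic genus; it also shows that every form vanishing on the curve
    vanishes to first order along the kernel of the differentials of the given
    equations, so that nonsingularity is a Jacobian computation. The norm down to the
    line of a nonzero normal form is a nonzero polynomial: this is a descent at a branch
    point of the projection ([simple_root_nonsquare], [cubic_norm_eq0],
    [quartic_norm_eq0]), and it is here that [gamma^2 <> 16] separates the branch points
    of the quartic. Therefore a form that does not vanish on the curve has finitely many
    zeros on it, which implies irreducibility and dimension 1 ([curve_like]).

    Since all components are curves in this sense, an inclusion between two of them is
    an equality, and the decomposition follows once linear forms have told them apart
    ([curves_decompose]). *)

(** * Closed sets and curves in projective space *)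

Lemma pset_ext (k : closedFieldType) (n : nat) (X Y : pset k n) :
  peq X Y -> X = Y.
Proof.
move=> eqXY; apply: functional_extensionality => p.
exact: propositional_extensionality.
Qed.

Lemma closed_field_avoid (k : closedFieldType) (s : seq k) : exists a, a \notin s.
Proof.
pose P : {poly k} := \prod_(a <- 0 :: s) ('X - a%:P) + 1.
have /closed_rootP [a] : size P != 1%N.
  by rewrite size_polyDl size_prod_XsubC // size_poly1.
rewrite rootE hornerD hornerC addr_eq0 => ha; exists a; apply/negP => sa.
have : root (\prod_(a <- 0 :: s) ('X - a%:P)) a.
  by rewrite root_prod_XsubC inE sa orbT.
by rewrite rootE (eqP ha) oppr_eq0 oner_eq0.
Qed.

Section Evaluation.
Variables (k : closedFieldType) (n : nat).
Implicit Types (f g : {mpoly k[n.+1]}) (p : 'rV[k]_n.+1).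

Lemma evalpD f g p : evalp (f + g) p = evalp f p + evalp g p.
Proof. exact: mevalD. Qed.
Lemma evalpB f g p : evalp (f - g) p = evalp f p - evalp g p.
Proof. exact: mevalB. Qed.
Lemma evalpN f p : evalp (- f) p = - evalp f p.
Proof. exact: mevalN. Qed.
Lemma evalpM f g p : evalp (f * g) p = evalp f p * evalp g p.
Proof. exact: mevalM. Qed.
Lemma evalpZ c f p : evalp (c *: f) p = c * evalp f p.
Proof. exact: mevalZ. Qed.
Lemma evalpU j p : evalp 'X_j p = p 0 j.
Proof. exact: mevalXU. Qed.
Lemma evalpXn f m p : evalp (f ^+ m) p = evalp f p ^+ m.
Proof. exact: rmorphXn. Qed.
Lemma evalp1 p : evalp 1 p = 1.
Proof. exact: meval1. Qed.
Lemma evalp0 p : evalp 0 p = 0.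
Proof. exact: meval0. Qed.
Lemma evalp_sum (I : Type) (r : seq I) (P : pred I) (F : I -> {mpoly k[n.+1]}) p :
  evalp (\sum_(j <- r | P j) F j) p = \sum_(j <- r | P j) evalp (F j) p.
Proof. exact: raddf_sum. Qed.

Lemma evalp_scale d f (c : k) p :
  f \is d.-homog -> evalp f (c *: p) = c ^+ d * evalp f p.
Proof.
move=> /dhomogP hf; rewrite /evalp !mevalE mulr_sumr.
apply: eq_big_seq => m /hf hm.
rewrite mulrCA; congr (_ * _).
under eq_bigr do rewrite mxE exprMn.
by rewrite big_split /= prodrXr -mdegE hm.
Qed.

End Evaluation.

Section Curves.
Variables (k : closedFieldType) (n : nat).
Implicit Types (X Y Z : pset k n) (p q : 'rV[k]_n.+1).

Lemma zclosed_neq0 X p : zclosed X -> X p -> p != 0.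
Proof. by case=> S [_ XS] /XS []. Qed.

Lemma zclosed_scale X p c : zclosed X -> c != 0 -> X p -> X (c *: p).
Proof.
case=> S [homS XS] c0 /XS [p0 Sp]; apply/XS; split.
  by rewrite scaler_eq0 negb_or c0.
by move=> f Sf; have [d hf] := homS f Sf; rewrite (evalp_scale _ _ hf) Sp ?mulr0.
Qed.

Lemma zclosed_sub X p q : zclosed X -> X q -> p != 0 -> (p <= q)%MS -> X p.
Proof.
move=> clX Xq p0 /sub_rVP [c pE]; rewrite pE; apply: zclosed_scale => //.
by apply: contraNneq p0 => c0; rewrite pE c0 scale0r.
Qed.

Lemma zclosed0 : @zclosed k n (fun _ => False).
Proof.
exists (fun f => f = 1); split.
  by move=> f ->; exists 0%N; apply: dhomog1.
move=> p; split=> // -[_ /(_ 1 erefl)].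
by rewrite evalp1 => /eqP; rewrite oner_eq0.
Qed.

Lemma zclosedU X Y : zclosed X -> zclosed Y -> zclosed (fun p => X p \/ Y p).
Proof.
move=> [S [homS XS]] [T [homT YT]].
exists (fun h => exists f g, [/\ S f, T g & h = f * g]); split.
  move=> h [f [g [Sf Tg ->]]].
  have [d hf] := homS f Sf; have [e hg] := homT g Tg.
  by exists (d + e)%N; apply: dhomogM.
move=> p; split.
  case=> [/XS|/YT] [p0 Hp]; split=> // h [f [g [Sf Tg ->]]]; rewrite evalpM.
    by rewrite (Hp f) ?mul0r.
  by rewrite (Hp g) ?mulr0.
move=> [p0 Hp]; case: (classic (X p)) => Xp; [by left | right].
apply/YT; split=> // g Tg.
have [f [Sf fp]] : exists f, S f /\ evalp f p <> 0.
  apply: NNPP => no; apply: Xp; apply/XS; split=> // f Sf.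
  by apply: NNPP => fp; apply: no; exists f.
have /eqP := Hp (f * g) (ex_intro _ f (ex_intro _ g (And3 Sf Tg erefl))).
by rewrite evalpM mulf_eq0 => /orP [/eqP|/eqP].
Qed.

Lemma zclosed_peq X Y : peq X Y -> zclosed X -> zclosed Y.
Proof. by move=> /pset_ext ->. Qed.

Definition point q : pset k n := fun p => p != 0 /\ (p <= q)%MS.

Lemma zclosed_point q : q != 0 -> zclosed (point q).
Proof.
move=> q0; exists (fun f => exists a b, f = q 0 b *: 'X_a - q 0 a *: 'X_b); split.
  move=> f [a [b ->]]; exists 1%N.
  by apply: rpredB; apply: dhomogZ; rewrite dhomogX /= mdeg1.
move=> p; split=> [[p0 /sub_rVP [c pE]]|[p0 Hp]]; split=> //.
  move=> f [a [b ->]]; rewrite evalpB !evalpZ !evalpU pE !mxE; ring.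
have [b qb] : exists b, q 0 b != 0.
  apply: NNPP => no; case/negP: q0; apply/eqP/rowP => b; rewrite mxE.
  by apply/eqP/negPn/negP => qb; apply: no; exists b.
apply/sub_rVP; exists (p 0 b / q 0 b); apply/rowP => a; rewrite mxE.
have /eqP := Hp _ (ex_intro _ a (ex_intro _ b erefl)).
rewrite evalpB !evalpZ !evalpU subr_eq0 => /eqP E.
by rewrite mulrAC [_ * q 0 a]mulrC -E mulrAC divff ?mul1r.
Qed.

(** Finiteness is up to scalars, because the points of a projective set are given by
    all their coordinate rows. *)
Definition proj_finite X :=
  exists s : seq 'rV[k]_n.+1, forall p, X p -> exists2 q, q \in s & (p <= q)%MS.

Lemma proj_finite_sub X Y : psub X Y -> proj_finite Y -> proj_finite X.
Proof. by move=> XY [s Ys]; exists s => p /XY /Ys. Qed.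

Lemma proj_finiteU X Y :
  proj_finite X -> proj_finite Y -> proj_finite (fun p => X p \/ Y p).
Proof.
move=> [s Xs] [t Yt]; exists (s ++ t) => p [/Xs|/Yt] [q qs pq]; exists q => //;
  by rewrite mem_cat qs ?orbT.
Qed.

Lemma proj_finite_bigU (I : eqType) (r : seq I) (X : I -> pset k n) :
  (forall a, proj_finite (X a)) ->
  proj_finite (fun p => exists2 a, a \in r & X a p).
Proof.
move=> finX; elim: r => [|a r IH]; first by exists [::] => p [].
apply: proj_finite_sub (proj_finiteU (finX a) IH) => p [b].
by rewrite inE => /predU1P [-> | br] Xp; [left | right; exists b].
Qed.

(** What is used of an irreducible curve: a form cuts out on it either everything or
    finitely many points. These facts are easy to check on explicit models and to
    transport along linear embeddings, and they imply irreducibility, dimension 1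
    and the rigidity of inclusions. *)
Definition curve_like X :=
  [/\ zclosed X, ~ proj_finite X &
      forall f, homogeneous f -> ~ vanishes_on f X ->
        proj_finite (fun p => X p /\ evalp f p = 0)].

Lemma nonvanishing_form X Y :
  zclosed X -> zclosed Y -> ~ psub Y X ->
  exists f, [/\ homogeneous f, vanishes_on f X & ~ vanishes_on f Y].
Proof.
move=> [S [homS XS]] clY nYX; apply: NNPP => no; apply: nYX => p Yp.
apply/XS; split; first exact: zclosed_neq0 Yp.
move=> f Sf; apply: NNPP => fp; apply: no; exists f; split; first exact: homS.
- by move=> q /XS [_]; apply.
- by move=> /(_ p Yp).
Qed.

(** Some equation of [Y] does not vanish on [X], and cuts it in finitely many points. *)
Lemma curve_like_proper X Y :
  curve_like X -> zclosed Y -> psub Y X -> ~ psub X Y -> proj_finite Y.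
Proof.
move=> [clX _ finX] clY YX nXY.
have [f [homf fY fX]] := nonvanishing_form clY clX nXY.
by apply: proj_finite_sub (finX f homf fX) => p Yp; split; [apply: YX | apply: fY].
Qed.

(** Two curves of which one contains the other are equal, since [X] is infinite; this
    halves the comparisons between components. *)
Lemma curve_like_sub X Y : curve_like X -> curve_like Y -> psub X Y -> peq X Y.
Proof.
move=> [clX infX _] cY XY p; split; first exact: XY.
apply: NNPP => nYX; apply: infX; apply: (curve_like_proper cY) => // YX.
by apply: nYX; apply: YX.
Qed.

(** If two closed sets cover [X] and neither contains it, then forms that vanish on
    them cut [X] in two finite sets that cover it. *)
Lemma curve_like_irreducible X : curve_like X -> irreducible X.
Proof.
move=> [clX infX finX]; split=> //.
  by apply: NNPP => no; apply: infX; exists [::] => p Xp; case: no; exists p.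
move=> Y Z clY clZ XYZ.
case: (classic (psub X Y)) => XY; [by left | right].
apply: NNPP => XZ; apply: infX.
have [f [homf fY fX]] := nonvanishing_form clY clX XY.
have [g [homg gZ gX]] := nonvanishing_form clZ clX XZ.
apply: proj_finite_sub (proj_finiteU (finX f homf fX) (finX g homg gX)) => p Xp.
by case: (XYZ p Xp) => [/fY|/gZ]; [left | right].
Qed.

(** Points are closed, so an irreducible finite set is one of its points; the induction
    removes superfluous representatives one at a time. *)
Lemma irreducible_finite X :
  irreducible X -> proj_finite X -> exists2 q, q != 0 & peq X (point q).
Proof.
move=> [clX [x Xx] irrX] [s Xs].
have clU (r : seq 'rV[k]_n.+1) :
    zclosed (fun p => exists2 q, q \in r & q != 0 /\ point q p).
  elim: r => [|a r IH]; first by apply: zclosed_peq zclosed0 => p; split=> // -[].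
  have [-> | a0] := eqVneq a 0.
    apply: zclosed_peq IH => p; split=> [[q qr Hq]|[q]].
      by exists q; rewrite // inE qr orbT.
    by rewrite inE => /predU1P [->|qr] [q0 Hq]; [rewrite eqxx in q0 | exists q].
  apply: zclosed_peq (zclosedU (zclosed_point a0) IH) => p; split.
    case=> [ap|[q qr Hq]]; first by exists a; rewrite ?mem_head.
    by exists q; rewrite // inE qr orbT.
  case=> q; rewrite inE => /predU1P [->|qr] [q0 Hq]; [by left | right].
  by exists q.
have {Xs} : forall p, X p -> exists2 q, q \in s & q != 0 /\ point q p.
  move=> p Xp; have p0 := zclosed_neq0 clX Xp.
  have [q qs pq] := Xs p Xp; exists q => //; split=> //.
  by apply: contraNneq p0 => q0; case/sub_rVP: pq => c ->; rewrite q0 scaler0.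
elim: s => [/(_ x Xx) [] // | a r IH Xs].
have [a0 | a0] := eqVneq a 0.
  apply: IH => p /Xs [q]; rewrite inE => /predU1P [->|qr] [q0 Hq].
    by rewrite a0 eqxx in q0.
  by exists q.
case: (irrX _ _ (zclosed_point a0) (clU r)).
- move=> p /Xs [q]; rewrite inE => /predU1P [->|qr] [q0 Hq]; [by left | right].
  by exists q.
- move=> Xa; exists a => // p; split; [exact: Xa | move=> [p0 pa]].
  have [x0 xa] := Xa x Xx; apply: zclosed_sub Xx _ _ => //.
  move/sub_rVP: xa => [c xE]; have c0 : c != 0.
    by apply: contraNneq x0 => c0; rewrite xE c0 scale0r.
  by apply: submx_trans pa _; rewrite xE (eqmx_scale _ c0).
- by move=> /IH.
Qed.

Lemma point_irreducible q : q != 0 -> irreducible (point q).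
Proof.
move=> q0; split; first exact: zclosed_point.
  by exists q; split; rewrite ?submx_refl.
move=> Y Z clY clZ qYZ.
have : point q q by split; rewrite ?submx_refl.
by case/qYZ => [Yq|Zq]; [left|right] => p [p0 pq];
  [apply: zclosed_sub Yq _ _ | apply: zclosed_sub Zq _ _].
Qed.

(** A proper closed subset of the curve is finite, hence a point when it is
    irreducible, and a point has no irreducible proper subset. *)
Lemma curve_like_dim X : curve_like X -> has_dim X 1.
Proof.
move=> cX; have irrX := curve_like_irreducible cX.
have [clX infX _] := cX; have [_ [x Xx] _] := irrX.
have x0 := zclosed_neq0 clX Xx; split.
  exists (fun j => if j is 0%N then point x else X); split.
    case=> [|j] _ /=; split=> //; first exact: point_irreducible.
    by move=> p [p0 px]; apply: zclosed_sub Xx _ _.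
  case=> [|//] _ /=; split; first by move=> p [p0 px]; apply: zclosed_sub Xx _ _.
  move=> Xsub; apply: infX; exists [:: x] => p /Xsub [_ px].
  by exists x; rewrite ?mem_head.
move=> [Z [irrZ chZ]].
have [irr0 _] := irrZ 0%N isT; have [irr1 _] := irrZ 1%N isT.
have [irr2 sub2] := irrZ 2%N isT.
have [sub01 n01] := chZ 0%N isT; have [sub12 n12] := chZ 1%N isT.
have [cl1 _ _] := irr1; have [cl0 [z Zz] _] := irr0; have [cl2 _ _] := irr2.
have fin1 : proj_finite (Z 1%N).
  apply: (curve_like_proper cX) => //.
    by move=> p /sub12 /sub2.
  by move=> X1; apply: n12 => p /sub2 /X1.
have [q q0 Z1q] := irreducible_finite irr1 fin1.
have /Z1q [z0 /sub_rVP [c zE]] := sub01 z Zz.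
have c0 : c != 0 by apply: contraNneq z0 => c0; rewrite zE c0 scale0r.
apply: n01 => p /Z1q [p0 pq]; apply: (zclosed_sub cl0 Zz) => //.
by apply: submx_trans pq _; rewrite zE (eqmx_scale _ c0).
Qed.

End Curves.

(** * Derivatives of a form along a vector *)

Section DirectionalDerivative.
Variables (k : closedFieldType) (n : nat).
Implicit Types (f g : {mpoly k[n.+1]}) (p v : 'rV[k]_n.+1).

Definition dirderiv f p v := \sum_(j < n.+1) evalp (f^`M(j)) p * v 0 j.

Lemma dirderivD f g p v : dirderiv (f + g) p v = dirderiv f p v + dirderiv g p v.
Proof.
rewrite /dirderiv -big_split; apply: eq_bigr => j _.
by rewrite mderivD evalpD mulrDl.
Qed.

Lemma dirderivZ c f p v : dirderiv (c *: f) p v = c * dirderiv f p v.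
Proof.
rewrite /dirderiv mulr_sumr; apply: eq_bigr => j _.
by rewrite mderivZ evalpZ mulrA.
Qed.

Lemma dirderivN f p v : dirderiv (- f) p v = - dirderiv f p v.
Proof. by rewrite -scaleN1r dirderivZ mulN1r. Qed.

Lemma dirderivB f g p v : dirderiv (f - g) p v = dirderiv f p v - dirderiv g p v.
Proof. by rewrite dirderivD dirderivN. Qed.

Lemma dirderivM f g p v :
  dirderiv (f * g) p v = dirderiv f p v * evalp g p + evalp f p * dirderiv g p v.
Proof.
rewrite /dirderiv mulr_suml mulr_sumr -big_split; apply: eq_bigr => j _ /=.
by rewrite mderivM evalpD !evalpM mulrDl mulrAC mulrA.
Qed.

Lemma dirderivU l p v : dirderiv 'X_l p v = v 0 l.
Proof.
rewrite /dirderiv (bigD1 l) //= big1 ?addr0 => [|j jl].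
  by rewrite mderivX mnm1E eqxx scale1r -[X in (X - _)%MM]add0m addmK mpolyX0 evalp1 mul1r.
by rewrite mderivX mnm1E eq_sym (negPf jl) scale0r evalp0 mul0r.
Qed.

Lemma dirderivC c p v : dirderiv c%:MP p v = 0.
Proof. by rewrite /dirderiv big1 // => j _; rewrite mderivC evalp0 mul0r. Qed.

Lemma dirderiv1 p v : dirderiv 1 p v = 0.
Proof. exact: dirderivC. Qed.

Lemma dirderiv0 p v : dirderiv 0 p v = 0.
Proof. exact: dirderivC. Qed.

Lemma dirderiv_sum (I : Type) (s : seq I) (F : I -> {mpoly k[n.+1]}) p v :
  dirderiv (\sum_(a <- s) F a) p v = \sum_(a <- s) dirderiv (F a) p v.
Proof. exact: (big_morph _ (fun f g => dirderivD f g p v) (dirderiv0 p v)). Qed.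

Lemma dirderivXn f m p v :
  dirderiv (f ^+ m.+1) p v = m.+1%:R * evalp f p ^+ m * dirderiv f p v.
Proof.
elim: m => [|m IH]; first by rewrite expr1 expr0 !mul1r.
by rewrite exprS dirderivM IH evalpXn -[m.+2]addn1 natrD exprS; ring.
Qed.

End DirectionalDerivative.

Lemma mpoly_ring_ind (R : comNzRingType) (n : nat) (P : {mpoly R[n]} -> Prop) :
  (forall c, P c%:MP) -> (forall j, P 'X_j) ->
  (forall f g, P f -> P g -> P (f + g)) ->
  (forall f g, P f -> P g -> P (f * g)) -> forall f, P f.
Proof.
move=> PC PX PD PM f; rewrite [f]mpolyE.
apply: big_ind => [||m _]; [by rewrite -mpolyC0 | exact: PD |].
rewrite -mul_mpolyC; apply: (PM) => //.
rewrite mpolyXE_id; apply: big_ind => [||j _]; [by rewrite -mpolyC1 | exact: PM |].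
elim: (m j) => [|e IH]; first by rewrite expr0 -mpolyC1.
by rewrite exprS; apply: (PM).
Qed.

(** * Normal forms over the binary forms of a line *)

Section NormalForms.
Variables (k : closedFieldType) (n : nat).
Variables (gens : seq {mpoly k[n.+1]}) (y z : 'I_n.+1).
Variables (r : nat) (e : 'I_r -> {mpoly k[n.+1]}) (dg : 'I_r -> nat).
Implicit Types (F G : {poly k}) (Fs Gs : 'I_r -> {poly k}) (f g : {mpoly k[n.+1]}) (p v : 'rV[k]_n.+1).

Let C : pset k n := zlocus gens.

Definition tangent (p v : 'rV[k]_n.+1) := forall g, g \in gens -> dirderiv g p v = 0.

(** The forms that vanish on the curve to first order along its tangent vectors.
    Working modulo this ideal, instead of modulo the functions vanishing on the
    curve, makes one normal form computation yield both the coordinate ring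
    and the tangent spaces. *)
Definition vanishes_to_first_order f :=
  forall p v, C p -> tangent p v -> evalp f p = 0 /\ dirderiv f p v = 0.
Let J := vanishes_to_first_order.

Lemma first_orderD f g : J f -> J g -> J (f + g).
Proof.
move=> Jf Jg p v Cp Tv; have [f0 f1] := Jf p v Cp Tv; have [g0 g1] := Jg p v Cp Tv.
by rewrite evalpD dirderivD f0 f1 g0 g1 addr0.
Qed.

Lemma first_orderM f g : J g -> J (f * g).
Proof.
move=> Jg p v Cp Tv; have [g0 g1] := Jg p v Cp Tv.
by rewrite evalpM dirderivM g0 g1 !mulr0 addr0.
Qed.

Lemma first_order0 : J 0.
Proof. by move=> p v _ _; rewrite evalp0 dirderiv0. Qed.

Lemma first_orderN f : J f -> J (- f).
Proof. by rewrite -mulN1r; apply: first_orderM. Qed.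

Lemma first_orderZ c f : J f -> J (c *: f).
Proof. by rewrite -mul_mpolyC; apply: first_orderM. Qed.

Lemma first_order_gen g : g \in gens -> J g.
Proof. by move=> gg p v [_ /(_ g gg) g0] /(_ g gg) g1. Qed.

(** Binary forms are encoded by their dehomogenizations [F], to which the theory of
    polynomials in one variable applies. *)
Definition binary_form (d : nat) (F : {poly k}) : {mpoly k[n.+1]} :=
  \sum_(i < d.+1) F`_i *: ('X_y ^+ i * 'X_z ^+ (d - i)).

Lemma binary_formD d F G : binary_form d (F + G) = binary_form d F + binary_form d G.
Proof.
by rewrite /binary_form -big_split; apply: eq_bigr => i _; rewrite coefD scalerDl.
Qed.

Lemma binary_formZ d c F : binary_form d (c *: F) = c *: binary_form d F.
Proof.
by rewrite /binary_form scaler_sumr; apply: eq_bigr => i _; rewrite coefZ scalerA.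
Qed.

Lemma binary_form0 d : binary_form d 0 = 0.
Proof. by rewrite -[0](scale0r 0) binary_formZ scale0r. Qed.

Lemma binary_form_mulY d F : 'X_y * binary_form d F = binary_form d.+1 ('X * F).
Proof.
rewrite /binary_form [RHS]big_ord_recl coefXM eqxx scale0r add0r mulr_sumr.
apply: eq_bigr => i _ /=.
by rewrite -scalerAr coefXM /= /bump /= add1n subSS mulrA -exprS.
Qed.

Lemma binary_form_mulZ d F :
  (size F <= d.+1)%N -> 'X_z * binary_form d F = binary_form d.+1 F.
Proof.
move=> sF; rewrite /binary_form [RHS]big_ord_recr /= nth_default // scale0r addr0.
rewrite mulr_sumr; apply: eq_bigr => i _ /=.
by rewrite -scalerAr mulrCA -exprS subSn // -ltnS.
Qed.

Lemma evalp_binary_form d F p :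
  (size F <= d.+1)%N -> p 0 z = 1 -> evalp (binary_form d F) p = F.[p 0 y].
Proof.
move=> sF pz; rewrite (horner_coef_wide _ sF) evalp_sum; apply: eq_bigr => i _.
by rewrite evalpZ evalpM !evalpXn !evalpU pz expr1n mulr1.
Qed.

Definition normal_form (d : nat) Fs := \sum_j e j * binary_form (d - dg j) (Fs j).

(** The truncated difference forces [Fs j = 0] when the degree of [e j] exceeds [d]. *)
Definition bounded (d : nat) Fs := forall j, (size (Fs j) <= d.+1 - dg j)%N.

Lemma bounded_degree d Fs j : bounded d Fs -> Fs j != 0 -> (dg j <= d)%N.
Proof.
rewrite -size_poly_gt0 => /(_ j) bF F0.
by rewrite -ltnS -subn_gt0; apply: leq_trans bF.
Qed.

Definition has_normal_form (d : nat) (f : {mpoly k[n.+1]}) :=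
  exists2 Fs, bounded d Fs & J (f - normal_form d Fs).
Let M := has_normal_form.

Lemma has_normal_form_mod d f g : J (f - g) -> M d g -> M d f.
Proof.
move=> Jfg [F bF JF]; exists F => //.
by rewrite -(subrKA g); apply: first_orderD.
Qed.

Lemma has_normal_form0 d : M d 0.
Proof.
exists (fun=> 0) => [j|]; first by rewrite size_poly0.
rewrite sub0r; apply: first_orderN; rewrite /normal_form big1 => [|j _].
  exact: first_order0.
by rewrite binary_form0 mulr0.
Qed.

Lemma has_normal_formD d f g : M d f -> M d g -> M d (f + g).
Proof.
move=> [F bF JF] [G bG JG]; exists (fun j => F j + G j) => [j|].
  by apply: leq_trans (size_polyD _ _) _; rewrite geq_max bF bG.
have -> : normal_form d (fun j => F j + G j) = normal_form d F + normal_form d G.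
  by rewrite /normal_form -big_split; apply: eq_bigr => j _; rewrite binary_formD mulrDr.
by rewrite opprD addrACA; apply: first_orderD.
Qed.

Lemma normal_formZ d c Fs :
  normal_form d (fun j => c *: Fs j) = c *: normal_form d Fs.
Proof.
rewrite /normal_form scaler_sumr; apply: eq_bigr => j _.
by rewrite binary_formZ scalerAr.
Qed.

Lemma has_normal_formZ d c f : M d f -> M d (c *: f).
Proof.
move=> [F bF JF]; exists (fun j => c *: F j) => [j|].
  exact: leq_trans (size_scale_leq _ _) (bF j).
by rewrite normal_formZ -scalerBr; apply: first_orderZ.
Qed.

Lemma has_normal_form_sum d (I : Type) (s : seq I) (P : pred I)
    (f : I -> {mpoly k[n.+1]}) :
  (forall a, P a -> M d (f a)) -> M d (\sum_(a <- s | P a) f a).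
Proof.
by move=> Mf; apply: big_ind => //; [apply: has_normal_form0 | apply: has_normal_formD].
Qed.

Lemma has_normal_form_mulY d f : M d f -> M d.+1 ('X_y * f).
Proof.
move=> [F bF JF]; exists (fun j => 'X * F j) => [j|].
  have [->|Fj0] := eqVneq (F j) 0; first by rewrite mulr0 size_poly0.
  have le_d := bounded_degree bF Fj0.
  by rewrite mulrC size_mulX // subSn ?ltnS ?bF // leqW.
have -> : normal_form d.+1 (fun j => 'X * F j) = 'X_y * normal_form d F.
  rewrite /normal_form mulr_sumr; apply: eq_bigr => j _; rewrite mulrCA.
  have [->|Fj0] := eqVneq (F j) 0; first by rewrite mulr0 !binary_form0 !mulr0.
  by rewrite binary_form_mulY -subSn // (bounded_degree bF Fj0).
by rewrite -mulrBr; apply: first_orderM.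
Qed.

Lemma has_normal_form_mulZ d f : M d f -> M d.+1 ('X_z * f).
Proof.
move=> [F bF JF]; exists F => [j|].
  by apply: leq_trans (bF j) _; apply: leq_sub2r.
have -> : normal_form d.+1 F = 'X_z * normal_form d F.
  rewrite /normal_form mulr_sumr; apply: eq_bigr => j _; rewrite mulrCA.
  have [Fj0|Fj0] := eqVneq (F j) 0; first by rewrite Fj0 !binary_form0 !mulr0.
  have le_d := bounded_degree bF Fj0.
  by rewrite binary_form_mulZ -subSn.
by rewrite -mulrBr; apply: first_orderM.
Qed.

Lemma has_normal_form_basis j : M (dg j) (e j).
Proof.
exists (fun a => if a == j then 1 else 0) => [a|].
  by case: eqP => [->|_]; rewrite ?size_poly0 // size_poly1 subSnn.
rewrite /normal_form (bigD1 j) //= eqxx big1 => [|a /negPf ->]; last first.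
  by rewrite binary_form0 mulr0.
rewrite subnn /binary_form big_ord_recl big_ord0 /= !expr0 coef1 mulr1 scale1r !addr0 mulr1 subrr.
exact: first_order0.
Qed.

Lemma has_normal_form_mulY_iter d m f : M d f -> M (d + m) ('X_y ^+ m * f).
Proof.
move=> Mf; elim: m => [|m IH]; first by rewrite addn0 mul1r.
by rewrite addnS exprS -mulrA; apply: has_normal_form_mulY.
Qed.

Lemma has_normal_form_mulZ_iter d m f : M d f -> M (d + m) ('X_z ^+ m * f).
Proof.
move=> Mf; elim: m => [|m IH]; first by rewrite addn0 mul1r.
by rewrite addnS exprS -mulrA; apply: has_normal_form_mulZ.
Qed.

Hypothesis normal1 : M 0 1.
Hypothesis normal_step : forall l j, M (dg j).+1 ('X_l * e j).

(** The hypothesis gives the normal form of ['X_l * e j]; multiplying further by a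
    binary form only uses the two easy multiplications. *)
Lemma has_normal_form_mulX d l f : M d f -> M d.+1 ('X_l * f).
Proof.
move=> [F bF JF]; apply: (@has_normal_form_mod _ _ ('X_l * normal_form d F)).
  by rewrite -mulrBr; apply: first_orderM.
rewrite mulr_sumr; apply: has_normal_form_sum => j _.
have [->|Fj0] := eqVneq (F j) 0.
  by rewrite binary_form0 !mulr0; apply: has_normal_form0.
have le_d := bounded_degree bF Fj0.
rewrite mulrA mulr_sumr; apply: has_normal_form_sum => i _.
rewrite -scalerAr; apply: has_normal_formZ.
have -> : d.+1 = ((dg j).+1 + (d - dg j - i) + i)%N.
  by rewrite -addnA subnK 1?addSn ?subnKC // -ltnS.
rewrite mulrC -mulrA.
by apply: has_normal_form_mulY_iter; apply: has_normal_form_mulZ_iter.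
Qed.

Lemma homog_has_normal_form d f : f \is d.-homog -> M d f.
Proof.
move=> /dhomogP hf; rewrite [f]mpolyE big_seq; apply: has_normal_form_sum => m /hf.
move=> hm; apply: has_normal_formZ; elim: d m hm {hf} => [|d IH] m.
  by move/eqP; rewrite mdeg_eq0 => /eqP ->; rewrite mpolyX0.
move=> hm; have {}hm : mdeg m = d.+1 := hm.
have [l ml] : exists l, (0 < m l)%N.
  apply: NNPP => no; move: hm; rewrite mdegE big1 // => l _.
  by apply/eqP; rewrite -leqn0 leqNgt; apply/negP => ml; apply: no; exists l.
have mE : m = (U_(l) + (m - U_(l)))%MM.
  by rewrite addmC submK //; apply/mnm_lepP => j; rewrite mnm1E; case: eqP => // <-.
rewrite mE mpolyXD; apply: has_normal_form_mulX; apply: IH.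
by apply: succn_inj; rewrite -hm {2}mE mdegD mdeg1.
Qed.

End NormalForms.

(** * Curves that are finite over a line *)

(** A curve that projects onto the line with homogeneous coordinates [y : z], so that
    its coordinate ring is free over the ring of binary forms, with basis [e].
    The polynomial in [fiber_norm] is the norm down to the line, in the chart [z = 1]:
    that it is nonzero expresses that the coordinate ring is a domain. *)
Record finite_over_line (k : closedFieldType) (n : nat)
    (gens : seq {mpoly k[n.+1]}) (y z : 'I_n.+1)
    (r : nat) (e : 'I_r -> {mpoly k[n.+1]}) (dg : 'I_r -> nat) : Prop := {
  gens_homog : forall g, g \in gens -> homogeneous g;
  basis_homog : forall j, e j \is (dg j).-homog;
  normal1 : has_normal_form gens y z e dg 0 1;
  normal_step : forall l j, has_normal_form gens y z e dg (dg j).+1 ('X_l * e j);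
  fiber_norm : forall Fs : 'I_r -> {poly k}, (exists j, Fs j != 0) ->
    exists2 N : {poly k}, N != 0 &
      forall p, zlocus gens p -> p 0 z = 1 ->
        \sum_j evalp (e j) p * (Fs j).[p 0 y] = 0 -> N.[p 0 y] = 0;
  fiber_finite : forall a b, exists s : seq 'rV[k]_n.+1,
    forall p, zlocus gens p -> p 0 y = a -> p 0 z = b -> p \in s;
  fiber_nonempty : forall a, exists p, [/\ zlocus gens p, p 0 y = a & p 0 z = 1];
  center_missed : forall p, zlocus gens p -> p 0 y = 0 -> p 0 z = 0 -> False
}.

Section FiniteOverLine.
Variables (k : closedFieldType) (n : nat).
Variables (gens : seq {mpoly k[n.+1]}) (y z : 'I_n.+1).
Variables (r : nat) (e : 'I_r -> {mpoly k[n.+1]}) (dg : 'I_r -> nat).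
Hypothesis CL : finite_over_line gens y z e dg.
Implicit Types (Fs : 'I_r -> {poly k}) (f g : {mpoly k[n.+1]}) (p v : 'rV[k]_n.+1).

Let C : pset k n := zlocus gens.

Lemma zlocus_closed : zclosed C.
Proof.
exists (fun f => f \in gens); split; first exact: gens_homog CL.
by move=> p; split.
Qed.

Lemma eval_normal_form d f Fs p :
  vanishes_to_first_order gens (f - normal_form y z e dg d Fs) -> C p ->
  evalp f p = evalp (normal_form y z e dg d Fs) p.
Proof.
move=> Jf Cp; apply/eqP; rewrite -subr_eq0 -evalpB.
have [|->] // := Jf p 0 Cp.
by move=> g _; rewrite /dirderiv big1 // => j _; rewrite mxE mulr0.
Qed.

Lemma eval_affine_normal_form d Fs p : bounded dg d Fs -> p 0 z = 1 ->
  evalp (normal_form y z e dg d Fs) p = \sum_j evalp (e j) p * (Fs j).[p 0 y].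
Proof.
move=> bF pz; rewrite evalp_sum; apply: eq_bigr => j _; rewrite evalpM.
have [->|Fj0] := eqVneq (Fs j) 0; first by rewrite binary_form0 evalp0 horner0.
rewrite evalp_binary_form // -subSn //.
exact: bounded_degree bF Fj0.
Qed.

(** Every value of the affine coordinate [y / z] is attained on the curve. *)
Lemma infinite_curve : ~ proj_finite C.
Proof.
move=> [s Cs]; have [a] := closed_field_avoid [seq (q : 'rV[k]_n.+1) 0 y / q 0 z | q <- s].
have [p [Cp py pz]] := fiber_nonempty CL a.
have [q qs /sub_rVP [c pE]] := Cs p Cp; case/negP; apply/mapP; exists q => //.
move: py pz; rewrite pE !mxE => <- cz.
have c0 : c != 0 by apply: contra_eq_neq cz => ->; rewrite mul0r eq_sym oner_eq0.
have qz0 : q 0 z != 0 by apply: contra_eq_neq cz => ->; rewrite mulr0 eq_sym oner_eq0.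
have -> : c = (q 0 z)^-1 by apply: (mulIf qz0); rewrite cz mulVf.
by rewrite mulrC.
Qed.

Lemma vanishing_of_normal_form0 d f Fs :
  vanishes_to_first_order gens (f - normal_form y z e dg d Fs) ->
  (forall j, Fs j = 0) -> vanishes_to_first_order gens f.
Proof.
move=> Jf F0; rewrite -[f](subr0 f) -[0](_ : normal_form y z e dg d Fs = 0) //.
by rewrite /normal_form big1 // => j _; rewrite F0 binary_form0 mulr0.
Qed.

(** The zeros lie above the roots of the norm or above the point at infinity of the
    line, and the fibers are finite. *)
Lemma finite_zeros d f Fs :
  f \is d.-homog -> bounded dg d Fs ->
  vanishes_to_first_order gens (f - normal_form y z e dg d Fs) ->
  (exists j, Fs j != 0) -> proj_finite (fun p => C p /\ evalp f p = 0).
Proof.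
move=> homf bF Jf /(fiber_norm CL) [N N0 Np].
have [rs Nrs] := closed_field_poly_normal N.
have fibfin a b : proj_finite (fun p => [/\ C p, p 0 y = a & p 0 z = b]).
  have [s Cs] := fiber_finite CL a b; exists s => p [Cp py pz]; exists p => //.
  exact: Cs.
have := proj_finiteU (fibfin 1 0) (proj_finite_bigU rs (fibfin^~ 1)).
move=> [s sP]; exists s => p [Cp fp].
have scaled c (c0 : c != 0) : (exists2 q, q \in s & (c *: p <= q)%MS) ->
    exists2 q, q \in s & (p <= q)%MS.
  by move=> [q qs pq]; exists q => //; rewrite (eqmx_scale _ c0) in pq.
have Cc c (c0 : c != 0) : C (c *: p) by apply: zclosed_scale zlocus_closed c0 Cp.
have [pz|pz] := eqVneq (p 0 z) 0.
  have py : p 0 y != 0 by apply/eqP => py; apply: (center_missed CL Cp).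
  have py' : (p 0 y)^-1 != 0 by rewrite invr_eq0.
  apply: (scaled _ py'); apply: sP; left; split; first exact: Cc.
    by rewrite mxE mulVf.
  by rewrite mxE pz mulr0.
have pz' : (p 0 z)^-1 != 0 by rewrite invr_eq0.
have qz : ((p 0 z)^-1 *: p) 0 z = 1 by rewrite mxE mulVf.
apply: (scaled _ pz'); apply: sP; right; exists (((p 0 z)^-1 *: p) 0 y).
  have : root N (((p 0 z)^-1 *: p) 0 y).
    apply/eqP; apply: Np => //; first exact: Cc.
    rewrite -(eval_affine_normal_form bF qz) -(eval_normal_form Jf (Cc _ pz')).
    by rewrite (evalp_scale _ _ homf) fp mulr0.
  by rewrite Nrs rootZ ?lead_coef_eq0 // root_prod_XsubC.
by split=> //; apply: Cc.
Qed.

(** A form with a nonzero normal form has finitely many zeros on the curve, which is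
    infinite. *)
Lemma vanishing_normal_form d f Fs :
  f \is d.-homog -> bounded dg d Fs ->
  vanishes_to_first_order gens (f - normal_form y z e dg d Fs) ->
  vanishes_on f C -> forall j, Fs j = 0.
Proof.
move=> homf bF Jf f0 j; apply/eqP/negPn/negP => Fj0; apply: infinite_curve.
have [s sP] : proj_finite (fun p => C p /\ evalp f p = 0).
  by apply: (finite_zeros homf bF Jf); exists j.
by exists s => p Cp; apply: sP; split; last exact: f0.
Qed.

Lemma vanishing_first_order f :
  homogeneous f -> vanishes_on f C -> vanishes_to_first_order gens f.
Proof.
move=> [d homf] f0.
have [Fs bF Jf] := homog_has_normal_form (normal1 CL) (normal_step CL) homf.
exact: (vanishing_of_normal_form0 Jf (vanishing_normal_form homf bF Jf f0)).
Qed.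

Lemma finite_over_line_curve : curve_like C.
Proof.
split; [exact: zlocus_closed | exact: infinite_curve |].
move=> f [d homf] nf0.
have [Fs bF Jf] := homog_has_normal_form (normal1 CL) (normal_step CL) homf.
apply: (finite_zeros homf bF Jf); apply: NNPP => no; apply: nf0 => p Cp.
rewrite (eval_normal_form Jf Cp) evalp_sum big1 // => j _.
have -> : Fs j = 0 by apply/eqP/negPn/negP => Fj0; apply: no; exists j.
by rewrite binary_form0 mulr0 evalp0.
Qed.

(** The products of the basis elements [e j] with the monomials in [y] and [z] form a
    basis of each graded piece of the coordinate ring. *)
Lemma finite_over_line_hilbert d :
  hilbert_value C d (\sum_j (d.+1 - dg j)).
Proof.
pose T := {j : 'I_r & 'I_(d.+1 - dg j)}.
have cardT : #|{: T}| = (\sum_j (d.+1 - dg j))%N.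
  by rewrite card_tagged sumnE big_map big_enum; apply: eq_bigr => j _; rewrite card_ord.
rewrite -cardT.
pose b (t : T) := e (tag t) * ('X_y ^+ tagged t * 'X_z ^+ (d - dg (tag t) - tagged t)).
have le_d (t : T) : (dg (tag t) <= d)%N.
  by rewrite -ltnS -subn_gt0; apply: leq_ltn_trans (ltn_ord (tagged t)).
have le_i (t : T) : (tagged t <= d - dg (tag t))%N.
  by rewrite -ltnS -subSn // ltn_ord.
pose Fc (c : 'rV[k]_#|{: T}|) (j : 'I_r) : {poly k} :=
  \poly_(i < d.+1 - dg j)
    (if (insub i : option 'I_(d.+1 - dg j)) is Some i'
     then c 0 (enum_rank (Tagged (fun j => 'I_(d.+1 - dg j)) i')) else 0).
have bFc c : bounded dg d (Fc c) by move=> j; apply: size_poly.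
have Fc_coef c (t : T) : (Fc c (tag t))`_(tagged t) = c 0 (enum_rank t).
  by rewrite coef_poly ltn_ord valK; case: t.
have homb t : b t \is d.-homog.
  have -> : d = (dg (tag t) + (1 * tagged t + 1 * (d - dg (tag t) - tagged t)))%N.
    by rewrite !mul1n subnKC // subnKC.
  apply: dhomogM; first exact: basis_homog CL _.
  by apply: dhomogM; apply: dhomogMn; rewrite dhomogX /= mdeg1.
have nfE (c : 'rV[k]_#|{: T}|) : \sum_j c 0 j *: b (enum_val j) = normal_form y z e dg d (Fc c).
  rewrite (reindex_onto enum_rank enum_val) => [|j _]; last exact: enum_valK.
  rewrite (eq_bigl xpredT) => [|t]; last by rewrite enum_rankK eqxx.
  transitivity (\sum_j \sum_(i < d.+1 - dg j) (Fc c j)`_i *: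
      (e j * ('X_y ^+ i * 'X_z ^+ (d - dg j - i)))).
    rewrite sig_big_dep /=; apply: eq_bigr => t _.
    by rewrite enum_rankK Fc_coef.
  apply: eq_bigr => j _; rewrite mulr_sumr.
  have [le_dj|lt_dj] := leqP (dg j) d.
    by rewrite -subSn //; apply: eq_bigr => i _; rewrite scalerAr.
  have j0 : (d.+1 - dg j = 0)%N by apply/eqP; rewrite subn_eq0.
  have -> : Fc c j = 0 by apply/eqP; rewrite -size_poly_leq0 -j0 bFc.
  by rewrite !big1 // => i _; rewrite coef0 scale0r ?mulr0.
exists (fun j => b (enum_val j)); split=> [j|f homf]; first exact: homb.
have [Fs bF Jf] := homog_has_normal_form (normal1 CL) (normal_step CL) homf.
pose c0 : 'rV[k]_#|{: T}| := \row_j (Fs (tag (enum_val j : T)))`_(tagged (enum_val j : T)).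
have Fc0 j : Fc c0 j = Fs j.
  apply/polyP => i; rewrite coef_poly; case: ltnP => [lt_i|le_i'].
    by rewrite insubT mxE enum_rankK.
  by rewrite nth_default //; apply: leq_trans (bF j) le_i'.
have nf0 : normal_form y z e dg d (Fc c0) = normal_form y z e dg d Fs.
  by apply: eq_bigr => j _; rewrite Fc0.
exists c0; split=> [p Cp|c fc].
  by rewrite nfE nf0 evalpB (eval_normal_form Jf Cp) subrr.
apply/rowP => j; apply/eqP; rewrite -subr_eq0; apply/eqP.
have diff_van : vanishes_on (normal_form y z e dg d (Fc (c0 - c))) C.
  move=> p Cp; have := fc p Cp; rewrite nfE evalpB (eval_normal_form Jf Cp) -nf0 -!nfE.
  rewrite -evalpB -sumrB => <-; congr (evalp _ p); apply: eq_bigr => t _.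
  by rewrite !mxE scalerBl.
have Jdiff : vanishes_to_first_order gens (normal_form y z e dg d (Fc (c0 - c)) -
    normal_form y z e dg d (Fc (c0 - c))) by rewrite subrr; apply: first_order0.
have homdiff : normal_form y z e dg d (Fc (c0 - c)) \is d.-homog.
  by rewrite -nfE; apply: rpred_sum => t _; apply: rpredZ.
have := vanishing_normal_form homdiff (bFc _) Jdiff diff_van (tag (enum_val j : T)).
move/(congr1 (fun F : {poly k} => F`_(tagged (enum_val j : T)))).
by rewrite Fc_coef coef0 enum_valK !mxE.
Qed.

End FiniteOverLine.

(** * Tangent lines and linear embeddings *)

(** The tangent spaces of the whole homogeneous ideal, as subspaces of the space of
    coordinate rows: a tangent line has rank 2. *)
Definition has_tangent_lines (k : closedFieldType) (n : nat) (X : pset k n) :=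
  forall p, X p -> exists W : 'M[k]_n.+1, \rank W = 2 /\
    forall v : 'rV[k]_n.+1, (v <= W)%MS <->
      (forall f, homogeneous f -> vanishes_on f X -> dirderiv f p v = 0).

(** Forms that vanish on the curve have a zero normal form, hence vanish to first order
    along the common kernel of the differentials of the generators. *)
Lemma finite_over_line_tangent (k : closedFieldType) (n : nat)
    (gens : seq {mpoly k[n.+1]}) (y z : 'I_n.+1)
    (r : nat) (e : 'I_r -> {mpoly k[n.+1]}) (dg : 'I_r -> nat) :
  finite_over_line gens y z e dg ->
  (forall p, zlocus gens p -> exists W : 'M[k]_n.+1, \rank W = 2 /\
     forall v : 'rV[k]_n.+1, (v <= W)%MS <-> tangent gens p v) ->
  has_tangent_lines (zlocus gens).
Proof.
move=> CL tanC p Cp; have [W [rW Wtan]] := tanC p Cp; exists W; split=> // v.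
split=> [/Wtan Tv f homf f0 | Tv].
  by have [] := vanishing_first_order CL homf f0 Cp Tv.
apply/Wtan => g gg; apply: Tv; first exact: (gens_homog CL).
by move=> q [_ /(_ g gg)].
Qed.

Section LinearPullback.
Variables (k : closedFieldType) (m n : nat) (E : 'M[k]_(m.+1, n.+1)).

Definition linear_forms : n.+1.-tuple {mpoly k[m.+1]} :=
  [tuple \sum_(a < m.+1) E a j *: 'X_a | j < n.+1].

Definition pullback (f : {mpoly k[n.+1]}) : {mpoly k[m.+1]} := f \mPo linear_forms.

Lemma evalp_linear_form (j : 'I_n.+1) q :
  evalp (tnth linear_forms j) q = (q *m E) 0 j.
Proof.
rewrite tnth_mktuple evalp_sum mxE; apply: eq_bigr => a _.
by rewrite evalpZ evalpU mulrC.
Qed.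

Lemma evalp_pullback f q : evalp (pullback f) q = evalp f (q *m E).
Proof.
rewrite /evalp comp_mpoly_meval; apply: meval_eq => j.
exact: evalp_linear_form.
Qed.

Lemma dirderiv_pullback f q v :
  dirderiv (pullback f) q v = dirderiv f (q *m E) (v *m E).
Proof.
elim/mpoly_ring_ind: f => [c|j|f g IHf IHg|f g IHf IHg].
- by rewrite /pullback comp_mpolyC !dirderivC.
- rewrite /pullback comp_mpolyXU -tnth_nth tnth_mktuple dirderivU mxE.
  by rewrite dirderiv_sum; apply: eq_bigr => a _; rewrite dirderivZ dirderivU mulrC.
- by rewrite /pullback comp_mpolyD !dirderivD -!/(pullback _) IHf IHg.
- rewrite /pullback rmorphM /= !dirderivM -!/(pullback _) IHf IHg.
  by rewrite !evalp_pullback.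
Qed.

End LinearPullback.

Lemma dhomog_comp (R : comNzRingType) (m n : nat) (lq : n.-tuple {mpoly R[m]}) d f :
  (forall j, tnth lq j \is 1.-homog) -> f \is d.-homog -> f \mPo lq \is d.-homog.
Proof.
move=> homl /dhomogP homf; rewrite comp_mpolyEX big_seq.
apply: rpred_sum => c /homf <-; apply: dhomogZ; rewrite comp_mpolyX /= mdegE.
apply: (big_ind2 (fun (p : {mpoly R[m]}) d => p \is d.-homog)) => [||j _].
- exact: dhomog1.
- by move=> *; apply: dhomogM.
- by rewrite -[X in X.-homog]mul1n; apply: dhomogMn.
Qed.

Lemma dhomog_pullback (k : closedFieldType) (m n : nat) (E : 'M[k]_(m.+1, n.+1)) d f :
  f \is d.-homog -> pullback E f \is d.-homog.
Proof.
apply: dhomog_comp => j; rewrite tnth_mktuple; apply: rpred_sum => a _.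
by apply: dhomogZ; rewrite dhomogX /= mdeg1.
Qed.

Lemma homogeneous_pullback (k : closedFieldType) (m n : nat) (E : 'M[k]_(m.+1, n.+1)) f :
  homogeneous f -> homogeneous (pullback E f).
Proof. by move=> [d hf]; exists d; apply: dhomog_pullback. Qed.

Section LinearEmbedding.
Variables (k : closedFieldType) (m n : nat).
Variables (E : 'M[k]_(m.+1, n.+1)) (E' : 'M[k]_(n.+1, m.+1)).
Hypothesis EE' : E *m E' = 1%:M.
Variable C : pset k m.

Definition embed : pset k n := fun p => exists2 q, C q & p = q *m E.

Lemma embedK (q : 'rV[k]_m.+1) : q *m E *m E' = q.
Proof. by rewrite -mulmxA EE' mulmx1. Qed.

Lemma embed_row_free : row_free E.
Proof. by apply/row_freeP; exists E'. Qed.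

Lemma vanishes_on_pullback f : vanishes_on f embed <-> vanishes_on (pullback E f) C.
Proof.
split=> f0 => [q Cq | _ [q Cq ->]].
  by rewrite evalp_pullback; apply: f0; exists q.
by rewrite -evalp_pullback; apply: f0.
Qed.

Lemma vanishes_on_pushforward f : vanishes_on f C -> vanishes_on (pullback E' f) embed.
Proof. by move=> f0 _ [q Cq ->]; rewrite evalp_pullback embedK; apply: f0. Qed.

(** [E' *m E] projects onto the row space of [E], so these forms cut out that space. *)
Definition span_equation (j : 'I_n.+1) : {mpoly k[n.+1]} :=
  'X_j - \sum_a (E' *m E) a j *: 'X_a.

Lemma evalp_span_equation j p : evalp (span_equation j) p = (p - p *m E' *m E) 0 j.
Proof.
rewrite evalpB evalpU evalp_sum -mulmxA !mxE; congr (_ - _).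
by apply: eq_bigr => a _; rewrite evalpZ evalpU mulrC.
Qed.

Lemma dirderiv_span_equation j p v :
  dirderiv (span_equation j) p v = (v - v *m E' *m E) 0 j.
Proof.
rewrite dirderivB dirderivU -mulmxA !mxE; congr (_ - _).
by rewrite dirderiv_sum; apply: eq_bigr => a _; rewrite dirderivZ dirderivU mulrC.
Qed.

Lemma dhomog_span_equation j : span_equation j \is 1.-homog.
Proof.
apply: rpredB; first by rewrite dhomogX /= mdeg1.
by apply: rpred_sum => a _; apply: dhomogZ; rewrite dhomogX /= mdeg1.
Qed.

Lemma span_equation_embed j : vanishes_on (span_equation j) embed.
Proof. by move=> _ [q _ ->]; rewrite evalp_span_equation embedK subrr mxE. Qed.

Lemma zclosed_embed : zclosed C -> zclosed embed.
Proof.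
move=> [S [homS CS]].
exists (fun f => (exists j, f = span_equation j) \/ exists2 g, S g & f = pullback E' g).
split=> [f [[j ->]|[g Sg ->]]|p].
- by exists 1%N; apply: dhomog_span_equation.
- exact/homogeneous_pullback/homS.
split=> [[q Cq pE] | [p0 Hp]].
  have [q0 Sq] := (CS q).1 Cq; split.
    by rewrite pE; apply: contraNneq q0 => qE0; rewrite -(embedK q) qE0 mul0mx.
  move=> f [[j ->]|[g Sg ->]]; first by apply: span_equation_embed; exists q.
  by rewrite evalp_pullback pE embedK Sq.
have pE : p = p *m E' *m E.
  apply/eqP; rewrite -subr_eq0; apply/eqP/rowP => j; rewrite [RHS]mxE.
  by rewrite -evalp_span_equation; apply: Hp; left; exists j.
exists (p *m E') => //; apply/CS; split.
  by apply: contraNneq p0 => pE'0; rewrite pE pE'0 mul0mx.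
by move=> g Sg; rewrite -evalp_pullback; apply: Hp; right; exists g.
Qed.

Lemma curve_like_embed : curve_like C -> curve_like embed.
Proof.
move=> [clC infC finC]; split; first exact: zclosed_embed.
  move=> [s sP]; apply: infC; exists [seq q *m E' | q <- s] => q Cq.
  have [p ps qp] := sP (q *m E) (ex_intro2 _ _ q Cq erefl).
  exists (p *m E'); first by apply/mapP; exists p.
  by rewrite -(embedK q); apply: submxMr.
move=> f homf nf0; have [s sP] : proj_finite (fun q => C q /\ evalp (pullback E f) q = 0).
  apply: finC; first exact: homogeneous_pullback.
  by move=> f0; apply: nf0; apply/vanishes_on_pullback.
exists [seq q *m E | q <- s] => _ [[q Cq ->]]; rewrite -evalp_pullback => fq.
have [q' q's qq'] := sP q (conj Cq fq).
by exists (q' *m E); [apply/mapP; exists q' | apply: submxMr].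
Qed.

Lemma has_tangent_lines_embed : has_tangent_lines C -> has_tangent_lines embed.
Proof.
move=> tanC _ [q Cq ->]; have [W [rW Wtan]] := tanC q Cq.
exists <<W *m E>>%MS; split; first by rewrite genmxE mxrankMfree ?embed_row_free.
move=> v; rewrite genmxE; split.
  move=> /submxP [D vE] f homf /vanishes_on_pullback f0.
  rewrite vE mulmxA -dirderiv_pullback; apply: (Wtan _).1 => //; first exact: submxMl.
  exact: homogeneous_pullback.
move=> Tv; have vE : v = v *m E' *m E.
  apply/eqP; rewrite -subr_eq0; apply/eqP/rowP => j; rewrite [RHS]mxE.
  rewrite -(dirderiv_span_equation j (q *m E)); apply: Tv.
    by exists 1%N; apply: dhomog_span_equation.
  exact: span_equation_embed.
rewrite vE; apply: submxMr; apply/Wtan => g homg g0.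
rewrite -(embedK q) -dirderiv_pullback; apply: Tv.
  exact: homogeneous_pullback.
exact: vanishes_on_pushforward.
Qed.

Lemma hilbert_value_embed d N : hilbert_value C d N -> hilbert_value embed d N.
Proof.
move=> [b [homb basis]]; exists (fun j => pullback E' (b j)); split=> [j|f homf].
  exact: dhomog_pullback.
have eqv (c : 'rV[k]_N) :
    vanishes_on (f - \sum_(j < N) c 0 j *: pullback E' (b j)) embed <->
    vanishes_on (pullback E f - \sum_(j < N) c 0 j *: b j) C.
  have sumE q : evalp (\sum_(j < N) c 0 j *: pullback E' (b j)) (q *m E) =
      evalp (\sum_(j < N) c 0 j *: b j) q.
    rewrite !evalp_sum; apply: eq_bigr => j _.
    by rewrite !evalpZ evalp_pullback embedK.
  split=> f0 => [q Cq | _ [q Cq ->]].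
    rewrite evalpB evalp_pullback -sumE -evalpB; apply: f0; by exists q.
  by rewrite evalpB sumE -evalp_pullback -evalpB; apply: f0.
have [c [c0 cuniq]] := basis _ (dhomog_pullback E homf).
by exists c; split=> [|c' /eqv]; [apply/eqv | apply: cuniq].
Qed.

End LinearEmbedding.

(** * Explicit coordinates *)

Notation o30 := (Ordinal (isT : 0 < 3)%N).
Notation o31 := (Ordinal (isT : 1 < 3)%N).
Notation o32 := (Ordinal (isT : 2 < 3)%N).

Lemma ord3_ind (P : 'I_3 -> Prop) : P o30 -> P o31 -> P o32 -> forall j, P j.
Proof.
move=> P0 P1 P2 [[|[|[|j]]] lt_j] //.
- by rewrite (bool_irrelevance lt_j isT).
- by rewrite (bool_irrelevance lt_j isT).
- by rewrite (bool_irrelevance lt_j isT).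
Qed.

Definition rowseq (k : nzRingType) (n : nat) (s : seq k) : 'rV[k]_n := \row_j s`_j.

Lemma row3E (k : nzRingType) (p : 'rV[k]_3) :
  p = rowseq 3 [:: p 0 o30; p 0 o31; p 0 o32].
Proof. by apply/rowP; elim/ord3_ind; rewrite mxE. Qed.

Notation o40 := (Ordinal (isT : 0 < 4)%N).
Notation o41 := (Ordinal (isT : 1 < 4)%N).
Notation o42 := (Ordinal (isT : 2 < 4)%N).
Notation o43 := (Ordinal (isT : 3 < 4)%N).

Lemma ord4_ind (P : 'I_4 -> Prop) : P o40 -> P o41 -> P o42 -> P o43 -> forall j, P j.
Proof.
move=> P0 P1 P2 P3 [[|[|[|[|j]]]] lt_j] //.
- by rewrite (bool_irrelevance lt_j isT).
- by rewrite (bool_irrelevance lt_j isT).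
- by rewrite (bool_irrelevance lt_j isT).
- by rewrite (bool_irrelevance lt_j isT).
Qed.

Lemma row4E (k : nzRingType) (p : 'rV[k]_4) :
  p = rowseq 4 [:: p 0 o40; p 0 o41; p 0 o42; p 0 o43].
Proof. by apply/rowP; elim/ord4_ind; rewrite mxE. Qed.

Notation o60 := (Ordinal (isT : 0 < 6)%N).
Notation o61 := (Ordinal (isT : 1 < 6)%N).
Notation o62 := (Ordinal (isT : 2 < 6)%N).
Notation o63 := (Ordinal (isT : 3 < 6)%N).
Notation o64 := (Ordinal (isT : 4 < 6)%N).
Notation o65 := (Ordinal (isT : 5 < 6)%N).

Lemma ord6_ind (P : 'I_6 -> Prop) :
  P o60 -> P o61 -> P o62 -> P o63 -> P o64 -> P o65 -> forall j, P j.
Proof.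
move=> P0 P1 P2 P3 P4 P5 [[|[|[|[|[|[|j]]]]]] lt_j] //;
  by rewrite (bool_irrelevance lt_j isT).
Qed.

Lemma sum3E (V : nmodType) (F : 'I_3 -> V) : \sum_j F j = F o30 + (F o31 + F o32).
Proof.
rewrite !big_ord_recl big_ord0 addr0.
by congr (F _ + (F _ + F _)); apply: val_inj.
Qed.

Lemma sum4E (V : nmodType) (F : 'I_4 -> V) :
  \sum_j F j = F o40 + (F o41 + (F o42 + F o43)).
Proof.
rewrite !big_ord_recl big_ord0 addr0.
by congr (F _ + (F _ + (F _ + F _))); apply: val_inj.
Qed.

Lemma sum6E (V : nmodType) (F : 'I_6 -> V) :
  \sum_j F j = F o60 + (F o61 + (F o62 + (F o63 + (F o64 + F o65)))).
Proof.
rewrite !big_ord_recl big_ord0 addr0.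
by congr (F _ + (F _ + (F _ + (F _ + (F _ + F _))))); apply: val_inj.
Qed.

Definition mxseq (k : nzRingType) (m n : nat) (s : seq (seq k)) : 'M[k]_(m, n) :=
  \matrix_(a, b) (nth [::] s a)`_b.

Lemma sub_eq0 (R : zmodType) (a b : R) : a - b = 0 <-> a = b.
Proof. by split=> [/eqP|->]; rewrite ?subrr // subr_eq0 => /eqP. Qed.

Lemma sqr_neg1_neq0 (k : fieldType) (i : k) : i ^+ 2 = -1 -> i != 0.
Proof.
by move=> i2; apply: contraNneq (oner_neq0 k) => i0; rewrite -oppr_eq0 -i2 i0 expr0n.
Qed.

(** * Descent, norms and the Jacobian criterion *)

(** Infinite descent: iterating the hypothesis divides each [F j] by every power of
    [X - x]. *)
Lemma poly_descent (k : fieldType) (I : Type) (P : (I -> {poly k}) -> Prop) (x : k) :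
  (forall F, P F -> exists2 G, P G & forall j, F j = ('X - x%:P) * G j) ->
  forall F, P F -> forall j, F j = 0.
Proof.
move=> desc F PF j; apply/eqP/negPn/negP => Fj0.
suff divF m : exists2 G, P G & F j = ('X - x%:P) ^+ m * G j.
  have [G _ FE] := divF (size (F j)).
  have G0 : G j != 0 by apply: contraNneq Fj0 => G0; rewrite FE G0 mulr0.
  have := leqnn (size (F j)).
  rewrite {1}FE size_monicM ?monic_exp ?monicXsubC // size_exp_XsubC.
  by rewrite addSn /= -{2}[size _]addn0 leq_add2l leqn0 size_poly_eq0 (negPf G0).
elim: m => [|m [G PG FE]]; first by exists F; rewrite ?expr0 ?mul1r.
have [H PH GE] := desc G PG; exists H => //.
by rewrite FE GE exprSr mulrA.
Qed.

Lemma root_factor (k : fieldType) (F : {poly k}) (x : k) :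
  F.[x] = 0 -> exists G, F = ('X - x%:P) * G.
Proof. by move/eqP/factor_theorem => [G ->]; exists G; rewrite mulrC. Qed.

(** The root [x] has odd order on the right and even order on the left; as a descent,
    [X - x] divides [A], then [B]. *)
Lemma simple_root_nonsquare (k : fieldType) (x : k) (G A B : {poly k}) :
  G.[x] != 0 -> A ^+ 2 = ('X - x%:P) * G * B ^+ 2 -> A = 0 /\ B = 0.
Proof.
move=> Gx AB; have X0 : 'X - x%:P != 0 :> {poly k} by rewrite polyXsubC_eq0.
pose P (F : bool -> {poly k}) := F true ^+ 2 = ('X - x%:P) * G * F false ^+ 2.
suff desc F : P F -> exists2 H, P H & forall b, F b = ('X - x%:P) * H b.
  have F0 := @poly_descent _ _ P x desc (fun b => if b then A else B) AB.
  by split; [apply: (F0 true) | apply: (F0 false)].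
rewrite /P => PF.
have : (F true).[x] ^+ 2 = 0 by rewrite -horner_exp PF -mulrA hornerM hornerXsubC subrr mul0r.
move/eqP; rewrite expf_eq0 /= => /eqP /root_factor [A1 A1E].
have PF1 : ('X - x%:P) * A1 ^+ 2 = G * F false ^+ 2.
  by apply: (mulfI X0); rewrite [RHS]mulrA -PF A1E; ring.
have : G.[x] * (F false).[x] ^+ 2 = 0.
  by rewrite -horner_exp -hornerM -PF1 hornerM hornerXsubC subrr mul0r.
move/eqP; rewrite mulf_eq0 (negPf Gx) expf_eq0 /= => /eqP /root_factor [B1 B1E].
exists (fun b : bool => if b then A1 else B1); last by case.
by apply: (mulfI X0); rewrite PF1 B1E /=; ring.
Qed.

(** The Jacobian criterion for curves. *)
Lemma gradient_kernel (k : closedFieldType) (n m : nat) (gens : m.-tuple {mpoly k[n.+1]}) p :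
  \rank (\matrix_(a < n.+1, b < m) evalp (tnth gens b)^`M(a) p) = (n.+1 - 2)%N -> (0 < n)%N ->
  exists W : 'M[k]_n.+1, \rank W = 2 /\
    forall v : 'rV[k]_n.+1, (v <= W)%MS <-> tangent gens p v.
Proof.
set A := \matrix_(a, b) _ => rA n0; exists (kermx A); split.
  by rewrite mxrank_ker rA subKn // ltnS.
have AE v b : (v *m A) 0 b = dirderiv (tnth gens b) p v.
  by rewrite mxE; apply: eq_bigr => a _; rewrite mxE mulrC.
move=> v; split.
  move/sub_kermxP => vA _ /tnthP [b ->]; by rewrite -AE vA mxE.
move=> Tv; apply/sub_kermxP/rowP => b; rewrite AE mxE.
by apply: Tv; apply: mem_tnth.
Qed.

Lemma evalp_partial (k : closedFieldType) (n : nat) (f : {mpoly k[n.+1]}) a p :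
  evalp f^`M(a) p = dirderiv f p (delta_mx 0 a).
Proof.
rewrite /dirderiv (bigD1 a) //= big1 => [|b ba]; rewrite mxE ?eqxx /=.
  by rewrite mulr1 addr0.
by rewrite (negPf ba) mulr0.
Qed.

Lemma polynomial_roots (k : closedFieldType) (F : {poly k}) :
  F != 0 -> exists rs : seq k, forall a, F.[a] = 0 -> a \in rs.
Proof.
move=> F0; have [rs FE] := closed_field_poly_normal F; exists rs => a /eqP Fa.
by move: Fa; rewrite -rootE FE rootZ ?lead_coef_eq0 // root_prod_XsubC.
Qed.

Lemma homogeneousX (k : closedFieldType) (n : nat) (a : 'I_n.+1) :
  'X_a \is [in k[n.+1], 1.-homog].
Proof. by rewrite dhomogX /= mdeg1. Qed.

Definition evalpE := (evalpD, evalpB, evalpN, evalpM, evalpZ, evalpXn, evalpU, evalp1, evalp0).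
Definition dirderivE := (dirderivD, dirderivB, dirderivN, dirderivM, dirderivZ, dirderivXn,
  dirderivU, dirderiv1).

Definition poly_evalE := (horner_exp, hornerD, hornerN, hornerM, hornerX, hornerC).

(** * The conic *)

Section Conic.
Variable k : closedFieldType.

Definition conic_gens : 1.-tuple {mpoly k[3]} := [tuple 'X_o30 ^+ 2 - 'X_o31 * 'X_o32].
Definition conic : pset k 2 := zlocus conic_gens.

Lemma conicP p : conic p <-> p != 0 /\ p 0 o30 ^+ 2 = p 0 o31 * p 0 o32.
Proof.
rewrite /conic /zlocus /zeros; split=> -[p0 Hp]; split=> //.
  have := Hp _ (mem_head _ _); rewrite !evalpE => /eqP.
  by rewrite subr_eq0 => /eqP.
by move=> f; rewrite inE => /eqP ->; rewrite !evalpE Hp subrr.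
Qed.

(** Over the line [y : z] the coordinate [x] satisfies [x^2 = y z], and the norm of
    [F0 + F1 x] is [F0^2 - t F1^2], where [t = y / z]. *)
Lemma conic_over_line :
  finite_over_line conic_gens o31 o32 (fun j : 'I_2 => 'X_o30 ^+ j) (fun j : 'I_2 => j : nat).
Proof.
pose M := has_normal_form conic_gens o31 o32 (fun j : 'I_2 => 'X_o30 ^+ j) (fun j : 'I_2 => j : nat).
have M0 : M 0%N 1 by apply: (has_normal_form_basis _ _ _ _ _ (@Ordinal 2 0 isT)).
have M1 : M 1%N 'X_o30 by apply: (has_normal_form_basis _ _ _ _ _ (@Ordinal 2 1 isT)).
split.
- move=> g; rewrite inE => /eqP ->; exists 2; apply: rpredB.
    exact: (dhomogMn 2 (homogeneousX _ _)).
  exact: (dhomogM (homogeneousX _ _) (homogeneousX _ _)).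
- by move=> j; rewrite -[X in X.-homog]mul1n; apply: (dhomogMn j (homogeneousX _ _)).
- exact: M0.
- move=> l j; elim/ord3_ind: l; last first.
  + exact/has_normal_form_mulZ/has_normal_form_basis.
  + exact/has_normal_form_mulY/has_normal_form_basis.
  case: j => [[|[|//]] ltj] /=; first by rewrite expr0 mulr1.
  apply: (@has_normal_form_mod _ _ _ _ _ _ _ _ _ _ ('X_o31 * ('X_o32 * 1))).
    by rewrite expr1 mulr1 -expr2; apply: first_order_gen; rewrite mem_head.
  exact/has_normal_form_mulY/has_normal_form_mulZ.
- move=> F [j Fj0]; pose F0 := F (@Ordinal 2 0 isT); pose F1 := F (@Ordinal 2 1 isT).
  exists (F0 ^+ 2 - 'X * F1 ^+ 2).
    apply: contraNneq Fj0 => /eqP; rewrite subr_eq0 => /eqP FE.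
    have [F00 F10] : F0 = 0 /\ F1 = 0.
      apply: (@simple_root_nonsquare _ 0 1); first by rewrite hornerC oner_eq0.
      by rewrite subr0 mulr1.
    by case: j => [[|[|//]] ltj]; apply/eqP; [rewrite -F00 | rewrite -F10];
      congr (F _); apply: val_inj.
  move=> p /conicP [_ px] pz; rewrite !big_ord_recl big_ord0 /= !evalpE pz mulr1 in px *.
  rewrite (_ : F ord0 = F0); last by congr (F _); apply: val_inj.
  rewrite (_ : F (lift ord0 ord0) = F1); last by congr (F _); apply: val_inj.
  rewrite expr0 mul1r addr0.
  move/eqP; rewrite addr_eq0 => /eqP FE.
  by rewrite hornerD hornerN horner_exp hornerM horner_exp hornerX FE sqrrN exprMn px subrr.
- move=> a b; have [rs rsP] : exists rs : seq k, forall x, ('X ^+ 2 - (a * b)%:P : {poly k}).[x] = 0 -> x \in rs.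
    by apply: polynomial_roots; rewrite -size_poly_eq0 size_XnsubC.
  exists [seq rowseq 3 [:: x; a; b] | x <- rs] => p /conicP [_ px] py pz.
  apply/mapP; exists (p 0 o30); last by rewrite {1}[p]row3E py pz.
  by apply: rsP; rewrite !hornerE px py pz subrr.
- move=> a; have /closed_rootP [x] : size ('X ^+ 2 - a%:P : {poly k}) != 1%N by rewrite size_XnsubC.
  rewrite rootE !hornerE subr_eq0 => /eqP xa; exists (rowseq 3 [:: x; a; 1]); split.
  + apply/conicP; rewrite !mxE /= mulr1; split=> //.
    by apply/eqP => /rowP /(_ o32); rewrite !mxE /= => /eqP; rewrite oner_eq0.
  + by rewrite mxE.
  + by rewrite mxE.
- move=> p /conicP [p0 px] py pz; case/negP: p0.
  have /eqP : p 0 o30 ^+ 2 = 0 by rewrite px py mul0r.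
  rewrite expf_eq0 /= => /eqP x0; apply/eqP/rowP.
  by elim/ord3_ind; rewrite mxE.
Qed.

Lemma conic_tangent : (2%:R != 0 :> k) -> has_tangent_lines conic.
Proof.
move=> char2; apply: finite_over_line_tangent conic_over_line _ => p /conicP [p0 px].
apply: gradient_kernel => //; apply/eqP; rewrite eqn_leq rank_leq_col lt0n mxrank_eq0.
apply: contraNneq p0 => /matrixP A0.
have := A0 o30 0; have := A0 o31 0; have := A0 o32 0.
rewrite !mxE !evalp_partial !dirderivE !evalpE !mxE /= => z0 y0 x0.
apply/eqP/rowP; elim/ord3_ind; rewrite [RHS]mxE.
- by apply: (mulfI char2); rewrite mulr0 -[RHS]x0; ring.
- by apply: oppr_inj; rewrite oppr0 -[RHS]z0; ring.
- by apply: oppr_inj; rewrite oppr0 -[RHS]y0; ring.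
Qed.

End Conic.

(** * The plane cubic *)

Section Cubic.
Variables (k : closedFieldType) (c : k).
Hypothesis c0 : c != 0.

Definition cubic_gens : 1.-tuple {mpoly k[3]} :=
  [tuple 'X_o30 ^+ 3 - 'X_o30 * 'X_o31 ^+ 2 - c *: ('X_o31 * 'X_o32 ^+ 2)].
Definition cubic : pset k 2 := zlocus cubic_gens.

Lemma cubicP p : cubic p <-> p != 0 /\
  p 0 o30 ^+ 3 = p 0 o30 * p 0 o31 ^+ 2 + c * (p 0 o31 * p 0 o32 ^+ 2).
Proof.
rewrite /cubic /zlocus /zeros; split=> -[p0 Hp]; split=> //.
  have := Hp _ (mem_head _ _); rewrite !evalpE => /eqP.
  by rewrite -addrA -opprD subr_eq0 => /eqP.
by move=> f; rewrite inE => /eqP ->; rewrite !evalpE Hp; ring.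
Qed.

(** The norm of [F0 + F1 x + F2 x^2], where [x^3 = x t^2 + c t]: the determinant of
    multiplication by this element in the basis [1, x, x^2]. *)
Definition cubic_norm (R : comNzRingType) (c t F0 F1 F2 : R) : R :=
  let p := t ^+ 2 in let r := c * t in
  F0 * ((F0 + F2 * p) ^+ 2 - F1 * (F1 * p + F2 * r))
  - F1 * (F2 * r * (F0 + F2 * p) - F1 * (F1 * r))
  + F2 * (F2 * r * (F1 * p + F2 * r) - F1 * r * (F0 + F2 * p)).

(** The matrix of the multiplication kills the vector [(1, x, x^2)]; the identity below
    expands its determinant along the first column. *)
Lemma cubic_norm_multiple (R : comNzRingType) (a t F0 F1 F2 x : R) :
  x ^+ 3 = x * t ^+ 2 + a * t -> F0 + F1 * x + F2 * x ^+ 2 = 0 ->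
  cubic_norm a t F0 F1 F2 = 0.
Proof.
move=> xE FE; pose p := t ^+ 2; pose r := a * t.
have x0 : x ^+ 3 - x * p - r = 0 by rewrite xE /p /r; ring.
transitivity (((F0 + F2 * p) ^+ 2 - F1 * (F1 * p + F2 * r)) * (F0 + F1 * x + F2 * x ^+ 2)
  - (F1 * (F0 + F2 * p) - F2 * (F1 * p + F2 * r)) *
      (x * (F0 + F1 * x + F2 * x ^+ 2) - F2 * (x ^+ 3 - x * p - r))
  + (F1 ^+ 2 - F2 * (F0 + F2 * p)) *
      (x ^+ 2 * (F0 + F1 * x + F2 * x ^+ 2) - F1 * (x ^+ 3 - x * p - r)
       - F2 * x * (x ^+ 3 - x * p - r))).
  by rewrite /cubic_norm -/p -/r; ring.
by rewrite x0 FE; ring.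
Qed.

(** The equation of the cubic is of Eisenstein type at [t = 0], so that [t] divides
    the three coefficients one after the other when the norm vanishes. *)
Lemma cubic_norm_eq0 (F : 'I_3 -> {poly k}) :
  cubic_norm c%:P 'X (F o30) (F o31) (F o32) = 0 -> forall j, F j = 0.
Proof.
pose P (F : 'I_3 -> {poly k}) := cubic_norm c%:P 'X (F o30) (F o31) (F o32) = 0.
have X0 : 'X != 0 :> {poly k} by rewrite polyX_eq0.
have divX (G : {poly k}) m : c ^+ m * G.[0] ^+ 3 = 0 -> exists H, G = 'X * H.
  move/eqP; rewrite mulf_eq0 expf_eq0 (negPf c0) andbF expf_eq0 /= => /eqP.
  by move/root_factor; rewrite subr0.
apply: (@poly_descent _ _ P 0) => {}F; rewrite /P subr0.
set F0 := F o30; set F1 := F o31; set F2 := F o32 => NF.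
have [G0 F0E] : exists H, F0 = 'X * H.
  apply: (divX _ 0%N); have := horner0 (0 : k); rewrite -NF.
  by rewrite /cubic_norm !poly_evalE => E; rewrite -[RHS]E; ring.
have {}NF : G0 * (('X * G0 + F2 * 'X ^+ 2) ^+ 2 - F1 * (F1 * 'X ^+ 2 + F2 * c%:P * 'X))
    - F1 * (F2 * c%:P * ('X * G0 + F2 * 'X ^+ 2) - c%:P * F1 ^+ 2)
    + F2 * (F2 * c%:P * (F1 * 'X ^+ 2 + F2 * c%:P * 'X)
            - F1 * c%:P * ('X * G0 + F2 * 'X ^+ 2)) = 0.
  by apply: (mulfI X0); rewrite mulr0 -[RHS]NF F0E /cubic_norm; ring.
have [G1 F1E] : exists H, F1 = 'X * H.
  apply: (divX _ 1%N); have := horner0 (0 : k); rewrite -NF.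
  by rewrite !poly_evalE => E; rewrite -[RHS]E; ring.
have {}NF : G0 * ('X * (G0 + F2 * 'X) ^+ 2 - G1 * ('X ^+ 3 * G1 + F2 * c%:P * 'X))
    - G1 * (F2 * c%:P * ('X * G0 + F2 * 'X ^+ 2) - c%:P * 'X ^+ 2 * G1 ^+ 2)
    + F2 * (F2 * c%:P * ('X ^+ 2 * G1 + F2 * c%:P)
            - G1 * c%:P * ('X * G0 + F2 * 'X ^+ 2)) = 0.
  by apply: (mulfI X0); rewrite mulr0 -[RHS]NF F1E; ring.
have [G2 F2E] : exists H, F2 = 'X * H.
  apply: (divX _ 2%N); have := horner0 (0 : k); rewrite -NF.
  by rewrite !poly_evalE => E; rewrite -[RHS]E; ring.
exists (fun j => [:: G0; G1; G2]`_j); last by elim/ord3_ind.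
apply: (mulfI X0); rewrite mulr0 -[RHS]NF F2E /cubic_norm /=; ring.
Qed.

Lemma monic_cubic_root (a b : k) : exists x, x ^+ 3 = x * a + b.
Proof.
have [x xE] := solve_monicpoly (fun j => [:: b; a]`_j) (isT : (0 < 3)%N).
by exists x; rewrite xE !big_ord_recl big_ord0 /=; ring.
Qed.

Lemma monic_cubic_roots (a b : k) :
  exists rs : seq k, forall x, x ^+ 3 = x * a + b -> x \in rs.
Proof.
have [|rs rsP] := @polynomial_roots k ('X ^+ 3 - 'X * a%:P - b%:P).
  apply/eqP => /(congr1 (fun F : {poly k} => F`_3)).
  by rewrite !coefB coefXn coefXM !coefC /= !subr0 => /eqP; rewrite oner_eq0.
by exists rs => x xE; apply: rsP; rewrite !poly_evalE xE; ring.
Qed.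

Lemma cubic_over_line :
  finite_over_line cubic_gens o31 o32 (fun j : 'I_3 => 'X_o30 ^+ j) (fun j : 'I_3 => j : nat).
Proof.
pose M := has_normal_form cubic_gens o31 o32 (fun j : 'I_3 => 'X_o30 ^+ j) (fun j : 'I_3 => j : nat).
have Mb (j : 'I_3) : M j ('X_o30 ^+ j) by apply: (has_normal_form_basis _ _ _ _ _ j).
have [X0 X1 X2] : [/\ 'X_o30 \is [in k[3], 1.-homog], 'X_o31 \is [in k[3], 1.-homog]
  & 'X_o32 \is [in k[3], 1.-homog]] by split; apply: homogeneousX.
split.
- move=> g; rewrite inE => /eqP ->; exists 3; apply: rpredB; first apply: rpredB.
  + exact: (dhomogMn 3 X0).
  + exact: (dhomogM X0 (dhomogMn 2 X1)).
  + exact/dhomogZ/(dhomogM X1 (dhomogMn 2 X2)).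
- by move=> j; rewrite -[X in X.-homog]mul1n; apply: (dhomogMn j X0).
- exact: (Mb o30).
- move=> l j; elim/ord3_ind: l; last first.
  + exact/has_normal_form_mulZ/has_normal_form_basis.
  + exact/has_normal_form_mulY/has_normal_form_basis.
  elim/ord3_ind: j; rewrite -exprS.
  + exact: (Mb o31).
  + exact: (Mb o32).
  apply: (@has_normal_form_mod _ _ _ _ _ _ _ _ _ _
    ('X_o31 * ('X_o31 * 'X_o30 ^+ o31) + c *: ('X_o31 * ('X_o32 * ('X_o32 * 'X_o30 ^+ o30))))).
    rewrite (_ : _ - _ = tnth cubic_gens ord0).
      by apply: first_order_gen; apply: mem_tnth.
    by rewrite (tnth_nth 0) /= -!mul_mpolyC; ring.
  apply: has_normal_formD.
    by do 2!apply: has_normal_form_mulY; apply: (Mb o31).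
  apply: has_normal_formZ; apply/has_normal_form_mulY.
  by do 2!apply: has_normal_form_mulZ; apply: (Mb o30).
- move=> F [j Fj0]; exists (cubic_norm c%:P 'X (F o30) (F o31) (F o32)).
    by apply: contraNneq Fj0 => /cubic_norm_eq0 ->.
  move=> p /cubicP [_ px] pz; rewrite !big_ord_recl big_ord0 /= !evalpE => FE.
  have -> : (cubic_norm c%:P 'X (F o30) (F o31) (F o32)).[p 0 o31] =
      cubic_norm c (p 0 o31) (F o30).[p 0 o31] (F o31).[p 0 o31] (F o32).[p 0 o31].
    by rewrite /cubic_norm !poly_evalE.
  apply: (cubic_norm_multiple (x := p 0 o30)); first by rewrite px pz expr1n mulr1.
  have E0 : ord0 = o30 by apply: val_inj.
  have E1 : lift ord0 ord0 = o31 by apply: val_inj.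
  have E2 : lift ord0 (lift ord0 ord0) = o32 by apply: val_inj.
  by rewrite -[RHS]FE E2 E1 E0 /=; ring.
- move=> a b; have [rs rsP] := monic_cubic_roots (a ^+ 2) (c * (a * b ^+ 2)).
  exists [seq rowseq 3 [:: x; a; b] | x <- rs] => p /cubicP [_ px] py pz.
  apply/mapP; exists (p 0 o30); last by rewrite {1}[p]row3E py pz.
  by apply: rsP; rewrite -py -pz.
- move=> a; have [x xE] := monic_cubic_root (a ^+ 2) (c * a).
  exists (rowseq 3 [:: x; a; 1]); split; rewrite ?mxE //.
  apply/cubicP; rewrite !mxE /= expr1n mulr1; split=> //.
  by apply/eqP => /rowP /(_ o32); rewrite !mxE /= => /eqP; rewrite oner_eq0.
- move=> p /cubicP [p0 px] py pz; case/negP: p0.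
  have /eqP : p 0 o30 ^+ 3 = 0 by rewrite px py; ring.
  rewrite expf_eq0 /= => /eqP x0; apply/eqP/rowP.
  by elim/ord3_ind; rewrite mxE.
Qed.

(** The partial derivatives are [3 x^2 - y^2], [-2 x y - c z^2] and [-2 c y z]. *)
Lemma cubic_tangent : (2%:R != 0 :> k) -> has_tangent_lines cubic.
Proof.
move=> char2; apply: finite_over_line_tangent cubic_over_line _ => p /cubicP [p0 px].
apply: gradient_kernel => //; apply/eqP; rewrite eqn_leq rank_leq_col lt0n mxrank_eq0.
apply: contraNneq p0 => /matrixP A0.
have := A0 o30 0; have := A0 o31 0; have := A0 o32 0.
rewrite !mxE !evalp_partial !dirderivE !evalpE !mxE /=.
set X := p 0 o30; set Y := p 0 o31; set Z := p 0 o32 => z0 y0 x0.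
rewrite -/X -/Y -/Z in px.
suff [X0 Y0 Z0] : [/\ X = 0, Y = 0 & Z = 0].
  by apply/eqP/rowP; elim/ord3_ind; rewrite [RHS]mxE.
have YZ : Y * Z = 0.
  apply: (mulfI char2); apply: (mulfI c0); rewrite !mulr0; apply: oppr_inj.
  by rewrite oppr0 -[RHS]z0; ring.
move/eqP: YZ; rewrite mulf_eq0 => /orP [/eqP Y0 | /eqP Z0].
  have X0 : X = 0 by apply/eqP; move/eqP: px; rewrite Y0 !(expr0n, mulr0, mul0r) addr0 expf_eq0.
  have /eqP : c * Z ^+ 2 = 0 by apply: oppr_inj; rewrite oppr0 -[RHS]y0 X0 Y0; ring.
  by rewrite mulf_eq0 (negPf c0) sqrf_eq0 => /eqP.
have XY : X * Y = 0.
  apply: (mulfI char2); rewrite mulr0; apply: oppr_inj.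
  by rewrite oppr0 -[RHS]y0 Z0; ring.
have /eqP : X ^+ 3 = 0 by rewrite px Z0 expr2 mulrA XY; ring.
rewrite expf_eq0 /= => /eqP X0.
have /eqP : Y ^+ 2 = 0 by apply: oppr_inj; rewrite oppr0 -[RHS]x0 X0 Z0; ring.
by rewrite sqrf_eq0 => /eqP.
Qed.

End Cubic.

(** * The space quartic *)

(** The norm of [A + B q + C s + D q s] where [q^2 = G] and [s^2 = H], taken first
    down to the field generated by [q]. *)
Definition quartic_norm (R : comNzRingType) (G H A B C D : R) : R :=
  (A ^+ 2 + G * B ^+ 2 - H * (C ^+ 2 + G * D ^+ 2)) ^+ 2
  - G * (2%:R * (A * B - H * C * D)) ^+ 2.

Lemma quartic_norm_multiple (R : comNzRingType) (G H A B C D q s : R) :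
  q ^+ 2 = G -> s ^+ 2 = H -> A + B * q + C * s + D * (q * s) = 0 ->
  quartic_norm G H A B C D = 0.
Proof.
move=> <- <- F0; transitivity ((A + B * q + C * s + D * (q * s)) *
  (A + B * q - C * s - D * (q * s)) *
  (A ^+ 2 + q ^+ 2 * B ^+ 2 - s ^+ 2 * (C ^+ 2 + q ^+ 2 * D ^+ 2)
    - q * (2%:R * (A * B - s ^+ 2 * C * D)))).
  by rewrite /quartic_norm; ring.
by rewrite F0 !mul0r.
Qed.

Lemma square_root (k : closedFieldType) (a : k) : exists x, x ^+ 2 = a.
Proof.
have [x xE] := solve_monicpoly (fun j => [:: a; 0]`_j) (isT : (0 < 2)%N).
by exists x; rewrite xE !big_ord_recl big_ord0 /=; ring.
Qed.

Lemma square_roots (k : closedFieldType) (a : k) :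
  exists rs : seq k, forall x, x ^+ 2 = a -> x \in rs.
Proof.
have [x xE] := square_root a; exists [:: x; - x] => t /eqP.
by rewrite -xE eqf_sqr !inE.
Qed.

Section Quartic.
Variables (k : closedFieldType) (al be : k).
Hypotheses (char2 : 2%:R != 0 :> k).
Hypotheses (al0 : al != 0) (be0 : be != 0) (al_be : al ^+ 2 != be ^+ 2).

Definition quartic_gens : 2.-tuple {mpoly k[4]} :=
  [tuple 'X_o41 ^+ 2 - (al *: 'X_o40 ^+ 2 + be *: 'X_o42 ^+ 2);
         'X_o43 ^+ 2 - (be *: 'X_o40 ^+ 2 + al *: 'X_o42 ^+ 2)].
Definition quartic : pset k 3 := zlocus quartic_gens.

Lemma quarticP p : quartic p <-> [/\ p != 0,
  p 0 o41 ^+ 2 = al * p 0 o40 ^+ 2 + be * p 0 o42 ^+ 2 &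
  p 0 o43 ^+ 2 = be * p 0 o40 ^+ 2 + al * p 0 o42 ^+ 2].
Proof.
rewrite /quartic /zlocus /zeros; split=> [[p0 Hp]|[p0 Hq Hs]]; split=> //.
- apply/eqP; rewrite -subr_eq0; apply/eqP.
  by rewrite -(Hp _ (mem_head _ _)) !evalpE.
- apply/eqP; rewrite -subr_eq0; apply/eqP.
  by rewrite -(Hp _ (mem_last _ _)) !evalpE.
- by move=> f; rewrite !inE => /orP [] /eqP ->; rewrite !evalpE ?Hq ?Hs subrr.
Qed.

Lemma split_quadratic (a b : k) : a != 0 -> b != 0 ->
  exists x (G1 : {poly k}), [/\ a%:P * 'X ^+ 2 + b%:P = ('X - x%:P) * G1,
    G1.[x] != 0 & a * x ^+ 2 + b = 0].
Proof.
move=> a0 b0; have [x xE] := square_root (- b / a).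
have axb : a * x ^+ 2 + b = 0 by rewrite xE mulrC divfK // addNr.
have x0 : x != 0.
  by apply: contraNneq b0 => x0; rewrite -axb x0 expr0n mulr0 add0r.
exists x, (a%:P * ('X + x%:P)); split=> //.
  transitivity (a%:P * 'X ^+ 2 - (a * x ^+ 2)%:P); last by rewrite polyCM rmorphXn; ring.
  by congr (_ + _); rewrite -polyCN; congr (_%:P); apply/eqP; rewrite -addr_eq0 addrC axb.
rewrite !poly_evalE -mulr2n -[x *+ 2]mulr_natl mulf_neq0 //.
by rewrite mulf_neq0.
Qed.

Lemma two_squares_eq0 (a b g : k) :
  g != 0 -> a ^+ 2 + g * b ^+ 2 = 0 -> a * b = 0 -> a = 0 /\ b = 0.
Proof.
move=> g0 ab /eqP; rewrite mulf_eq0 => /orP [] /eqP z0; split=> //; apply/eqP.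
  by move/eqP: ab; rewrite z0 expr0n add0r mulf_eq0 (negPf g0) sqrf_eq0.
by move/eqP: ab; rewrite z0 expr0n mulr0 addr0 sqrf_eq0.
Qed.

Let G : {poly k} := al%:P * 'X ^+ 2 + be%:P.
Let H : {poly k} := be%:P * 'X ^+ 2 + al%:P.

(** The two branch loci [G = 0] and [H = 0] are reduced and disjoint: [G] is not a
    square, and [H] remains a nonsquare after adjoining [q], because at a root
    of [H] the double cover [q^2 = G] is unramified. *)
Lemma quartic_norm_eq0 (F : 'I_4 -> {poly k}) :
  quartic_norm G H (F o40) (F o41) (F o43) (F o42) = 0 -> forall j, F j = 0.
Proof.
have [g [G1 [GE G1g _]]] := split_quadratic al0 be0.
have [h [H1 [HE H1h Hh]]] := split_quadratic be0 al0.
have Gh : G.[h] != 0.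
  apply: contraNneq al_be; rewrite /G !poly_evalE => Gh.
  rewrite -subr_eq0; apply/eqP; transitivity (al * (be * h ^+ 2 + al) - be * (al * h ^+ 2 + be)).
    by ring.
  by rewrite Gh Hh; ring.
pose P (F : 'I_4 -> {poly k}) :=
  F o40 ^+ 2 + G * F o41 ^+ 2 = H * (F o43 ^+ 2 + G * F o42 ^+ 2) /\
  F o40 * F o41 = H * F o43 * F o42.
move/eqP; rewrite /quartic_norm subr_eq0 => /eqP; rewrite [X in _ = X * _]GE.
case/(simple_root_nonsquare G1g) => E1 /eqP E2.
apply: (@poly_descent _ _ P h); last first.
  split; first by apply/eqP; rewrite -subr_eq0 E1.
  by move: E2; rewrite mulf_eq0 -polyC_natr polyC_eq0 (negPf char2) /= subr_eq0 => /eqP.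
move=> {E1 E2}F [E1 E2]; have Xh : 'X - h%:P != 0 :> {poly k} by rewrite polyXsubC_eq0.
have X0 : ('X - h%:P).[h] = 0 by rewrite hornerXsubC subrr.
have ev (A B : {poly k}) : A = B -> A.[h] = B.[h] by move->.
have [/root_factor [A AE] /root_factor [B BE]] : (F o40).[h] = 0 /\ (F o41).[h] = 0.
  apply: (two_squares_eq0 Gh).
    by have := ev _ _ E1; rewrite /H HE -mulrA [in RHS]hornerM X0 mul0r => <-; rewrite !poly_evalE.
  by have := ev _ _ E2; rewrite /H HE -!mulrA [in RHS]hornerM X0 mul0r => <-; rewrite hornerM.
have {}E1 : ('X - h%:P) * (A ^+ 2 + G * B ^+ 2) = H1 * (F o43 ^+ 2 + G * F o42 ^+ 2).
  by apply: (mulfI Xh); rewrite [RHS]mulrA -HE -/H -E1 AE BE; ring.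
have {}E2 : ('X - h%:P) * (A * B) = H1 * (F o43 * F o42).
  by apply: (mulfI Xh); rewrite [RHS]mulrA -HE -/H [RHS]mulrA -E2 AE BE; ring.
have [/root_factor [C CE] /root_factor [D DE]] : (F o43).[h] = 0 /\ (F o42).[h] = 0.
  apply: (two_squares_eq0 Gh); apply: (mulfI H1h); rewrite mulr0.
    have := ev _ _ E1; rewrite [LHS]hornerM X0 mul0r => ->; rewrite hornerM.
    by rewrite !poly_evalE.
  by have := ev _ _ E2; rewrite [LHS]hornerM X0 mul0r => ->; rewrite !hornerM.
exists (fun j => [:: A; B; D; C]`_j); last by elim/ord4_ind.
split; apply: (mulfI Xh); rewrite /H HE /=.
  by rewrite E1 CE DE; ring.
by rewrite E2 CE DE; ring.
Qed.

Let e (j : 'I_4) : {mpoly k[4]} := [:: 1; 'X_o41; 'X_o41 * 'X_o43; 'X_o43]`_j.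
Let dg (j : 'I_4) : nat := nth 0%N [:: 0; 1; 2; 1]%N j.

Lemma quartic_point_neq0 p : quartic p -> p 0 o40 = 0 -> p 0 o42 = 0 -> False.
Proof.
move=> /quarticP [p0 Hq Hs] y0 z0; case/negP: p0; apply/eqP/rowP.
have q0 : p 0 o41 = 0 by apply/eqP; rewrite -sqrf_eq0 Hq y0 z0; apply/eqP; ring.
have s0 : p 0 o43 = 0 by apply/eqP; rewrite -sqrf_eq0 Hs y0 z0; apply/eqP; ring.
by elim/ord4_ind; rewrite mxE.
Qed.

Lemma quartic_over_line : finite_over_line quartic_gens o40 o42 e dg.
Proof.
pose M := has_normal_form quartic_gens o40 o42 e dg.
have Mb (j : 'I_4) : M (dg j) (e j) by apply: (has_normal_form_basis _ _ _ _ _ j).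
have MQ a b d f : M d f -> M d.+2 ((a *: 'X_o40 ^+ 2 + b *: 'X_o42 ^+ 2) * f).
  move=> Mf; rewrite mulrDl -!scalerAl !expr2 -!mulrA; apply: has_normal_formD.
    by apply: has_normal_formZ; do 2!apply: has_normal_form_mulY.
  by apply: has_normal_formZ; do 2!apply: has_normal_form_mulZ.
have Jq f : vanishes_to_first_order quartic_gens
    ('X_o41 * ('X_o41 * f) - (al *: 'X_o40 ^+ 2 + be *: 'X_o42 ^+ 2) * f).
  rewrite mulrA -expr2 -mulrBl mulrC; apply: first_orderM; apply: first_order_gen.
  by rewrite inE eqxx.
have Js f : vanishes_to_first_order quartic_gens
    ('X_o43 * ('X_o43 * f) - (be *: 'X_o40 ^+ 2 + al *: 'X_o42 ^+ 2) * f).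
  rewrite mulrA -expr2 -mulrBl mulrC; apply: first_orderM; apply: first_order_gen.
  by rewrite !inE eqxx orbT.
have X (a : 'I_4) : 'X_a \is [in k[4], 1.-homog] by apply: homogeneousX.
have homQ a b : a *: 'X_o40 ^+ 2 + b *: 'X_o42 ^+ 2 \is [in k[4], 2.-homog].
  by apply: rpredD; apply: dhomogZ; apply: (dhomogMn 2 (X _)).
split.
- move=> f; rewrite !inE => /orP [] /eqP ->; exists 2; apply: rpredB;
    by [apply: (dhomogMn 2 (X _)) | apply: homQ].
- elim/ord4_ind; [exact: dhomog1 | exact: X | | exact: X].
  exact: (dhomogM (X _) (X _)).
- exact: (Mb o40).
- move=> l j; elim/ord4_ind: l.
  + exact/has_normal_form_mulY/has_normal_form_basis.
  + elim/ord4_ind: j.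
    * by rewrite mulr1; apply: (Mb o41).
    * rewrite -[e o41]mulr1; apply: has_normal_form_mod (Jq 1) _.
      exact: (MQ _ _ _ _ (Mb o40)).
    * apply: has_normal_form_mod (Jq 'X_o43) _.
      exact: (MQ _ _ _ _ (Mb o43)).
    * exact: (Mb o42).
  + exact/has_normal_form_mulZ/has_normal_form_basis.
  + elim/ord4_ind: j.
    * by rewrite mulr1; apply: (Mb o43).
    * by rewrite mulrC; apply: (Mb o42).
    * rewrite [X in 'X_o43 * X](mulrC 'X_o41 'X_o43 : e o42 = _).
      apply: has_normal_form_mod (Js 'X_o41) _.
      exact: (MQ _ _ _ _ (Mb o41)).
    * rewrite -[e o43]mulr1; apply: has_normal_form_mod (Js 1) _.
      exact: (MQ _ _ _ _ (Mb o40)).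
- move=> F [j Fj0]; exists (quartic_norm G H (F o40) (F o41) (F o43) (F o42)).
    by apply: contraNneq Fj0 => /quartic_norm_eq0 ->.
  move=> p /quarticP [_ Hq Hs] pz; rewrite !big_ord_recl big_ord0 /= !evalpE => FE.
  have -> : (quartic_norm G H (F o40) (F o41) (F o43) (F o42)).[p 0 o40] =
      quartic_norm G.[p 0 o40] H.[p 0 o40] (F o40).[p 0 o40] (F o41).[p 0 o40]
        (F o43).[p 0 o40] (F o42).[p 0 o40].
    by rewrite /quartic_norm -polyC_natr !poly_evalE.
  apply: (quartic_norm_multiple (q := p 0 o41) (s := p 0 o43)).
  + by rewrite Hq pz /G !poly_evalE; ring.
  + by rewrite Hs pz /H !poly_evalE; ring.
  have E0 : ord0 = o40 by apply: val_inj.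
  have E1 : lift ord0 ord0 = o41 by apply: val_inj.
  have E2 : lift ord0 (lift ord0 ord0) = o42 by apply: val_inj.
  have E3 : lift ord0 (lift ord0 (lift ord0 ord0)) = o43 by apply: val_inj.
  by rewrite -[RHS]FE E3 E2 E1 E0 /=; ring.
- move=> a b; have [qs qsP] := square_roots (al * a ^+ 2 + be * b ^+ 2).
  have [ss ssP] := square_roots (be * a ^+ 2 + al * b ^+ 2).
  exists [seq rowseq 4 [:: a; q; b; s] | q <- qs, s <- ss] => p /quarticP [_ Hq Hs] py pz.
  apply/allpairsP; exists (p 0 o41, p 0 o43); split=> /=.
  + by apply: qsP; rewrite Hq py pz.
  + by apply: ssP; rewrite Hs py pz.
  + by rewrite {1}[p]row4E py pz.
- move=> a; have [q qE] := square_root (al * a ^+ 2 + be).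
  have [s sE] := square_root (be * a ^+ 2 + al).
  exists (rowseq 4 [:: a; q; 1; s]); split; rewrite ?mxE //.
  apply/quarticP; rewrite !mxE /= expr1n !mulr1; split=> //.
  by apply/eqP => /rowP /(_ o42); rewrite !mxE /= => /eqP; rewrite oner_eq0.
- exact: quartic_point_neq0.
Qed.

(** If a combination of the two differentials vanishes at a point, then [q] or [s] is zero
    there, so that both [p] and [r] are nonzero; the remaining linear system for the
    coefficients has determinant [al^2 - be^2]. *)
Lemma quartic_tangent : has_tangent_lines quartic.
Proof.
apply: finite_over_line_tangent quartic_over_line _ => p Cp.
have /quarticP [p0 Hq Hs] := Cp.
apply: gradient_kernel => //; rewrite -mxrank_tr; apply/eqP; apply: inj_row_free => u /rowP uA.
have := uA o40; have := uA o41; have := uA o42; have := uA o43.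
rewrite !mxE !big_ord_recl !big_ord0 !mxE !evalp_partial !dirderivE !evalpE !mxE /=.
set U := u 0 ord0; set V := u 0 (lift ord0 ord0).
set A := p 0 o40 in Hq Hs *; set B := p 0 o42 in Hq Hs *.
set Q := p 0 o41 in Hq Hs *; set S := p 0 o43 in Hq Hs * => s0 z0 q0 y0.
have half (x : k) : 2%:R * x = 0 -> x = 0 by move=> x0; apply: (mulfI char2); rewrite mulr0.
have {s0}VS : V * S = 0 by apply: half; rewrite -[RHS]s0; ring.
have {q0}UQ : U * Q = 0 by apply: half; rewrite -[RHS]q0; ring.
have {y0}YA : (al * U + be * V) * A = 0.
  by apply: half; apply: oppr_inj; rewrite oppr0 -[RHS]y0; ring.
have {z0}ZB : (be * U + al * V) * B = 0.
  by apply: half; apply: oppr_inj; rewrite oppr0 -[RHS]z0; ring.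
suff [U0 V0] : U = 0 /\ V = 0.
  apply/rowP => -[[|[|//]] ltj]; rewrite [RHS]mxE; [rewrite -U0 | rewrite -V0];
    by congr (u _ _); apply: val_inj.
have [A0|A0] := eqVneq A 0; have [B0|B0] := eqVneq B 0.
- by case: (quartic_point_neq0 Cp).
- have Q0 : Q != 0 by rewrite -sqrf_eq0 Hq A0 expr0n mulr0 add0r mulf_neq0 // expf_neq0.
  have S0 : S != 0 by rewrite -sqrf_eq0 Hs A0 expr0n mulr0 add0r mulf_neq0 // expf_neq0.
  by split; [apply: (mulIf Q0) | apply: (mulIf S0)]; rewrite mul0r.
- have Q0 : Q != 0 by rewrite -sqrf_eq0 Hq B0 expr0n mulr0 addr0 mulf_neq0 // expf_neq0.
  have S0 : S != 0 by rewrite -sqrf_eq0 Hs B0 expr0n mulr0 addr0 mulf_neq0 // expf_neq0.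
  by split; [apply: (mulIf Q0) | apply: (mulIf S0)]; rewrite mul0r.
have {}YA : al * U + be * V = 0 by apply: (mulIf A0); rewrite mul0r.
have {}ZB : be * U + al * V = 0 by apply: (mulIf B0); rewrite mul0r.
have D0 : al ^+ 2 - be ^+ 2 != 0 by rewrite subr_eq0.
split; apply: (mulfI D0); rewrite mulr0.
  transitivity (al * (al * U + be * V) - be * (be * U + al * V)); first by ring.
  by rewrite YA ZB; ring.
transitivity (al * (be * U + al * V) - be * (al * U + be * V)); first by ring.
by rewrite YA ZB; ring.
Qed.

(** Reflecting the signs of [q] and [s] and setting [p] or [r] to zero gives enough
    points to span the space. *)
Lemma quartic_spans (m : nat) (W : 'M[k]_(m, 4)) :
  (forall p, quartic p -> (p <= W)%MS) -> forall v : 'rV[k]_4, (v <= W)%MS.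
Proof.
move=> CW; have [a aE] := square_root al; have [b bE] := square_root be.
have a0 : a != 0 by rewrite -sqrf_eq0 aE.
have b0 : b != 0 by rewrite -sqrf_eq0 bE.
have pt y q z s : (y, z) != (0, 0) -> q ^+ 2 = al * y ^+ 2 + be * z ^+ 2 ->
    s ^+ 2 = be * y ^+ 2 + al * z ^+ 2 -> (rowseq 4 [:: y; q; z; s] <= W)%MS.
  move=> yz Hq Hs; apply: CW; apply/quarticP; rewrite !mxE; split=> //.
  apply: contraNneq yz => /rowP p0; have := p0 o40; have := p0 o42.
  by rewrite !mxE /= => -> ->.
have n10 : (1 : k, 0 : k) != (0, 0) by rewrite xpair_eqE oner_eq0.
have n01 : (0 : k, 1 : k) != (0, 0) by rewrite xpair_eqE oner_eq0 andbF.
have half (v : 'rV[k]_4) c w : c != 0 -> (w <= W)%MS -> w = c *: v -> (v <= W)%MS.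
  by move=> c0 wW wE; move: wW; rewrite wE (eqmx_scale _ c0).
have y1 : (rowseq 4 [:: 1; 0; 0; 0] <= W)%MS.
  apply: (half _ 2%:R (rowseq 4 [:: 1; a; 0; b] + rowseq 4 [:: 1; - a; 0; - b])) => //.
    by apply: addmx_sub; apply: pt => //; rewrite ?sqrrN ?aE ?bE; ring.
  by apply/rowP; elim/ord4_ind; rewrite !mxE /=; ring.
have z1 : (rowseq 4 [:: 0; 0; 1; 0] <= W)%MS.
  apply: (half _ 2%:R (rowseq 4 [:: 0; b; 1; a] + rowseq 4 [:: 0; - b; 1; - a])) => //.
    by apply: addmx_sub; apply: pt => //; rewrite ?sqrrN ?aE ?bE; ring.
  by apply/rowP; elim/ord4_ind; rewrite !mxE /=; ring.
have q1 : (rowseq 4 [:: 0; 1; 0; 0] <= W)%MS.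
  apply: (half _ (2%:R * a) (rowseq 4 [:: 1; a; 0; b] - rowseq 4 [:: 1; - a; 0; b])).
  - by rewrite mulf_neq0.
  - by apply: addmx_sub; rewrite ?eqmx_opp; apply: pt => //; rewrite ?sqrrN ?aE ?bE; ring.
  - by apply/rowP; elim/ord4_ind; rewrite !mxE /=; ring.
have s1 : (rowseq 4 [:: 0; 0; 0; 1] <= W)%MS.
  apply: (half _ (2%:R * b) (rowseq 4 [:: 1; a; 0; b] - rowseq 4 [:: 1; a; 0; - b])).
  - by rewrite mulf_neq0.
  - by apply: addmx_sub; rewrite ?eqmx_opp; apply: pt => //; rewrite ?sqrrN ?aE ?bE; ring.
  - by apply/rowP; elim/ord4_ind; rewrite !mxE /=; ring.
move=> v; have -> : v = v 0 o40 *: rowseq 4 [:: 1; 0; 0; 0] + v 0 o41 *: rowseq 4 [:: 0; 1; 0; 0]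
    + v 0 o42 *: rowseq 4 [:: 0; 0; 1; 0] + v 0 o43 *: rowseq 4 [:: 0; 0; 0; 1].
  by apply/rowP; elim/ord4_ind; rewrite !mxE /=; ring.
by rewrite !addmx_sub // scalemx_sub.
Qed.

End Quartic.

(** * Genus and degree of the embedded models *)

Section CurveTypes.
Variables (k : closedFieldType) (n : nat) (X : pset k n).
Hypotheses (curveX : curve_like X) (tanX : has_tangent_lines X).

Lemma smooth_projective_curve : projective_curve X /\ nonsingular X.
Proof.
have dimX := curve_like_dim curveX; split.
  by split=> //; apply: curve_like_irreducible.
by exists 1%N.
Qed.

(** The Hilbert polynomial [m X] vanishes at 0, which makes the arithmetic genus 1. *)
Lemma elliptic_of_hilbert (m : nat) :
  (forall d, (0 < d)%N -> hilbert_value X d (m * d)) -> elliptic_curve X.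
Proof.
move=> hilbX; have [cX nsX] := smooth_projective_curve; split=> //.
exists 1%N, (m%:R *: 'X); split; first exact: curve_like_dim.
  exists 1%N => d d0; exists (m * d)%N; first exact: hilbX.
  by rewrite hornerZ hornerX natrM.
by rewrite hornerZ hornerX mulr0 sub0r expr1 mulrNN mulr1.
Qed.

Lemma conic_of_hilbert :
  planar X -> (forall d, hilbert_value X d (2 * d + 1)) -> nonsingular_conic X.
Proof.
move=> plX hilbX; have [cX nsX] := smooth_projective_curve; split=> //.
exists 1%N, (2%:R *: 'X + 1); split; first exact: curve_like_dim.
  exists 0%N => d _; exists (2 * d + 1)%N; first exact: hilbX.
  by rewrite hornerD hornerZ hornerX hornerC natrD natrM.
by rewrite coefD coefZ coefX coef1 /= addr0 !mulr1.
Qed.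

End CurveTypes.

Section Embedded.
Variables (k : closedFieldType).
Hypothesis char2 : 2%:R != 0 :> k.

Lemma planar_embed (E : 'M[k]_(3, 6)) E' C : E *m E' = 1%:M -> planar (embed E C : pset k 5).
Proof.
move=> EE'; exists <<E>>%MS; split.
  by rewrite genmxE; apply/eqP; apply: (embed_row_free EE').
by move=> _ [q _ ->]; rewrite genmxE submxMl.
Qed.

(** The basis [1, x] contributes [(d + 1) + d = 2 d + 1] to the Hilbert function. *)
Lemma embedded_conic (E : 'M[k]_(3, 6)) E' : E *m E' = 1%:M ->
  curve_like (embed E (conic (k := k))) /\ nonsingular_conic (embed E (conic (k := k))).
Proof.
move=> EE'; have CL := conic_over_line k.
have cE := curve_like_embed EE' (finite_over_line_curve CL); split=> //.
apply: conic_of_hilbert => //.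
- exact (has_tangent_lines_embed EE' (conic_tangent char2)).
- exact (planar_embed _ EE').
move=> d; apply (hilbert_value_embed EE').
have := finite_over_line_hilbert CL d; rewrite !big_ord_recl big_ord0 /= /bump /=.
by rewrite (_ : _ + _ = 2 * d + 1)%N // subn0 addn0 subSS subn0; lia.
Qed.

(** The basis [1, x, x^2] contributes [(d + 1) + d + (d - 1) = 3 d] when [d > 0]. *)
Lemma embedded_cubic c (E : 'M[k]_(3, 6)) E' : c != 0 -> E *m E' = 1%:M ->
  [/\ curve_like (embed E (cubic c)), elliptic_curve (embed E (cubic c))
    & planar (embed E (cubic c))].
Proof.
move=> c0 EE'; have CL := cubic_over_line c0.
have cE := curve_like_embed EE' (finite_over_line_curve CL); split=> //; last first.
  exact (planar_embed _ EE').
apply: (elliptic_of_hilbert (m := 3) cE (has_tangent_lines_embed EE' (cubic_tangent c0 char2))).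
move=> d d0; apply (hilbert_value_embed EE').
have := finite_over_line_hilbert CL d; rewrite !big_ord_recl big_ord0 /= /bump /=.
by rewrite (_ : _ + _ = 3 * d)%N // ; lia.
Qed.

(** The basis [1, q, q s, s] has degrees 0, 1, 2, 1 and contributes [4 d] when [d > 0]. *)
Lemma embedded_quartic al be (E : 'M[k]_(4, 6)) E' :
  al != 0 -> be != 0 -> al ^+ 2 != be ^+ 2 -> E *m E' = 1%:M ->
  curve_like (embed E (quartic al be)) /\
  [/\ elliptic_curve (embed E (quartic al be)), in_linear_subspace (embed E (quartic al be)) 3
    & ~ planar (embed E (quartic al be))].
Proof.
move=> al0 be0 albe EE'; have CL := quartic_over_line char2 al0 be0 albe.
have cE := curve_like_embed EE' (finite_over_line_curve CL); split=> //; split.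
- apply: (elliptic_of_hilbert (m := 4) cE (has_tangent_lines_embed EE' (quartic_tangent char2 al0 be0 albe))).
  move=> d d0; apply (hilbert_value_embed EE').
  have := finite_over_line_hilbert CL d; rewrite !big_ord_recl big_ord0 /=.
  by rewrite (_ : _ + _ = 4 * d)%N //; lia.
- exists <<E>>%MS; split.
    by rewrite genmxE; apply/eqP; apply: (embed_row_free EE').
  by move=> _ [q _ ->]; rewrite genmxE submxMl.
move=> [W [rW XW]]; have : (E <= W)%MS.
  apply/row_subP => j; rewrite -[E]mul1mx row_mul submxE -mulmxA.
  apply/eqP/sub_kermxP; apply: (quartic_spans char2 al0 be0) => q Cq.
  apply/sub_kermxP; rewrite mulmxA; apply/eqP; rewrite -submxE.
  by apply: XW; exists q.
by move/mxrankS; rewrite rW (eqP (embed_row_free EE' : \rank E == _)).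
Qed.

End Embedded.

(** * The components as embedded models *)

Lemma zlocus4P (k : closedFieldType) (n : nat) (f1 f2 f3 f4 : {mpoly k[n.+1]}) p :
  zlocus [:: f1; f2; f3; f4] p <->
  [/\ p != 0, evalp f1 p = 0, evalp f2 p = 0, evalp f3 p = 0 & evalp f4 p = 0].
Proof.
split=> [[p0 Hp]|[p0 H1 H2 H3 H4]].
  by split=> //; apply: Hp; rewrite !inE eqxx ?orbT.
by split=> // f; rewrite !inE => /or4P [] /eqP ->.
Qed.

Section Components.
Variables (k : closedFieldType) (i gamma : k).
Implicit Types p : 'rV[k]_6.

Lemma L1P p : L1 gamma p <-> [/\ p != 0, p 0 o61 = 0, p 0 o64 = 0,
  p 0 o62 * p 0 o63 + p 0 o60 * p 0 o65 = 0 &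
  p 0 o60 ^+ 2 + p 0 o65 ^+ 2 + gamma * (p 0 o62 * p 0 o63) - p 0 o62 ^+ 2
    - p 0 o63 ^+ 2 = 0].
Proof. by rewrite /L1 zlocus4P !evalpE. Qed.

Lemma L2P p : L2 i p <-> [/\ p != 0, p 0 o61 = 0, p 0 o62 = 0, p 0 o65 = 0 &
  p 0 o60 ^+ 3 - p 0 o60 * p 0 o63 ^+ 2 - i * (p 0 o63 * p 0 o64 ^+ 2) = 0].
Proof. by rewrite /L2 zlocus4P !evalpE. Qed.

Lemma L3P p : L3 i p <-> [/\ p != 0, p 0 o60 = 0, p 0 o61 = 0, p 0 o63 = 0 &
  p 0 o65 ^+ 3 - p 0 o62 ^+ 2 * p 0 o65 + i * (p 0 o62 * p 0 o64 ^+ 2) = 0].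
Proof. by rewrite /L3 zlocus4P !evalpE. Qed.

Lemma L4P p : L4 i gamma p <-> [/\ p != 0, p 0 o60 = 0, p 0 o62 = 0, p 0 o64 = 0 &
  p 0 o63 ^+ 2 * p 0 o65 + i * gamma * (p 0 o61 ^+ 2 * p 0 o63) - p 0 o65 ^+ 3 = 0].
Proof. by rewrite /L4 zlocus4P !evalpE. Qed.

Lemma L5P p : L5 i gamma p <-> [/\ p != 0, p 0 o63 = 0, p 0 o64 = 0, p 0 o65 = 0 &
  p 0 o60 * p 0 o62 ^+ 2 - i * gamma * (p 0 o61 ^+ 2 * p 0 o62) - p 0 o60 ^+ 3 = 0].
Proof. by rewrite /L5 zlocus4P !evalpE. Qed.

Lemma L6aP p : L6a i p <-> [/\ p != 0, p 0 o62 = 0, p 0 o63 = 0,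
  p 0 o60 * p 0 o65 - p 0 o61 * p 0 o64 = 0 & p 0 o60 + i * p 0 o65 = 0].
Proof. by rewrite /L6a zlocus4P !evalpE. Qed.

Lemma L6bP p : L6b i p <-> [/\ p != 0, p 0 o62 = 0, p 0 o63 = 0,
  p 0 o60 * p 0 o65 - p 0 o61 * p 0 o64 = 0 & p 0 o60 - i * p 0 o65 = 0].
Proof. by rewrite /L6b zlocus4P !evalpE. Qed.

Lemma L1aP p : L1a k p <-> [/\ p != 0, p 0 o61 = 0, p 0 o64 = 0,
  p 0 o62 * p 0 o63 + p 0 o60 * p 0 o65 = 0 &
  p 0 o60 + p 0 o62 - p 0 o63 - p 0 o65 = 0].
Proof. by rewrite /L1a zlocus4P !evalpE. Qed.

Lemma L1bP p : L1b k p <-> [/\ p != 0, p 0 o61 = 0, p 0 o64 = 0,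
  p 0 o62 * p 0 o63 + p 0 o60 * p 0 o65 = 0 &
  p 0 o60 - p 0 o62 + p 0 o63 - p 0 o65 = 0].
Proof. by rewrite /L1b zlocus4P !evalpE. Qed.

End Components.

Lemma embed_eq (k : closedFieldType) (m n : nat) (E : 'M[k]_(m.+1, n.+1))
    (E' : 'M[k]_(n.+1, m.+1)) (C : pset k m) (X : pset k n) :
  (forall q, C q -> X (q *m E)) ->
  (forall p, X p -> C (p *m E') /\ p = p *m E' *m E) -> X = embed E C.
Proof.
move=> CX XC; apply: pset_ext => p; split=> [/XC [Cp pE]|[q Cq ->]].
  by exists (p *m E').
exact: CX.
Qed.

Section Identification.
Variables (k : closedFieldType) (i gamma : k).
Hypotheses (char2 : 2%:R != 0 :> k) (i2 : i ^+ 2 = -1).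

(** The four plane cubics are one curve [x^3 = x y^2 + c y z^2], placed in the plane of
    the three coordinates [s0], [s1], [s2]. *)
Lemma cubic_component (c : k) (s0 s1 s2 : 'I_6) (X : pset k 5) :
  c != 0 -> uniq [:: s0; s1; s2] ->
  (forall p, X p <-> [/\ p != 0, forall j, j \notin [:: s0; s1; s2] -> p 0 j = 0 &
     p 0 s0 ^+ 3 = p 0 s0 * p 0 s1 ^+ 2 + c * (p 0 s1 * p 0 s2 ^+ 2)]) ->
  [/\ curve_like X, elliptic_curve X & planar X].
Proof.
move=> c0 us XP; pose sel (a : 'I_3) := nth s0 [:: s0; s1; s2] a.
have selK a b : (sel a == sel b) = (a == b) by rewrite nth_uniq.
pose E : 'M[k]_(3, 6) := \matrix_(a, j) (sel a == j)%:R.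
have EE' : E *m E^T = 1%:M.
  apply/matrixP => a b; rewrite !mxE (bigD1 (sel a)) //= big1 => [|j ja].
    by rewrite !mxE eqxx mul1r addr0 selK eq_sym.
  by rewrite !mxE eq_sym (negPf ja) mul0r.
have qE (q : 'rV[k]_3) a : (q *m E) 0 (sel a) = q 0 a.
  rewrite mxE (bigD1 a) //= big1 => [|b ba]; rewrite !mxE ?eqxx ?mulr1 ?addr0 //.
  by rewrite selK (negPf ba) mulr0.
have qE0 (q : 'rV[k]_3) j : j \notin [:: s0; s1; s2] -> (q *m E) 0 j = 0.
  move=> js; rewrite mxE big1 // => a _; rewrite mxE.
  by case: eqP js => [<-|_ _]; rewrite ?mem_nth // mulr0.
have pE' (p : 'rV[k]_6) a : (p *m E^T) 0 a = p 0 (sel a).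
  rewrite mxE (bigD1 (sel a)) //= big1 => [|j ja]; rewrite !mxE ?eqxx ?mulr1 ?addr0 //.
  by rewrite eq_sym (negPf ja) mulr0.
suff -> : X = embed E (cubic c) by apply: embedded_cubic EE'.
apply: (embed_eq (E' := E^T)) => [q /cubicP [q0 Cq]|p /XP [p0 pz Xp]].
  apply/XP; split=> [||]; last by rewrite !(qE _ o30, qE _ o31, qE _ o32).
    by apply: contraNneq q0 => qE_0; rewrite -(embedK EE' q) qE_0 mul0mx.
  exact: qE0.
have pEE : p = p *m E^T *m E.
  apply/rowP => j; have [js|js] := boolP (j \in [:: s0; s1; s2]); last by rewrite pz ?qE0.
  have [a aj] : exists a, j = sel a.
    by move: js; rewrite !inE => /or3P [] /eqP ->; [exists o30 | exists o31 | exists o32].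
  by rewrite aj qE pE'.
split=> //; apply/cubicP; split; last by rewrite !pE'.
by apply: contraNneq p0 => pE'0; rewrite pEE pE'0 mul0mx.
Qed.

Lemma L2_elliptic : [/\ curve_like (L2 i), elliptic_curve (L2 i) & planar (L2 i)].
Proof.
apply: (@cubic_component i o60 o63 o64) => // [|p]; first exact: sqr_neg1_neq0 i2.
rewrite L2P; split=> [[p0 e1 e2 e5 H]|[p0 Hz H]]; split=> //.
- by elim/ord6_ind.
- by apply/sub_eq0; rewrite -[RHS]H; ring.
- exact: Hz.
- exact: Hz.
- exact: Hz.
- by rewrite H; ring.
Qed.

Lemma L3_elliptic : [/\ curve_like (L3 i), elliptic_curve (L3 i) & planar (L3 i)].
Proof.
apply: (@cubic_component (- i) o65 o62 o64) => // [|p]; first by rewrite oppr_eq0 (sqr_neg1_neq0 i2).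
rewrite L3P; split=> [[p0 e1 e2 e5 H]|[p0 Hz H]]; split=> //.
- by elim/ord6_ind.
- by apply/sub_eq0; rewrite -[RHS]H; ring.
- exact: Hz.
- exact: Hz.
- exact: Hz.
- by rewrite H; ring.
Qed.

Hypothesis gamma0 : gamma != 0.

Lemma L4_elliptic :
  [/\ curve_like (L4 i gamma), elliptic_curve (L4 i gamma) & planar (L4 i gamma)].
Proof.
apply: (@cubic_component (i * gamma) o65 o63 o61) => // [|p]; first by rewrite mulf_neq0 ?(sqr_neg1_neq0 i2).
rewrite L4P; split=> [[p0 e1 e2 e5 H]|[p0 Hz H]]; split=> //.
- by elim/ord6_ind.
- by apply/esym/sub_eq0; rewrite -[RHS]H; ring.
- exact: Hz.
- exact: Hz.
- exact: Hz.
- by rewrite H; ring.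
Qed.

Lemma L5_elliptic :
  [/\ curve_like (L5 i gamma), elliptic_curve (L5 i gamma) & planar (L5 i gamma)].
Proof.
apply: (@cubic_component (- (i * gamma)) o60 o62 o61) => // [|p].
  by rewrite oppr_eq0 mulf_neq0 ?(sqr_neg1_neq0 i2).
rewrite L5P; split=> [[p0 e1 e2 e5 H]|[p0 Hz H]]; split=> //.
- by elim/ord6_ind.
- by apply/esym/sub_eq0; rewrite -[RHS]H; ring.
- exact: Hz.
- exact: Hz.
- exact: Hz.
- by rewrite H; ring.
Qed.

End Identification.

Section Conics.
Variables (k : closedFieldType) (i : k).
Hypotheses (char2 : 2%:R != 0 :> k) (i2 : i ^+ 2 = -1).

Lemma embed_point (m : nat) (E : 'M[k]_(m.+1, 6)) E' (q : 'rV[k]_m.+1) :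
  E *m E' = 1%:M -> q != 0 -> q *m E != 0.
Proof. by move=> EE'; apply: contraNneq => qE0; rewrite -(embedK EE' q) qE0 mul0mx. Qed.

Lemma conic_component (E : 'M[k]_(3, 6)) (E' : 'M[k]_(6, 3)) (X : pset k 5) :
  E *m E' = 1%:M ->
  (forall q, q *m E != 0 -> q 0 o30 ^+ 2 = q 0 o31 * q 0 o32 -> X (q *m E)) ->
  (forall p, X p -> [/\ p != 0, p = p *m E' *m E &
     (p *m E') 0 o30 ^+ 2 = (p *m E') 0 o31 * (p *m E') 0 o32]) ->
  curve_like X /\ nonsingular_conic X.
Proof.
move=> EE' CX XC; suff -> : X = embed E (conic (k := k)) by apply: embedded_conic EE'.
apply: (embed_eq (E' := E')) => [q /conicP [q0 Cq]|p /XC [p0 pE Cp]].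
  by apply: CX => //; apply: embed_point EE' q0.
split=> //; apply/conicP; split=> //.
by apply: contraNneq p0 => pE'0; rewrite pE pE'0 mul0mx.
Qed.

Lemma L6a_conic : curve_like (L6a i) /\ nonsingular_conic (L6a i).
Proof.
(* The coordinates are [x = M34], [y = i M13] and [z = M24]. *)
apply: (@conic_component
  (mxseq 3 6 [:: [:: - i; 0; 0; 0; 0; 1]; [:: 0; - i; 0; 0; 0; 0]; [:: 0; 0; 0; 0; 1; 0]])
  (mxseq 6 3 [:: [:: 0; 0; 0]; [:: 0; i; 0]; [::]; [::]; [:: 0; 0; 1]; [:: 1; 0; 0]])).
- by apply/matrixP; elim/ord3_ind; elim/ord3_ind; rewrite !mxE sum6E !mxE /=; ring: i2.
- move=> q qE0 Cq; apply/L6aP.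
  by split=> //; rewrite !mxE !sum3E !mxE /=; ring: Cq.
move=> p /L6aP [p0 e2 e3 H12 H6].
have {}H6 : p 0 o60 = - (i * p 0 o65) by apply/eqP; rewrite -addr_eq0 H6.
have {}H12 : p 0 o61 * p 0 o64 = - i * p 0 o65 ^+ 2.
  by apply/esym/sub_eq0; rewrite -[RHS]H12 H6; ring.
split=> //; last by rewrite !mxE !sum6E !mxE /=; ring: H12 i2.
by apply/rowP; elim/ord6_ind; rewrite !mxE !sum3E !mxE !sum6E !mxE /=; ring: e2 e3 H6 i2.
Qed.

End Conics.

Section ConicsAndQuartic.
Variables (k : closedFieldType) (i : k).
Hypotheses (char2 : 2%:R != 0 :> k) (i2 : i ^+ 2 = -1).

Lemma L6b_conj : L6b i = L6a (- i).
Proof. by apply: pset_ext => p; rewrite L6aP L6bP mulNr. Qed.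

Lemma L6b_conic : curve_like (L6b i) /\ nonsingular_conic (L6b i).
Proof. by rewrite L6b_conj; apply: L6a_conic; rewrite ?sqrrN. Qed.

Local Notation h := (2%:R^-1 : k).

(** In the coordinates [p = M12 + M34], [q = M12 - M34], [r = M14 + M23] and
    [s = M14 - M23] both conics become [p^2 + r^2 = 2 q^2] in a plane [s = e q] with
    [e^2 = 1], and [p^2 + r^2] splits over [i]. *)
Lemma L1_half_conic (e : k) (X : pset k 5) : e ^+ 2 = 1 ->
  (forall p, X p <-> [/\ p != 0, p 0 o61 = 0, p 0 o64 = 0,
    p 0 o62 * p 0 o63 + p 0 o60 * p 0 o65 = 0 &
    p 0 o62 - p 0 o63 = e * (p 0 o60 - p 0 o65)]) ->
  curve_like X /\ nonsingular_conic X.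
Proof.
move=> e2 XP.
(* The coordinates are [x = q], [y = p + i r] and [z = (p - i r) / 2]. *)
apply: (@conic_component _ char2
  (mxseq 3 6 [:: [:: h; 0; h * e; - (h * e); 0; - h];
                 [:: h ^+ 2; 0; - (h ^+ 2 * i); - (h ^+ 2 * i); 0; h ^+ 2];
                 [:: h; 0; h * i; h * i; 0; h]])
  (mxseq 6 3 [:: [:: 1; 1; h]; [::]; [:: 0; i; - (h * i)]; [:: 0; i; - (h * i)]; [::];
                 [:: - 1; 1; h]])).
- by apply/matrixP; elim/ord3_ind; elim/ord3_ind; rewrite !mxE sum6E !mxE /=; field: i2.
- move=> q qE0 Cq; apply/XP.
  by split=> //; rewrite !mxE !sum3E !mxE /=; field: Cq i2 e2.
move=> p /XP [p0 e1 e4 H1 H2].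
have {}H1 : p 0 o62 * p 0 o63 = - (p 0 o60 * p 0 o65).
  by apply/eqP; rewrite -addr_eq0 H1.
have H3 : (p 0 o60 + p 0 o65) ^+ 2 + (p 0 o62 + p 0 o63) ^+ 2 =
    2%:R * (p 0 o60 - p 0 o65) ^+ 2.
  transitivity ((p 0 o60 - p 0 o65) ^+ 2 + (p 0 o62 - p 0 o63) ^+ 2
    + 4%:R * (p 0 o60 * p 0 o65) + 4%:R * (p 0 o62 * p 0 o63)); first by ring.
  by rewrite H1 H2 exprMn e2; ring.
have {}H2 : p 0 o62 = p 0 o63 + e * (p 0 o60 - p 0 o65) by rewrite -H2 addrC subrK.
split=> //; last first.
  rewrite !mxE !sum6E !mxE /=.
  transitivity (h * (2%:R * (p 0 o60 - p 0 o65) ^+ 2)); first by field.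
  by rewrite -H3; field: i2.
by apply/rowP; elim/ord6_ind; rewrite !mxE !sum3E !mxE !sum6E !mxE /=; field: e1 e4 i2 H2.
Qed.

Lemma L1a_conic : curve_like (L1a k) /\ nonsingular_conic (L1a k).
Proof.
apply: (@L1_half_conic (-1)) => [|p]; first by rewrite sqrrN expr1n.
rewrite L1aP; split=> -[p0 e1 e4 H1 H2]; split=> //.
  by apply/sub_eq0; rewrite -[RHS]H2; ring.
transitivity (p 0 o62 - p 0 o63 + (p 0 o60 - p 0 o65)); first by ring.
by rewrite H2; ring.
Qed.

Lemma L1b_conic : curve_like (L1b k) /\ nonsingular_conic (L1b k).
Proof.
apply: (@L1_half_conic 1) => [|p]; first by rewrite expr1n.
rewrite L1bP; split=> -[p0 e1 e4 H1 H2]; split=> //.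
  by apply/esym/sub_eq0; rewrite -[RHS]H2; ring.
transitivity (p 0 o60 - p 0 o65 - (p 0 o62 - p 0 o63)); first by ring.
by rewrite H2; ring.
Qed.

(** In the coordinates [p], [q], [r], [s] the two quadrics through the curve span a
    pencil of diagonal forms, which can be solved for [q^2] and [s^2]. *)
Lemma L1_elliptic (gamma : k) : gamma != 0 -> gamma ^+ 2 != 16%:R ->
  curve_like (L1 gamma) /\
  [/\ elliptic_curve (L1 gamma), in_linear_subspace (L1 gamma) 3 & ~ planar (L1 gamma)].
Proof.
move=> g0 g16.
have n4 : 4%:R != 0 :> k by rewrite (_ : 4%:R = 2%:R * 2%:R) ?mulf_neq0 // -natrM.
have g4 : 4%:R + gamma != 0.
  apply: contraNneq g16 => /eqP; rewrite addrC addr_eq0 => /eqP ->.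
  by rewrite sqrrN -natrX.
pose al := gamma / (4%:R + gamma); pose be := 4%:R / (4%:R + gamma).
have al0 : al != 0 by rewrite mulf_neq0 ?invr_eq0.
have be0 : be != 0 by rewrite mulf_neq0 ?invr_eq0.
have albe : al ^+ 2 != be ^+ 2.
  rewrite !exprMn; apply: contraNneq g16 => /mulIf -> //; first by rewrite -natrX.
  by rewrite expf_neq0 ?invr_eq0.
pose E : 'M[k]_(4, 6) := mxseq 4 6 [:: [:: h; 0; 0; 0; 0; h]; [:: h; 0; 0; 0; 0; - h];
  [:: 0; 0; h; h; 0; 0]; [:: 0; 0; h; - h; 0; 0]].
pose E' : 'M[k]_(6, 4) := mxseq 6 4 [:: [:: 1; 1; 0; 0]; [::]; [:: 0; 0; 1; 1];
  [:: 0; 0; 1; - 1]; [::]; [:: 1; - 1; 0; 0]].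
have EE' : E *m E' = 1%:M.
  by apply/matrixP; elim/ord4_ind; elim/ord4_ind; rewrite !mxE sum6E !mxE /=; field.
suff -> : L1 gamma = embed E (quartic al be) by exact (embedded_quartic char2 al0 be0 albe EE').
apply: (embed_eq (E' := E')) => [q /quarticP [q0 Hq Hs]|p /L1P [p0 e1 e4 H1 H2]].
  have qE0 := embed_point EE' q0; apply/L1P.
  split=> //; rewrite !mxE !sum4E !mxE /=; try ring.
    transitivity (h ^+ 2 * (q 0 o40 ^+ 2 + q 0 o42 ^+ 2 - q 0 o41 ^+ 2 - q 0 o43 ^+ 2)); first by ring.
    by rewrite Hq Hs /al /be; field; apply/andP.
  transitivity (h * (q 0 o40 ^+ 2 - q 0 o42 ^+ 2 + q 0 o41 ^+ 2 - q 0 o43 ^+ 2)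
    + gamma * h ^+ 2 * (q 0 o42 ^+ 2 - q 0 o43 ^+ 2)); first by field.
  by rewrite Hq Hs /al /be; field; apply/andP.
have pEE : p = p *m E' *m E.
  by apply/rowP; elim/ord6_ind; rewrite !mxE !sum4E !mxE !sum6E !mxE /=; field: e1 e4.
split=> //; apply/quarticP; split.
- by apply: contraNneq p0 => pE'0; rewrite pEE pE'0 mul0mx.
- apply/sub_eq0; rewrite !mxE !sum6E !mxE /= /al /be.
  transitivity (4%:R / (4%:R + gamma) *
    ((p 0 o60 ^+ 2 + p 0 o65 ^+ 2 + gamma * (p 0 o62 * p 0 o63) - p 0 o62 ^+ 2 - p 0 o63 ^+ 2)
     - (2%:R + gamma) * (p 0 o62 * p 0 o63 + p 0 o60 * p 0 o65))); first by field.
  by rewrite H1 H2; ring.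
apply/sub_eq0; rewrite !mxE !sum6E !mxE /= /al /be.
transitivity (- (4%:R / (4%:R + gamma)) *
  ((p 0 o60 ^+ 2 + p 0 o65 ^+ 2 + gamma * (p 0 o62 * p 0 o63) - p 0 o62 ^+ 2 - p 0 o63 ^+ 2)
   + 2%:R * (p 0 o62 * p 0 o63 + p 0 o60 * p 0 o65))); first by field.
by rewrite H1 H2; ring.
Qed.

End ConicsAndQuartic.

(** * The minors as quartics in the coordinates of a line *)

(** Generalized Laplace expansion along the pairs of columns [c] and [n + c]: each
    permutation contributes a product of 2 x 2 minors, and is counted once for each of
    the [2 ^ n] ways of swapping the two entries of the pairs. *)
Lemma laplace_column_pairs (R : comNzRingType) (n : nat) (A : 'M[R]_(n + n)) :
  \det A *+ 2 ^ n = \sum_(s : 'S_(n + n)) (-1) ^+ s * \prod_(c < n)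
    (A (s (lshift n c)) (lshift n c) * A (s (rshift n c)) (rshift n c)
     - A (s (rshift n c)) (lshift n c) * A (s (lshift n c)) (rshift n c)).
Proof.
pose a (s : 'S_(n + n)) c := A (s (lshift n c)) (lshift n c) * A (s (rshift n c)) (rshift n c).
pose b (s : 'S_(n + n)) c := A (s (rshift n c)) (lshift n c) * A (s (lshift n c)) (rshift n c).
pose G r (s : 'S_(n + n)) c := if c \in (r : seq 'I_n) then a s c - b s c else a s c.
suff pairs r : uniq r ->
    \det A *+ 2 ^ size r = \sum_(s : 'S_(n + n)) (-1) ^+ s * \prod_(c < n) G r s c.
  have := pairs _ (enum_uniq 'I_n); rewrite size_enum_ord => ->.
  by apply: eq_bigr => s _; congr (_ * _); apply: eq_bigr => c _; rewrite /G mem_enum.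
elim: r => [_|m r IH /= /andP [mr ur]].
  rewrite expn0 mulr1n -det_tr; apply: eq_bigr => s _; congr (_ * _).
  rewrite big_split_ord /= -big_split; apply: eq_bigr => c _ /=.
  by rewrite !mxE.
rewrite expnS mulnC mulrnA IH // mulr2n.
pose t : 'S_(n + n) := tperm (lshift n m) (rshift n m).
have lr c : lshift n c != rshift n m by rewrite eq_lrshift.
have rl c : rshift n c != lshift n m by rewrite eq_rlshift.
have tl c : c != m -> t (lshift n c) = lshift n c.
  by move=> cm; rewrite tpermD // eq_sym ?lr // eq_lshift.
have tr c : c != m -> t (rshift n c) = rshift n c.
  by move=> cm; rewrite tpermD // eq_sym ?rl // eq_rshift.
have Gt s c : c != m -> G r (t * s)%g c = G (m :: r) s c.
  by move=> cm; rewrite /G inE (negPf cm) /a /b !permM tl // tr.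
have GE s c : c != m -> G r s c = G (m :: r) s c by move=> cm; rewrite /G inE (negPf cm).
have Gm s : G r s m = a s m by rewrite /G (negPf mr).
have Gtm s : G r (t * s)%g m = b s m by rewrite Gm /a /b !permM tpermL tpermR.
rewrite {2}(reindex_inj (mulgI t)) -big_split; apply: eq_bigr => s _ /=.
pose rest := \prod_(c < n | c != m) G (m :: r) s c.
have -> : \prod_(c < n) G r s c = a s m * rest.
  by rewrite (bigD1 m) //= Gm (eq_bigr _ (GE s)).
have -> : \prod_(c < n) G r (t * s)%g c = b s m * rest.
  by rewrite (bigD1 m) //= Gtm (eq_bigr _ (Gt s)).
have -> : \prod_(c < n) G (m :: r) s c = (a s m - b s m) * rest.
  by rewrite (bigD1 m) //= {1}/G mem_head.
by rewrite odd_permM odd_tperm lr signr_addb expr1 mulN1r mulNr -mulrBr -mulrBl.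
Qed.

Section LineMatrix.
Variables (k : closedFieldType) (i gamma : k).

(** The nonzero entries of the left half of the matrix: the entry in row [r] and
    column [c] is a scalar multiple of a single variable [u_j]; the right half has
    the same entries with [v_j] in place of [u_j]. *)
Definition line_table : seq (seq (k * 'I_4)) :=
  [:: [:: (0, o40); (1, o40); (0, o40); (0, o40)];
      [:: (1, o41); (0, o40); (0, o40); (0, o40)];
      [:: (0, o40); (0, o40); (0, o40); (1, o42)];
      [:: (0, o40); (0, o40); (1, o43); (0, o40)];
      [:: (1, o42); (0, o40); (1, o40); (0, o40)];
      [:: (0, o40); (1, o43); (0, o40); (1, o41)];
      [:: (- 1, o43); (0, o40); (0, o40); (i, o40)];
      [:: (0, o40); (- 1, o42); (i, o41); (0, o40)];
      [:: (1, o40); (0, o40); (1, o42); (gamma, o41)];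
      [:: (0, o40); (1, o41); (1, o40); (1, o43)]].

Definition line_entry (r : 'I_10) (c : 'I_4) : k * 'I_4 :=
  nth (0, o40) (nth [::] line_table r) c.

Let U (j : 'I_4) : {mpoly k[8]} := 'X_(lshift 4 j).
Let V (j : 'I_4) : {mpoly k[8]} := 'X_(rshift 4 j).

Lemma line_matrixE (r : 'I_10) (c : 'I_4) :
  line_matrix i gamma r (lshift 4 c) = (line_entry r c).1 *: U (line_entry r c).2 /\
  line_matrix i gamma r (rshift 4 c) = (line_entry r c).1 *: V (line_entry r c).2.
Proof.
have XE (j l : 'I_8) : j = l :> nat -> 'X_j = 'X_l :> {mpoly k[8]} by move/val_inj ->.
case: r => [[|[|[|[|[|[|[|[|[|[|m]]]]]]]]]] ltr] //; elim/ord4_ind: c;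
  rewrite !mxE /line_entry /U /V /= ?scale0r ?scale1r ?scaleN1r; split=> //;
  try congr (- _); try congr (_ *: _); exact: XE.
Qed.

(** The variables stand for N12, N13, N14, N23, N24, N34, in this order. *)
Definition pair_form (j l : 'I_4) : {mpoly k[6]} :=
  nth 0 (nth [::] [:: [:: 0; 'X_o60; 'X_o61; 'X_o62];
    [:: - 'X_o60; 0; 'X_o63; 'X_o64];
    [:: - 'X_o61; - 'X_o63; 0; 'X_o65];
    [:: - 'X_o62; - 'X_o64; - 'X_o65; 0]] j) l.

Lemma pair_formE (j l : 'I_4) :
  pair_form j l \mPo Ncoords k = U j * V l - U l * V j.
Proof.
have UE (j' : 'I_4) (l' : 'I_8) : j' = l' :> nat -> U j' = 'X_l'.
  by move=> jl; congr ('X_ _); apply: val_inj.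
have VE (j' : 'I_4) (l' : 'I_8) : (4 + j')%N = l' :> nat -> V j' = 'X_l'.
  by move=> jl; congr ('X_ _); apply: val_inj.
have [U0 U1 U2 U3] : [/\ U o40 = 'X_(Ordinal (isT : 0 < 8)%N), U o41 = 'X_(Ordinal (isT : 1 < 8)%N),
  U o42 = 'X_(Ordinal (isT : 2 < 8)%N) & U o43 = 'X_(Ordinal (isT : 3 < 8)%N)].
  by split; apply: UE.
have [V0 V1 V2 V3] : [/\ V o40 = 'X_(Ordinal (isT : 4 < 8)%N), V o41 = 'X_(Ordinal (isT : 5 < 8)%N),
  V o42 = 'X_(Ordinal (isT : 6 < 8)%N) & V o43 = 'X_(Ordinal (isT : 7 < 8)%N)].
  by split; apply: VE.
elim/ord4_ind: j; elim/ord4_ind: l;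
  rewrite /pair_form /= ?comp_mpoly0 ?comp_mpolyN ?comp_mpolyXU /= ?opprB;
  by rewrite ?U0 ?U1 ?U2 ?U3 ?V0 ?V1 ?V2 ?V3; ring.
Qed.

Lemma dhomog_pair_form j l : pair_form j l \is 1.-homog.
Proof.
elim/ord4_ind: j; elim/ord4_ind: l; rewrite /pair_form /= ?rpredN;
  by rewrite ?rpred0 //; apply: homogeneousX.
Qed.

Hypothesis char2 : 2%:R != 0 :> k.

(** By the expansion along the column pairs [c] and [4 + c], whose 2 x 2 minors are
    multiples of the forms [u_j v_l - u_l v_j]; each product is counted 16 times. *)
Lemma minor_is_quartic (s : 'I_8 -> 'I_10) :
  exists F : {mpoly k[6]}, F \is 4.-homog /\
    F \mPo Ncoords k = \det (rowsub s (line_matrix i gamma)).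
Proof.
pose D (w : 'S_(4 + 4)) (c : 'I_4) : {mpoly k[6]} :=
  let x := line_entry (s (w (lshift 4 c))) c in let y := line_entry (s (w (rshift 4 c))) c in
  (x.1 * y.1) *: pair_form x.2 y.2.
pose F : {mpoly k[6]} := \sum_(w : 'S_(4 + 4)) (-1) ^+ w *: \prod_(c < 4) D w c.
have rowsE (r c : 'I_8) :
    rowsub s (line_matrix i gamma) r c = line_matrix i gamma (s r) c by rewrite [LHS]mxE.
have Dh w c : D w c \is 1.-homog by apply/dhomogZ/dhomog_pair_form.
exists ((2%:R ^+ 4)^-1 *: F); split.
  apply: dhomogZ; apply: rpred_sum => w _; apply: dhomogZ.
  rewrite !big_ord_recl big_ord0 mulr1.
  exact: (dhomogM (Dh _ _) (dhomogM (Dh _ _) (dhomogM (Dh _ _) (Dh _ _)))).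
rewrite comp_mpolyZ.
have det16 : F \mPo Ncoords k = \det (rowsub s (line_matrix i gamma)) *+ 2 ^ 4.
  rewrite (laplace_column_pairs (n := 4)) raddf_sum; apply: eq_bigr => w _ /=.
  rewrite comp_mpolyZ rmorph_prod /= -mul_mpolyC rmorph_sign; congr (_ * _).
  apply: eq_bigr => c _; rewrite /D comp_mpolyZ pair_formE !rowsE.
  have [-> ->] := line_matrixE (s (w (lshift 4 c))) c.
  have [-> ->] := line_matrixE (s (w (rshift 4 c))) c.
  by rewrite -!scalerAl -!scalerAr !scalerA scalerBr; congr (_ - _); rewrite mulrC.
rewrite det16 -scaler_nat scalerA natrX mulVf ?scale1r // expf_neq0 //.
Qed.

End LineMatrix.

(** * Points of the line scheme and relation tensors *)

(** A matrix of full column rank has an invertible maximal minor, and sorting its rows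
    only changes the sign of the determinant. *)
Lemma minors_kernel (k : fieldType) (m n : nat) (L : 'M[k]_(m, n)) :
  (forall s : 'I_n -> 'I_m, (forall a b : 'I_n, (a < b)%N -> (s a < s b)%N) ->
     \det (rowsub s L) = 0) <->
  exists2 w : 'cV[k]_n, w != 0 & L *m w = 0.
Proof.
split=> [minors0|[w w0 Lw] s _]; last first.
  apply/eqP; rewrite -det_tr; apply/det0P; exists w^T; first by rewrite trmx_eq0.
  by rewrite -trmx_mul mul_rowsub_mx Lw; apply/matrixP => a b; rewrite !mxE.
have [fullL|] := boolP (row_full L); last first.
  rewrite /row_full -mxrank_tr => rL.
  have : kermx L^T != 0 by rewrite kermx_eq0.
  case/rowV0Pn => w /sub_kermxP wL w0; exists w^T; first by rewrite trmx_eq0.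
  by apply: trmx_inj; rewrite trmx_mul trmxK wL trmx0.
pose f := fullrankfun fullL.
have uf : uniq [tuple f a | a < n].
  by rewrite map_inj_uniq ?enum_uniq //; apply: fullrankfun_inj.
pose t := sort_tuple (fun x y : 'I_m => (x <= y)%N) [tuple f a | a < n].
have /tuple_permP [w tw] : perm_eq t [tuple f a | a < n] by rewrite perm_sort.
have tE a : tnth t a = f (w a).
  by rewrite (tnth_nth (f a)) tw -tnth_nth tnth_mktuple tnth_mktuple.
have incr (a b : 'I_n) : (a < b)%N -> (tnth t a < tnth t b)%N.
  move=> ab; rewrite ltn_neqAle !tE; apply/andP; split.
    apply/eqP => /val_inj /fullrankfun_inj /perm_inj abE.
    by rewrite abE ltnn in ab.
  rewrite -!tE !(tnth_nth (f a)); apply: (sorted_leq_nth (leT := fun x y : 'I_m => (x <= y)%N)).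
  - by move=> ? ? ?; apply: leq_trans.
  - by move=> ?; apply: leqnn.
  - by apply: sort_sorted => x y; apply: leq_total.
  - by rewrite inE size_tuple.
  - by rewrite inE size_tuple.
  - exact: ltnW.
have := minors0 (tnth t) incr.
have -> : rowsub (tnth t) L = perm_mx w *m rowsub f L.
  by rewrite -row_permE; apply/matrixP => a b; rewrite !mxE tE.
rewrite det_mulmx det_perm => /eqP; rewrite mulf_eq0 signr_eq0 /=.
by have := fullrowsub_unit fullL; rewrite unitmxE unitfE => /negPf ->.
Qed.

Section Incidence.
Variables (k : closedFieldType) (i gamma : k).
Implicit Types (p : 'rV[k]_6) (u v a b : 'rV[k]_4).

Let N u v (j l : 'I_4) := u 0 j * v 0 l - u 0 l * v 0 j.

(** The coordinates of the line through [u] and [v], with the dual indexing that turns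
    [N_12] into [M_34] and [N_13] into [- M_24]. *)
Definition spans_line u v p :=
  [/\ p 0 o65 = N u v o40 o41, - p 0 o64 = N u v o40 o42 & p 0 o63 = N u v o40 o43] /\
  [/\ p 0 o62 = N u v o41 o42, - p 0 o61 = N u v o41 o43 & p 0 o60 = N u v o42 o43].

(** When the coordinate [N_jl] is not 0, the two points of the line with [j]-th and
    [l]-th coordinates (1, 0) and (0, 1), up to scalars, have the others as coordinates;
    the Pluecker relation is what makes them fit. *)
Lemma spanning_pair p : p != 0 -> evalp (plucker k) p = 0 -> exists u v, spans_line u v p.
Proof.
move=> p0; rewrite !evalpE => P0; rewrite /spans_line /N.
pose N12 := p 0 o65; pose N13 := - p 0 o64; pose N14 := p 0 o63.
pose N23 := p 0 o62; pose N24 := - p 0 o61; pose N34 := p 0 o60.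
have {}P0 : N12 * N34 = N13 * N24 - N14 * N23.
  by apply/sub_eq0; rewrite -[RHS]P0 /N12 /N13 /N14 /N23 /N24 /N34 /=; ring.
rewrite -/N12 -/N13 -/N14 -/N23 -/N24 -/N34.
have [n12|n12] := eqVneq N12 0; last first.
  exists (rowseq 4 [:: 1; 0; - N23 / N12; - N24 / N12]), (rowseq 4 [:: 0; N12; N13; N14]).
  by rewrite !mxE /=; split; split; (field: P0 || ring).
have [n13|n13] := eqVneq N13 0; last first.
  exists (rowseq 4 [:: 1; N23 / N13; 0; - N34 / N13]), (rowseq 4 [:: 0; N12; N13; N14]).
  by rewrite !mxE /=; split; split; (field: P0 || ring).
have [n14|n14] := eqVneq N14 0; last first.
  exists (rowseq 4 [:: 1; N24 / N14; N34 / N14; 0]), (rowseq 4 [:: 0; N12; N13; N14]).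
  by rewrite !mxE /=; split; split; (field: P0 || ring).
rewrite n12 n13 n14.
have [n23|n23] := eqVneq N23 0; last first.
  exists (rowseq 4 [:: 0; 1; 0; - N34 / N23]), (rowseq 4 [:: 0; 0; N23; N24]).
  by rewrite !mxE /=; split; split; (field || ring).
have [n24|n24] := eqVneq N24 0; last first.
  exists (rowseq 4 [:: 0; 1; N34 / N24; 0]), (rowseq 4 [:: 0; 0; N23; N24]).
  by rewrite !mxE /= n23; split; split; (field || ring).
exists (rowseq 4 [:: 0; 0; 1; 0]), (rowseq 4 [:: 0; 0; 0; N34]).
by rewrite !mxE /= n23 n24; split; split; ring.
Qed.

Lemma spans_line_independent u v p : p != 0 -> spans_line u v p -> exists j l, N u v j l != 0.
Proof.
move=> p0 [[e1 e2 e3] [e4 e5 e6]]; apply: NNPP => no.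
have N0 j l : N u v j l = 0 by apply/eqP/negPn/negP => Njl; apply: no; exists j, l.
case/negP: p0; apply/eqP/rowP; elim/ord6_ind; rewrite [RHS]mxE ?e1 ?e3 ?e4 ?e6 //.
  by apply: oppr_inj; rewrite e5 N0 oppr0.
by apply: oppr_inj; rewrite e2 N0 oppr0.
Qed.

(** A column is a point of the line with coordinates [p] when this matrix kills it. *)
Definition incidence p : 'M[k]_4 := mxseq 4 4
  [:: [:: p 0 o62; p 0 o64; p 0 o65; 0];
      [:: - p 0 o61; - p 0 o63; 0; p 0 o65];
      [:: p 0 o60; 0; - p 0 o63; - p 0 o64];
      [:: 0; p 0 o60; p 0 o61; p 0 o62]].

Lemma incidence_spanning u v p : spans_line u v p ->
  incidence p *m u^T = 0 /\ incidence p *m v^T = 0.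
Proof.
rewrite /spans_line /N => -[[e1 e2 e3] [e4 e5 e6]].
have {}e2 : p 0 o64 = u 0 o42 * v 0 o40 - u 0 o40 * v 0 o42.
  by apply: oppr_inj; rewrite e2; ring.
have {}e5 : p 0 o61 = u 0 o43 * v 0 o41 - u 0 o41 * v 0 o43.
  by apply: oppr_inj; rewrite e5; ring.
by split; apply/colP; elim/ord4_ind; rewrite !mxE sum4E !mxE /= ?e1 ?e2 ?e3 ?e4 ?e5 ?e6; ring.
Qed.

(** Up to sign, the entries of [incidence p *m t] are the maximal minors of the matrix
    with rows [u], [v], [t]; Cramer's rule for the pair [j], [l] gives the combination. *)
Lemma incidence_span u v p (t : 'cV[k]_4) :
  p != 0 -> spans_line u v p -> incidence p *m t = 0 ->
  exists x y : k, forall j, t j 0 = u 0 j * x + v 0 j * y.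
Proof.
move=> p0 uvp /colP Kt; have [j [l Njl]] := spans_line_independent p0 uvp.
have := Kt o40; have := Kt o41; have := Kt o42; have := Kt o43; rewrite !mxE !sum4E !mxE /=.
move: uvp; rewrite /spans_line; case=> [[-> e2 ->] [-> e5 ->]] K4 K3 K2 K1.
have {}e2 : p 0 o64 = - N u v o40 o42 by rewrite -e2 opprK.
have {}e5 : p 0 o61 = - N u v o41 o43 by rewrite -e5 opprK.
rewrite e2 e5 /N in K1 K2 K3 K4; rewrite /N in Njl.
exists ((t j 0 * v 0 l - t l 0 * v 0 j) / (u 0 j * v 0 l - u 0 l * v 0 j)).
exists ((u 0 j * t l 0 - u 0 l * t j 0) / (u 0 j * v 0 l - u 0 l * v 0 j)).
move=> m; apply: (mulIf Njl); rewrite mulrDl !mulrA !(divfK Njl).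
apply/sub_eq0; clear Njl; move: j l m; do 3!elim/ord4_ind;
  first [ring | rewrite -[RHS]K1; ring | rewrite -[RHS]K2; ring | rewrite -[RHS]K3; ring
  | rewrite -[RHS]K4; ring | apply: oppr_inj; rewrite oppr0;
    first [rewrite -[RHS]K1; ring | rewrite -[RHS]K2; ring | rewrite -[RHS]K3; ring
    | rewrite -[RHS]K4; ring]].
Qed.

(** The tensors that satisfy the ten equations given by the rows of the matrix. *)
Definition relation_tensor (A B C D E F : k) : 'M[k]_4 := mxseq 4 4
  [:: [:: A; 0; B; C]; [:: 0; - B - F; D; E];
      [:: - B; i * D; - A - gamma * E; 0]; [:: i * C; - E; 0; F]].

Lemma relation_tensorP (T : 'M[k]_4) :
  (forall r : 'I_10, \sum_c (line_entry i gamma r c).1 * T (line_entry i gamma r c).2 c = 0) <->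
  T = relation_tensor (T o40 o40) (T o40 o42) (T o40 o43) (T o41 o42) (T o41 o43) (T o43 o43).
Proof.
split=> [H|TE r].
  have e0 := H (Ordinal (isT : 0 < 10)%N); have e1 := H (Ordinal (isT : 1 < 10)%N).
  have e2 := H (Ordinal (isT : 2 < 10)%N); have e3 := H (Ordinal (isT : 3 < 10)%N).
  have e4 := H (Ordinal (isT : 4 < 10)%N); have e5 := H (Ordinal (isT : 5 < 10)%N).
  have e6 := H (Ordinal (isT : 6 < 10)%N); have e7 := H (Ordinal (isT : 7 < 10)%N).
  have e8 := H (Ordinal (isT : 8 < 10)%N); have e9 := H (Ordinal (isT : 9 < 10)%N).
  rewrite !sum4E /line_entry /= in e0 e1 e2 e3 e4 e5 e6 e7 e8 e9.
  apply/matrixP; elim/ord4_ind; elim/ord4_ind; rewrite [RHS]mxE //=; apply/sub_eq0.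
  - by rewrite -[RHS]e0; ring.
  - by rewrite -[RHS]e1; ring.
  - by rewrite -[RHS]e9; ring.
  - by rewrite -[RHS]e4; ring.
  - by apply: oppr_inj; rewrite oppr0 -[RHS]e7; ring.
  - by rewrite -[RHS]e8; ring.
  - by rewrite -[RHS]e2; ring.
  - by apply: oppr_inj; rewrite oppr0 -[RHS]e6; ring.
  - by rewrite -[RHS]e5; ring.
  - by rewrite -[RHS]e3; ring.
rewrite TE; case: r => [[|[|[|[|[|[|[|[|[|[|m]]]]]]]]]] ltr] //;
  by rewrite sum4E /line_entry /= !mxE /=; ring.
Qed.

Let L u v : 'M[k]_(10, 8) := \matrix_(r, c) evalp (line_matrix i gamma r c) (row_mx u v : 'rV_(4 + 4)).

Lemma line_matrix_kernel u v a b :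
  L u v *m (row_mx a b : 'rV_(4 + 4))^T = 0 <->
  forall r, \sum_c (line_entry i gamma r c).1 *
     (u^T *m a + v^T *m b) (line_entry i gamma r c).2 c = 0.
Proof.
have LE r : (L u v *m (row_mx a b : 'rV_(4 + 4))^T) r 0 =
    \sum_c (line_entry i gamma r c).1 * (u^T *m a + v^T *m b) (line_entry i gamma r c).2 c.
  rewrite mxE (@big_split_ord _ _ _ 4 4) /= -big_split; apply: eq_bigr => c _ /=.
  have entry m : L u v r m = evalp (line_matrix i gamma r m) (row_mx u v : 'rV_(4 + 4)).
    by rewrite [LHS]mxE.
  have column m : (row_mx a b : 'rV_(4 + 4))^T m 0 = (row_mx a b : 'rV_(4 + 4)) 0 m.
    by rewrite [LHS]mxE.
  have [lE rE] := line_matrixE i gamma r c.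
  rewrite !entry !column lE rE !evalpZ !evalpU (row_mxEl u v) (row_mxEr u v).
  rewrite (row_mxEl a b) (row_mxEr a b) !mxE !big_ord1 !mxE.
  by ring.
split=> [/colP H r|H]; first by rewrite -LE H mxE.
by apply/colP => r; rewrite LE H mxE.
Qed.

Lemma eval_quartic u v p (F : {mpoly k[6]}) (f : {mpoly k[8]}) :
  F \mPo Ncoords k = f -> spans_line u v p ->
  evalp (F \mPo dual_coords k) p = evalp f (row_mx u v : 'rV_(4 + 4)).
Proof.
move=> <- [[e1 e2 e3] [e4 e5 e6]]; rewrite /evalp !comp_mpoly_meval; apply: meval_eq.
have U (j : 'I_4) (l : 'I_8) : j = l :> nat -> (row_mx u v : 'rV_(4 + 4)) 0 l = u 0 j.
  by move=> jl; rewrite -(row_mxEl u v); congr (_ _ _); apply: val_inj.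
have V (j : 'I_4) (l : 'I_8) : (4 + j)%N = l :> nat -> (row_mx u v : 'rV_(4 + 4)) 0 l = v 0 j.
  by move=> jl; rewrite -(row_mxEr u v); congr (_ _ _); apply: val_inj.
elim/ord6_ind; rewrite !(tnth_nth 0) /= ?mevalN mevalB !mevalM !mevalXU;
  rewrite ?e1 ?e2 ?e3 ?e4 ?e5 ?e6 /N;
  by congr (_ * _ - _ * _); symmetry; first [exact: U | exact: V].
Qed.

Hypothesis char2 : 2%:R != 0 :> k.

(** A point lies on the line scheme exactly when its line contains the columns of a
    nonzero relation tensor: a kernel vector [(a, b)] of the matrix at [(u, v)] is a
    relation tensor of the form [u a + v b]. *)
Lemma line_schemeP p : reduced_line_scheme i gamma p <->
  [/\ p != 0, evalp (plucker k) p = 0 & exists A B C D E F,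
     relation_tensor A B C D E F != 0 /\ incidence p *m relation_tensor A B C D E F = 0].
Proof.
split=> [[p0 Hp] | [p0 P0 [A [B [C [D [E [F]]]]]]]].
  have P0 : evalp (plucker k) p = 0 by apply: Hp; left.
  split=> //; have [u [v uvp]] := spanning_pair p0 P0.
  have : forall s : 'I_8 -> 'I_10, (forall a b : 'I_8, (a < b)%N -> (s a < s b)%N) ->
      \det (rowsub s (L u v)) = 0.
    move=> s incr; have [F [homF FE]] := minor_is_quartic i gamma char2 s.
    have := Hp _ (or_intror (ex_intro _ s (ex_intro _ F (And4 incr homF FE erefl)))).
    rewrite (eval_quartic FE uvp) /evalp -det_map_mx => <-; congr (\det _).
    by apply/matrixP => r c; rewrite !mxE.
  case/minors_kernel => w w0 Lw.
  pose a := lsubmx (w^T : 'rV_(4 + 4)); pose b := rsubmx (w^T : 'rV_(4 + 4)).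
  have wE : w = (row_mx a b : 'rV_(4 + 4))^T by rewrite hsubmxK trmxK.
  move: Lw; rewrite wE => /line_matrix_kernel /relation_tensorP.
  set T := u^T *m a + v^T *m b => TE.
  exists (T o40 o40), (T o40 o42), (T o40 o43), (T o41 o42), (T o41 o43), (T o43 o43).
  rewrite -TE; split; last first.
    have [Ku Kv] := incidence_spanning uvp.
    by rewrite mulmxDr !mulmxA Ku Kv !mul0mx addr0.
  apply: contraNneq w0 => T0; rewrite wE trmx_eq0.
  have [j [l Njl]] := spans_line_independent p0 uvp.
  have Tjl c : u 0 j * a 0 c + v 0 j * b 0 c = 0 /\ u 0 l * a 0 c + v 0 l * b 0 c = 0.
    have /matrixP T0' := T0; have := T0' l c; have := T0' j c.
    by rewrite !mxE !big_ord1 !mxE.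
  have a0 : a = 0.
    apply/rowP => c; have [ej el] := Tjl c; rewrite [RHS]mxE; apply: (mulfI Njl); rewrite mulr0.
    transitivity (v 0 l * (u 0 j * a 0 c + v 0 j * b 0 c)
      - v 0 j * (u 0 l * a 0 c + v 0 l * b 0 c)); first by rewrite /N; ring.
    by rewrite ej el !mulr0 subr0.
  have b0 : b = 0.
    apply/rowP => c; have [ej el] := Tjl c; rewrite [RHS]mxE; apply: (mulfI Njl); rewrite mulr0.
    transitivity (u 0 j * (u 0 l * a 0 c + v 0 l * b 0 c)
      - u 0 l * (u 0 j * a 0 c + v 0 j * b 0 c)); first by rewrite /N; ring.
    by rewrite ej el !mulr0 subr0.
  by rewrite a0 b0 row_mx0.
set T := relation_tensor A B C D E F => -[T0 KT].
have [u [v uvp]] := spanning_pair p0 P0.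
have span c : exists x y : k, forall j, T j c = u 0 j * x + v 0 j * y.
  have [|x [y xyE]] := @incidence_span u v p (col c T) p0 uvp.
    apply/colP => j; move/matrixP/(_ j c): KT; rewrite [LHS]mxE => KTjc.
    transitivity ((0 : 'M[k]_4) j c); last by rewrite !mxE.
    by rewrite [LHS]mxE -KTjc; apply: eq_bigr => l _; congr (_ * _); rewrite mxE.
  by exists x, y => j; rewrite -xyE [RHS]mxE.
have [a0 [b0 E0]] := span o40; have [a1 [b1 E1]] := span o41.
have [a2 [b2 E2]] := span o42; have [a3 [b3 E3]] := span o43.
pose a := rowseq 4 [:: a0; a1; a2; a3]; pose b := rowseq 4 [:: b0; b1; b2; b3].
have TE : T = u^T *m a + v^T *m b.
  by apply/matrixP => j; elim/ord4_ind; rewrite ?E0 ?E1 ?E2 ?E3 !mxE !big_ord1 !mxE.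
have Lab : L u v *m (row_mx a b : 'rV_(4 + 4))^T = 0.
  apply/line_matrix_kernel/relation_tensorP; rewrite -TE.
  by rewrite {1}/T /relation_tensor !mxE.
split=> // G [-> // | [s [Q [incr homQ QE ->]]]].
rewrite (eval_quartic QE uvp) /evalp -det_map_mx.
transitivity (\det (rowsub s (L u v))).
  by congr (\det _); apply/matrixP => r c; rewrite !mxE.
apply: (minors_kernel _).2 incr; exists (row_mx a b : 'rV_(4 + 4))^T => //.
rewrite trmx_eq0; apply: contraNneq T0 => ab0.
have a0' : a = 0 by rewrite -(row_mxKl a b) ab0 linear0.
have b0' : b = 0 by rewrite -(row_mxKr a b) ab0 linear0.
by rewrite TE a0' b0' !mulmx0 addr0.
Qed.

End Incidence.

(** * Solving the bilinear system *)

Section Locus.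
Variables (k : fieldType) (i gamma : k).
Hypotheses (char2 : 2%:R != 0 :> k) (i2 : i ^+ 2 = -1) (gamma0 : gamma != 0).

Lemma combine1 (x c1 y1 : k) : y1 = 0 -> x = c1 * y1 -> x = 0.
Proof. by move=> -> ->; rewrite mulr0. Qed.

Lemma combine2 (x c1 c2 y1 y2 : k) : y1 = 0 -> y2 = 0 -> x = c1 * y1 + c2 * y2 -> x = 0.
Proof. by move=> -> -> ->; rewrite !mulr0 addr0. Qed.

Lemma combine3 (x c1 c2 c3 y1 y2 y3 : k) : y1 = 0 -> y2 = 0 -> y3 = 0 ->
  x = c1 * y1 + c2 * y2 + c3 * y3 -> x = 0.
Proof. by move=> -> -> -> ->; rewrite !mulr0 !addr0. Qed.

Lemma combine4 (x c1 c2 c3 c4 y1 y2 y3 y4 : k) : y1 = 0 -> y2 = 0 -> y3 = 0 -> y4 = 0 ->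
  x = c1 * y1 + c2 * y2 + c3 * y3 + c4 * y4 -> x = 0.
Proof. by move=> -> -> -> -> ->; rewrite !mulr0 !addr0. Qed.

Lemma cancel_factor (x y : k) : x != 0 -> x * y = 0 -> y = 0.
Proof. by move=> x0 /eqP; rewrite mulf_eq0 (negPf x0) => /eqP. Qed.

(** The entries of the product of the incidence matrix with a relation tensor, where
    [a], [b], [c], [d], [e], [f] stand for M12, M34, M14, M23, M13, M24. *)
Definition incident (a b c d e f A B C D E F : k) : Prop :=
  [/\ [/\ c * A - b * B = 0, e * A - i * b * C = 0, a * A + d * B - i * f * C = 0
        & e * B - i * c * C = 0],
      [/\ f * (B + F) - i * b * D = 0, d * (B + F) - b * E = 0, f * E - i * d * D = 0
        & a * (B + F) - i * e * D + c * E = 0],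
      [/\ c * B + f * D - b * (A + gamma * E) = 0, e * B + d * D = 0,
          a * B + d * (A + gamma * E) = 0 & a * D - e * (A + gamma * E) = 0]
    & [/\ c * C + f * E = 0, b * F - e * C - d * E = 0, a * C - f * F = 0
        & a * E + c * F = 0]].

Definition on_some_curve (a b c d e f : k) : Prop :=
  [\/ [/\ e = 0, f = 0, c * d + a * b = 0 &
          a ^+ 2 + b ^+ 2 + gamma * (c * d) - c ^+ 2 - d ^+ 2 = 0],
      [/\ e = 0, c = 0, b = 0 & a ^+ 3 - a * d ^+ 2 - i * (d * f ^+ 2) = 0]
      \/ [/\ a = 0, e = 0, d = 0 & b ^+ 3 - c ^+ 2 * b + i * (c * f ^+ 2) = 0],
      [/\ a = 0, c = 0, f = 0 & d ^+ 2 * b + i * gamma * (e ^+ 2 * d) - b ^+ 3 = 0]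
      \/ [/\ d = 0, f = 0, b = 0 & a * c ^+ 2 - i * gamma * (e ^+ 2 * c) - a ^+ 3 = 0]
    | [/\ c = 0, d = 0, a * b - e * f = 0 & a + i * b = 0]
      \/ [/\ c = 0, d = 0, a * b - e * f = 0 & a - i * b = 0]].

(** The equations make [e B], [c C], [f E] and [d D] equal up to units with clashing
    signs, so that these products vanish. According to which of [e] and [f] are zero,
    the remaining equations are solved for one unknown, whose coefficient is the
    equation of the curve. *)
Lemma relation_locus (a b c d e f A B C D E F : k) :
  ~ [/\ A = 0, B = 0 & C = 0] \/ ~ [/\ D = 0, E = 0 & F = 0] ->
  ~ [/\ a = 0, b = 0 & c = 0] \/ ~ [/\ d = 0, e = 0 & f = 0] ->
  a * b - e * f + c * d = 0 ->
  incident a b c d e f A B C D E F ->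
  on_some_curve a b c d e f.
Proof.
move=> T0 p0 P0 [[h1 h2 h3 h4] [h5 h6 h7 h8] [h9 h10 h11 h12] [h13 h14 h15 h16]].
have vanish : A = 0 -> B = 0 -> C = 0 -> D = 0 -> E = 0 -> F = 0 -> False.
  by move=> A0 B0 C0 D0 E0 F0; case: T0 => H; apply: H.
have i0 := sqr_neg1_neq0 i2.
have dD : d * D = 0.
  apply: (cancel_factor char2); apply: (@combine4 _ 1 (-1) (- i) i _ _ _ _ h10 h4 h13 h7).
  by ring: i2.
have eB : e * B = 0 by apply: (@combine2 _ 1 (-1) _ _ h10 dD); ring.
have cC : c * C = 0 by apply: (@combine2 _ i (- i) _ _ h4 eB); ring: i2.
have fE : f * E = 0 by apply: (@combine2 _ 1 (-1) _ _ h13 cC); ring.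
have [e0|e0] := eqVneq e 0; have [f0|f0] := eqVneq f 0.
- (* A nonzero [C] or [D] leaves only a coordinate point; otherwise the quadric [Q] is
     the coefficient of [A], or of [E] and [F] when [A] is zero. *)
  subst e f.
  have [C0|C0] := eqVneq C 0; last first.
    apply: Or42; left; split=> //.
    + by apply: (cancel_factor C0); rewrite mulrC.
    + by apply: (cancel_factor C0); apply: (cancel_factor i0); apply: (@combine1 _ (-1) _ h2); ring.
    + have -> : a = 0 by apply: (cancel_factor C0); apply: (@combine1 _ 1 _ h15); ring.
      by ring.
  have [D0|D0] := eqVneq D 0; last first.
    have a0 : a = 0 by apply: (cancel_factor D0); apply: (@combine1 _ 1 _ h12); ring.
    have d0 : d = 0 by apply: (cancel_factor D0); rewrite mulrC.
    have b0 : b = 0.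
      by apply: (cancel_factor D0); apply: (cancel_factor i0); apply: (@combine1 _ (-1) _ h5); ring.
    by apply: Or42; right; rewrite b0; split=> //; ring.
  apply: Or41; split=> //; first by apply: (@combine1 _ 1 _ P0); ring.
  subst C D; set Q := a ^+ 2 + _ + _ - _ - _.
  have QA : Q * A = 0.
    have k1 : (b ^+ 2 - c ^+ 2) * A + gamma * b ^+ 2 * E = 0.
      by apply: (@combine2 _ (- c) (- b) _ _ h1 h9); ring.
    have k2 : (a ^+ 2 - d ^+ 2) * A - gamma * d ^+ 2 * E = 0.
      by apply: (@combine2 _ a (- d) _ _ h3 h11); ring.
    have k3 : c * d * A - (b ^+ 2 - d ^+ 2) * E = 0.
      by apply: (@combine3 _ b (- d) d _ _ _ h6 h14 h1); ring.
    by apply: (@combine3 _ 1 1 gamma _ _ _ k1 k2 k3); rewrite /Q; ring.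
  have [A0|A0] := eqVneq A 0; last by apply: (cancel_factor A0); rewrite mulrC.
  subst A.
  have bB : b * B = 0 by apply: (@combine1 _ (-1) _ h1); ring.
  have dB : d * B = 0 by apply: (@combine1 _ 1 _ h3); ring.
  have bbE : b ^+ 2 * E = 0.
    by apply: (cancel_factor gamma0); apply: (@combine2 _ (- b) c _ _ h9 bB); ring.
  have ddE : d ^+ 2 * E = 0.
    by apply: (cancel_factor gamma0); apply: (@combine2 _ d (- a) _ _ h11 dB); ring.
  have [b0|b0] := eqVneq b 0; last first.
    have B0 := cancel_factor b0 bB; have E0 := cancel_factor (expf_neq0 2 b0) bbE.
    subst B E; case: vanish => //; apply: (cancel_factor b0).
    by apply: (@combine1 _ 1 _ h14); ring.
  have [d0|d0] := eqVneq d 0; last first.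
    have B0 := cancel_factor d0 dB; have E0 := cancel_factor (expf_neq0 2 d0) ddE.
    subst B E; case: vanish => //; apply: (cancel_factor d0).
    by apply: (@combine1 _ 1 _ h6); ring.
  subst b d.
  have aB : a * B = 0 by apply: (@combine1 _ 1 _ h11); ring.
  have cB : c * B = 0 by apply: (@combine1 _ 1 _ h9); ring.
  have B0 : B = 0.
    have [a0|a0] := eqVneq a 0; last exact: cancel_factor a0 aB.
    have [c0|c0] := eqVneq c 0; last exact: cancel_factor c0 cB.
    by case: p0 => -[].
  subst B; rewrite add0r in h8.
  have QE : Q * E = 0 by apply: (@combine2 _ a (- c) _ _ h16 h8); rewrite /Q; ring.
  have QF : Q * F = 0 by apply: (@combine2 _ a (- c) _ _ h8 h16); rewrite /Q; ring.
  have [E0|E0] := eqVneq E 0; last by apply: (cancel_factor E0); rewrite mulrC.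
  have [F0|F0] := eqVneq F 0; last by apply: (cancel_factor F0); rewrite mulrC.
  by case: vanish.
- (* The equation of the curve is the coefficient of [B]. *)
  subst e; have E0 := cancel_factor f0 fE; subst E.
  have [b0|b0] := eqVneq b 0.
    subst b; have FB : B + F = 0.
      by apply: (cancel_factor f0); apply: (@combine1 _ 1 _ h5); ring.
    have {FB}FB : F = - B by apply/eqP; rewrite -addr_eq0 addrC FB.
    subst F.
    have cB : c * B = 0 by apply: (@combine1 _ (-1) _ h16); ring.
    have D0 : D = 0 by apply: (cancel_factor f0); apply: (@combine2 _ 1 (-1) _ _ h9 cB); ring.
    subst D; have [c0|c0] := eqVneq c 0; last first.
      have B0 := cancel_factor c0 cB; have C0 := cancel_factor c0 cC; subst B C.
      case: vanish => //; last by rewrite oppr0.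
      by apply: (cancel_factor c0); apply: (@combine1 _ 1 _ h1); ring.
    subst c; apply: Or42; left; split=> //; set X := _ - _ - _.
    have XB : X * B = 0.
      by apply: (@combine3 _ (- i * d * f) (- a * d) (a ^+ 2) _ _ _ h15 h3 h11); rewrite /X; ring: i2.
    have [B0|B0] := eqVneq B 0; last by apply: (cancel_factor B0); rewrite mulrC.
    subst B; have [a0|a0] := eqVneq a 0; last first.
      have C0 : C = 0 by apply: (cancel_factor a0); apply: (@combine1 _ 1 _ h15); ring.
      subst C; case: vanish => //; last by rewrite oppr0.
      by apply: (cancel_factor a0); apply: (@combine1 _ 1 _ h3); ring.
    subst a; have C0 : C = 0.
      by apply: (cancel_factor f0); apply: (cancel_factor i0); apply: (@combine1 _ (-1) _ h3); ring.
    subst C; have [d0|d0] := eqVneq d 0; first by rewrite /X d0; ring.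
    case: vanish => //; last by rewrite oppr0.
    by apply: (cancel_factor d0); apply: (@combine1 _ 1 _ h11); ring.
  have C0 : C = 0.
    by apply: (cancel_factor b0); apply: (cancel_factor i0); apply: (@combine1 _ (-1) _ h2); ring.
  subst C; have F0 : F = 0 by apply: (cancel_factor b0); apply: (@combine1 _ 1 _ h14); ring.
  subst F; have aB : a * B = 0 by apply: (@combine1 _ 1 _ h8); ring.
  have dB : d * B = 0 by apply: (@combine1 _ 1 _ h6); ring.
  have dA : d * A = 0 by apply: (@combine2 _ 1 (-1) _ _ h11 aB); ring.
  have aA : a * A = 0 by apply: (@combine2 _ 1 (-1) _ _ h3 dB); ring.
  have D0 : B = 0 -> D = 0.
    move=> B0; apply: (cancel_factor b0); apply: (cancel_factor i0).
    by apply: (@combine1 _ (-1) _ h5); rewrite B0; ring.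
  have [a0|a0] := eqVneq a 0; last first.
    by case: vanish => //; [apply: cancel_factor a0 aA | apply: cancel_factor a0 aB
      | apply/D0/(cancel_factor a0 aB)].
  have [d0|d0] := eqVneq d 0; last first.
    by case: vanish => //; [apply: cancel_factor d0 dA | apply: cancel_factor d0 dB
      | apply/D0/(cancel_factor d0 dB)].
  subst a d; apply: Or42; right; split=> //; set X := _ - _ + _.
  have XB : X * B = 0.
    by apply: (@combine3 _ (- b ^+ 2) (- b * c) (i * c * f) _ _ _ h1 h9 h5); rewrite /X; ring: i2.
  have [B0|B0] := eqVneq B 0; last by apply: (cancel_factor B0); rewrite mulrC.
  have {}D0 := D0 B0; subst B D; case: vanish => //.
  by apply: (cancel_factor b0); apply: (@combine1 _ (-1) _ h9); ring.
- (* The equation of the curve is the coefficient of [E]. *)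
  subst f; have B0 := cancel_factor e0 eB; subst B.
  have [b0|b0] := eqVneq b 0.
    subst b; have A0 : A = 0 by apply: (cancel_factor e0); apply: (@combine1 _ 1 _ h2); ring.
    subst A; have dE : d * E = 0.
      by apply: (cancel_factor gamma0); apply: (@combine1 _ 1 _ h11); ring.
    have C0 : C = 0.
      by apply: (cancel_factor e0); apply: (@combine2 _ (-1) (-1) _ _ h14 dE); ring.
    subst C; have [d0|d0] := eqVneq d 0; last first.
      have D0 := cancel_factor d0 dD; have E0 := cancel_factor d0 dE; subst D E.
      by case: vanish => //; apply: (cancel_factor d0); apply: (@combine1 _ 1 _ h6); ring.
    subst d; apply: Or43; right; split=> //; set X := _ - _ - _.
    have XE : X * E = 0.
      by apply: (@combine3 _ (- a ^+ 2) (a * c) (i * c * e) _ _ _ h16 h8 h12); rewrite /X; ring: i2.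
    have [E0|E0] := eqVneq E 0; last by apply: (cancel_factor E0); rewrite mulrC.
    subst E; have [a0|a0] := eqVneq a 0; last first.
      have D0 : D = 0 by apply: (cancel_factor a0); apply: (@combine1 _ 1 _ h12); ring.
      subst D; case: vanish => //.
      by apply: (cancel_factor a0); apply: (@combine1 _ 1 _ h8); ring.
    subst a; have D0 : D = 0.
      by apply: (cancel_factor e0); apply: (cancel_factor i0); apply: (@combine1 _ (-1) _ h8); ring.
    subst D; have [c0|c0] := eqVneq c 0; first by rewrite /X c0; ring.
    case: vanish => //.
    by apply: (cancel_factor c0); apply: (@combine1 _ 1 _ h16); ring.
  have R0 : A + gamma * E = 0.
    by apply: (cancel_factor b0); apply: (@combine1 _ (-1) _ h9); ring.
  have {R0}AE : A = - (gamma * E) by apply/eqP; rewrite -addr_eq0 R0.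
  have D0 : D = 0.
    by apply: (cancel_factor b0); apply: (cancel_factor i0); apply: (@combine1 _ (-1) _ h5); ring.
  subst D; have [E0|E0] := eqVneq E 0.
    have A0 : A = 0 by rewrite AE E0 mulr0 oppr0.
    have C0 : C = 0.
      apply: (cancel_factor b0); apply: (cancel_factor i0).
      by apply: (@combine1 _ (-1) _ h2); rewrite A0; ring.
    subst E A C; case: vanish => //.
    by apply: (cancel_factor b0); apply: (@combine1 _ 1 _ h14); ring.
  have A0 : A != 0 by rewrite AE oppr_eq0 mulf_neq0.
  have c0 : c = 0 by apply: (cancel_factor A0); apply: (@combine1 _ 1 _ h1); ring.
  have a0 : a = 0 by apply: (cancel_factor A0); apply: (@combine1 _ 1 _ h3); ring.
  apply: Or43; left; split=> //; apply: (cancel_factor E0).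
  apply: (@combine3 _ (b ^+ 2) (- b * d) (- i * d * e) _ _ _ h6 h14 h2).
  by rewrite AE; ring: i2.
(* The unknowns [C] and [D] are eigenvectors for the scalar [a^2 + b^2], which splits
   over [i] and separates the two conics. *)
have B0 := cancel_factor e0 eB; have E0 := cancel_factor f0 fE; subst B E.
have [c0|c0] := eqVneq c 0; last first.
  have C0 := cancel_factor c0 cC; subst C.
  have F0 : F = 0 by apply: (cancel_factor c0); apply: (@combine1 _ 1 _ h16); ring.
  subst F; case: vanish => //.
    by apply: (cancel_factor c0); apply: (@combine1 _ 1 _ h1); ring.
  by apply: (cancel_factor e0); apply: (cancel_factor i0); apply: (@combine1 _ (-1) _ h8); ring.
have [d0|d0] := eqVneq d 0; last first.
  have D0 := cancel_factor d0 dD; subst D.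
  have F0 : F = 0 by apply: (cancel_factor d0); apply: (@combine1 _ 1 _ h6); ring.
  subst F; case: vanish => //.
    by apply: (cancel_factor d0); apply: (@combine1 _ 1 _ h11); ring.
  by apply: (cancel_factor e0); apply: (@combine1 _ (-1) _ h14); ring.
subst c d.
have aDbC : a * D - i * b * C = 0 by apply: (@combine2 _ 1 1 _ _ h12 h2); ring.
have aCbD : a * C - i * b * D = 0.
  by apply: (cancel_factor e0); apply: (@combine2 _ (- a) b _ _ h14 h8); ring.
have sqD : (a + i * b) * (a - i * b) * D = 0.
  by apply: (@combine2 _ a (i * b) _ _ aDbC aCbD); ring: i2.
have sqC : (a + i * b) * (a - i * b) * C = 0.
  by apply: (@combine2 _ a (i * b) _ _ aCbD aDbC); ring: i2.
have sq0 : (a + i * b) * (a - i * b) = 0.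
  have [D0|D0] := eqVneq D 0; last by apply: (cancel_factor D0); rewrite mulrC.
  have [C0|C0] := eqVneq C 0; last by apply: (cancel_factor C0); rewrite mulrC.
  subst C D; case: vanish => //.
    by apply: (cancel_factor e0); apply: (@combine1 _ 1 _ h2); ring.
  by apply: (cancel_factor f0); apply: (@combine1 _ (-1) _ h15); ring.
have abef : a * b - e * f = 0 by apply: (@combine1 _ 1 _ P0); ring.
by move/eqP: sq0; rewrite mulf_eq0 => /orP [] /eqP z0; apply: Or44; [left | right].
Qed.

(** On each curve the relation tensor is a polynomial function of the point, up to
    finitely many points that need their own. *)
Lemma locus_relation (a b c d e f : k) :
  ~ [/\ a = 0, b = 0 & c = 0] \/ ~ [/\ d = 0, e = 0 & f = 0] ->
  on_some_curve a b c d e f ->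
  a * b - e * f + c * d = 0 /\
  exists A B C D E F, [|| A != 0, B != 0, C != 0, D != 0, E != 0 | F != 0] /\
    incident a b c d e f A B C D E F.
Proof.
move=> p0; have vanish : a = 0 -> b = 0 -> c = 0 -> d = 0 -> e = 0 -> f = 0 -> False.
  by move=> a0 b0 c0 d0 e0 f0; case: p0 => H; apply: H.
have one : (1 : k) != 0 := oner_neq0 k.
case.
- move=> [e0 f0 H1 H2]; subst e f; split; first by apply: (@combine1 _ 1 _ H1); ring.
  have [b0|b0] := eqVneq b 0; last first.
    exists (gamma * b ^+ 3), (gamma * b ^+ 2 * c), 0, 0,
      (b * (c ^+ 2 - b ^+ 2)), (d * (c ^+ 2 - b ^+ 2)).
    split; first by rewrite mulf_neq0 // expf_neq0.
    split; split; try by ring.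
    + by apply: (@combine1 _ (gamma * b ^+ 2) _ H1); ring.
    + by apply: (@combine2 _ (b ^+ 2) (c * d - a * b) _ _ H2 H1); ring.
    + by apply: (@combine2 _ (- c * b) (gamma * b * c + a * c - b * d) _ _ H2 H1); ring.
    + by apply: (@combine1 _ (gamma * b * c) _ H1); ring.
    + by apply: (@combine1 _ (c ^+ 2 - b ^+ 2) _ H1); ring.
  subst b; have [c0|c0] := eqVneq c 0.
    subst c; exists (- d), a, 0, 0, 0, (- a); split.
      rewrite oppr_eq0; have [d0|//] := eqVneq d 0; have [a0|//] := eqVneq a 0.
      by case: vanish.
    split; split; try by ring.
    by apply: (@combine1 _ 1 _ H2); ring.
  have d0 : d = 0 by apply: (cancel_factor c0); apply: (@combine1 _ 1 _ H1); ring.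
  subst d; exists 0, 0, 0, 0, a, (- c); split; first by rewrite oppr_eq0 c0 !orbT.
  split; split; try by ring.
  by apply: (@combine1 _ 1 _ H2); ring.
- case=> [[e0 c0 b0 H]|[a0 e0 d0 H]].
    subst e c b; split; first by ring.
    have [a0|a0] := eqVneq a 0; last first.
      exists (- a ^+ 2), (a * d), (- f * d), 0, 0, (- a * d).
      split; first by rewrite oppr_eq0 expf_neq0.
      split; split; try by ring.
      by apply: (@combine1 _ (-1) _ H); ring.
    subst a; have [d0|d0] := eqVneq d 0.
      subst d; exists 1, 0, 0, 0, 0, 0; split; first by rewrite one.
      by split; split; ring.
    have f0 : f = 0.
      have : f ^+ 2 = 0.
        by apply: (cancel_factor d0); apply: (cancel_factor (sqr_neg1_neq0 i2));
          apply: (@combine1 _ (-1) _ H); ring.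
      by move/eqP; rewrite sqrf_eq0 => /eqP.
    subst f; exists 0, 0, 1, 0, 0, 0; split; first by rewrite one !orbT.
    by split; split; ring.
  subst a e d; split; first by ring.
  have [b0|b0] := eqVneq b 0; last first.
    exists (b * c - i * f ^+ 2), (b ^+ 2), 0, (- i * f * b), 0, 0.
    split; first by rewrite (expf_neq0 2 b0) orbT.
    split; split; try by ring: i2.
    by apply: (@combine1 _ (-1) _ H); ring: i2.
  subst b; have [c0|c0] := eqVneq c 0.
    subst c; exists 1, 0, 0, 0, 0, 0; split; first by rewrite one.
    by split; split; ring.
  have f0 : f = 0.
    have : f ^+ 2 = 0.
      by apply: (cancel_factor c0); apply: (cancel_factor (sqr_neg1_neq0 i2));
        apply: (@combine1 _ 1 _ H); ring.
    by move/eqP; rewrite sqrf_eq0 => /eqP.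
  subst f; exists 0, 0, 0, 1, 0, 0; split; first by rewrite one !orbT.
  by split; split; ring.
- have ig0 : i * gamma != 0 by rewrite mulf_neq0 ?(sqr_neg1_neq0 i2).
  case=> [[a0 c0 f0 H]|[d0 f0 b0 H]].
    subst a c f; split; first by ring.
    have [b0|b0] := eqVneq b 0; last first.
      exists (- (gamma * b * d)), 0, (i * gamma * d * e), 0, (b * d), (b ^+ 2).
      split; first by rewrite (expf_neq0 2 b0) !orbT.
      split; split; try by ring: i2.
      by apply: (@combine1 _ (-1) _ H); ring.
    subst b; have [e0|e0] := eqVneq e 0.
      subst e; exists 0, 0, 1, 0, 0, 0; split; first by rewrite one !orbT.
      by split; split; ring.
    have d0 : d = 0.
      by apply: (cancel_factor (expf_neq0 2 e0)); apply: (cancel_factor ig0);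
        apply: (@combine1 _ 1 _ H); ring.
    subst d; exists 0, 0, 0, 0, 0, 1; split; first by rewrite one !orbT.
    by split; split; ring.
  subst d f b; split; first by ring.
  have [a0|a0] := eqVneq a 0; last first.
    exists 0, 0, 0, (- (gamma * e * c)), (- (a * c)), (a ^+ 2).
    split; first by rewrite (expf_neq0 2 a0) !orbT.
    split; split; try by ring.
    by apply: (@combine1 _ (-1) _ H); ring.
  subst a; have [e0|e0] := eqVneq e 0.
    subst e; exists 0, 0, 0, 1, 0, 0; split; first by rewrite one !orbT.
    by split; split; ring.
  have c0 : c = 0.
    by apply: (cancel_factor (expf_neq0 2 e0)); apply: (cancel_factor ig0);
      apply: (@combine1 _ (-1) _ H); ring.
  subst c; exists 0, 0, 0, 0, 0, 1; split; first by rewrite one !orbT.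
  by split; split; ring.
case=> -[c0 d0 H aib]; subst c d; (split; first by apply: (@combine1 _ 1 _ H); ring).
  have aE : a = - (i * b) by apply/eqP; rewrite -addr_eq0 aib.
  subst a; exists (- f), 0, b, (- b), 0, e; split.
    rewrite !oppr_eq0; have [f0|//] := eqVneq f 0.
    have [b0|b0] := eqVneq b 0; last by rewrite /= orbT.
    have [e0|e0] := eqVneq e 0; last by rewrite /= !orbT.
    by case: vanish => //; rewrite b0 mulr0 oppr0.
  by split; split; first [ring: i2 | apply: (@combine1 _ 1 _ H); ring: i2
    | apply: (@combine1 _ (-1) _ H); ring: i2].
have aE : a = i * b by apply/eqP; rewrite -subr_eq0 aib.
subst a; exists f, 0, b, b, 0, e; split.
  have [f0|//] := eqVneq f 0.
  have [b0|b0] := eqVneq b 0; last by rewrite /= orbT.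
  have [e0|e0] := eqVneq e 0; last by rewrite /= !orbT.
  by case: vanish => //; rewrite b0 mulr0.
by split; split; first [ring: i2 | apply: (@combine1 _ 1 _ H); ring: i2
  | apply: (@combine1 _ (-1) _ H); ring: i2].
Qed.

End Locus.

(** * The irreducible components *)

Section Decomposition.
Variables (k : closedFieldType) (n m : nat).
Implicit Types (X Y Z : pset k n) (C : m.-tuple (pset k n)).

Lemma irreducible_in_union (r : seq (pset k n)) Y :
  (forall Z, List.In Z r -> zclosed Z) -> irreducible Y ->
  (forall p, Y p -> exists2 Z, List.In Z r & Z p) -> exists2 Z, List.In Z r & psub Y Z.
Proof.
move=> clr irrY; have [clY [y Yy] irr] := irrY.
have clU (s : seq (pset k n)) : (forall Z, List.In Z s -> zclosed Z) ->
    zclosed (fun p => exists2 Z, List.In Z s & Z p).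
  elim: s => [_|A s IH cls]; first by apply: zclosed_peq (@zclosed0 k n) => p; split=> // -[].
  apply: zclosed_peq (zclosedU (cls A _) (IH _)) => [p||Z sZ]; [split | by left | by apply: cls; right].
    by case=> [Ap|[Z sZ Zp]]; [exists A; [left|] | exists Z; [right|]].
  by case=> Z [<-|sZ] Zp; [left | right; exists Z].
elim: r clr => [_ /(_ y Yy) [] // | A r IH clr YU].
case: (irr A (fun p => exists2 Z, List.In Z r & Z p)).
- by apply: clr; left.
- by apply: clU => Z rZ; apply: clr; right.
- by move=> p /YU [Z [<-|rZ] Zp]; [left | right; exists Z].
- by move=> YA; exists A => //; left.
move=> Yr; case: IH => // [Z rZ|Z rZ YZ]; first by apply: clr; right.
by exists Z => //; right.
Qed.

(** An irreducible subset of the union lies in one of the curves, and these are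
    irreducible, so they are the maximal irreducible subsets. *)
Lemma union_decomposes X C :
  (forall j, curve_like (tnth C j)) ->
  (forall j l, psub (tnth C j) (tnth C l) -> j = l) ->
  (forall p, X p <-> exists j, tnth C j p) -> decomposes_into X C.
Proof.
move=> curC injC XC; have irrC j := curve_like_irreducible (curC j).
have inC Z : List.In Z C <-> exists j, Z = tnth C j.
  split=> [|[j ->]].
    move=> CZ; suff [j [lt_j <-]] : exists j, (j < m)%N /\ List.nth j C Z = Z.
      exists (Ordinal lt_j); rewrite (tnth_nth Z) /=.
      by elim: (val C) j {lt_j} => [|A s IH] [|j] //=; apply: IH.
    have [j [lt_j jE]] := List.In_nth _ _ Z CZ; exists j; split=> //.
    by rewrite -(size_tuple C); apply/ssrnat.ltP.
  rewrite (tnth_nth (tnth C j)); have : (j < size C)%N by rewrite size_tuple.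
  move: (nat_of_ord j) => l; elim: (val C) l => [|A s IH] [|l] //= lt_l; first by left.
  by right; apply: IH.
have in_one Y : irreducible Y -> psub Y X -> exists j, psub Y (tnth C j).
  move=> irrY YX; have [Z /inC [j ->] YZ] : exists2 Z, List.In Z C & psub Y Z.
    apply: irreducible_in_union => // [Z /inC [j ->]|p /YX /XC [j Cp]].
      by have [] := curC j.
    by exists (tnth C j) => //; apply/inC; exists j.
  by exists j.
have subX j : psub (tnth C j) X by move=> p Cp; apply/XC; exists j.
split=> // [Z|j l eqC]; last by apply: injC => p /eqC.
split=> [[irrZ ZX maxZ]|[j /pset_ext ->]].
  have [j Zj] := in_one Z irrZ ZX; exists j => p; split; first exact: Zj.
  exact: (maxZ _ (irrC j) Zj (subX j)).
split=> // Y irrY jY YX; have [l Yl] := in_one Y irrY YX.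
have jl : j = l by apply: injC => p /jY /Yl.
by rewrite jl.
Qed.

End Decomposition.

Section Components.
Variables (k : closedFieldType) (i gamma : k).
Hypotheses (char0 : [pchar k] =i pred0) (i2 : i ^+ 2 = -1) (gamma0 : gamma != 0).
Implicit Types (p : 'rV[k]_6) (X Y : pset k 5).

Lemma natr_neq0 m : m.+1%:R != 0 :> k.
Proof. by rewrite ((pcharf0P k).1 char0). Qed.

Let char2 : 2%:R != 0 :> k := natr_neq0 1.

Lemma coordinates_neq0 p : p != 0 ->
  ~ [/\ p 0 o60 = 0, p 0 o65 = 0 & p 0 o62 = 0] \/
  ~ [/\ p 0 o63 = 0, p 0 o61 = 0 & p 0 o64 = 0].
Proof.
move=> p0; apply: NNPP => /not_or_and [/NNPP [e0 e5 e2] /NNPP [e3 e1 e4]].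
by case/negP: p0; apply/eqP/rowP; elim/ord6_ind; rewrite mxE.
Qed.

Lemma incidenceP p A B C D E F :
  incidence p *m relation_tensor i gamma A B C D E F = 0 <->
  incident i gamma (p 0 o60) (p 0 o65) (p 0 o62) (p 0 o63) (p 0 o61) (p 0 o64) A B C D E F.
Proof.
split=> [/matrixP K|[[h1 h2 h3 h4] [h5 h6 h7 h8] [h9 h10 h11 h12] [h13 h14 h15 h16]]].
  have {}K j l : \sum_m incidence p j m * relation_tensor i gamma A B C D E F m l = 0.
    by have := K j l; rewrite [LHS]mxE => ->; rewrite mxE.
  split; split;
  [ have := K o40 o40 | have := K o41 o40 | have := K o42 o40 | have := K o43 o40
  | have := K o40 o41 | have := K o41 o41 | have := K o42 o41 | have := K o43 o41
  | have := K o40 o42 | have := K o41 o42 | have := K o42 o42 | have := K o43 o42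
  | have := K o40 o43 | have := K o41 o43 | have := K o42 o43 | have := K o43 o43 ];
  rewrite sum4E !mxE /= => KE; first
    [ rewrite -[RHS]KE; ring | apply: oppr_inj; rewrite oppr0 -[RHS]KE; ring ].
apply/matrixP; elim/ord4_ind; elim/ord4_ind; rewrite [LHS]mxE sum4E !mxE /=;
  first [ rewrite -[RHS]h1; ring | rewrite -[RHS]h3; ring | rewrite -[RHS]h6; ring
  | rewrite -[RHS]h7; ring | rewrite -[RHS]h9; ring | rewrite -[RHS]h11; ring
  | rewrite -[RHS]h12; ring | rewrite -[RHS]h13; ring | rewrite -[RHS]h14; ring
  | rewrite -[RHS]h15; ring | rewrite -[RHS]h16; ring
  | apply: oppr_inj; rewrite oppr0;
    first [ rewrite -[RHS]h2; ring | rewrite -[RHS]h4; ring | rewrite -[RHS]h5; ring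
    | rewrite -[RHS]h8; ring | rewrite -[RHS]h10; ring ]].
Qed.

Lemma line_scheme_curves p : reduced_line_scheme i gamma p <->
  p != 0 /\ on_some_curve i gamma (p 0 o60) (p 0 o65) (p 0 o62) (p 0 o63) (p 0 o61) (p 0 o64).
Proof.
rewrite (line_schemeP i gamma char2); split.
  move=> [p0 P0 [A [B [C [D [E [F [T0 /incidenceP KT]]]]]]]]; split=> //.
  apply: (relation_locus char2 i2 gamma0 _ (coordinates_neq0 p0) _ KT); last first.
    by rewrite -[RHS]P0 !evalpE.
  apply: NNPP => /not_or_and [/NNPP [A0 B0 C0] /NNPP [D0 E0 F0]]; case/negP: T0.
  apply/eqP/matrixP; elim/ord4_ind; elim/ord4_ind;
    by rewrite !mxE /= ?A0 ?B0 ?C0 ?D0 ?E0 ?F0; ring.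
move=> [p0 /(locus_relation i2 gamma0 (coordinates_neq0 p0))].
move=> [P0 [A [B [C [D [E [F [T0 /incidenceP KT]]]]]]]]; split=> //.
  by rewrite !evalpE -[RHS]P0.
exists A, B, C, D, E, F; split=> //; apply: contraTneq T0 => /matrixP T0.
have := T0 o40 o40; have := T0 o40 o42; have := T0 o40 o43; have := T0 o41 o42.
have := T0 o41 o43; have := T0 o43 o43; rewrite !mxE /= => -> -> -> -> -> ->.
by rewrite eqxx.
Qed.

Lemma line_scheme_union p : reduced_line_scheme i gamma p <->
  [\/ L1 gamma p, L2 i p \/ L3 i p, L4 i gamma p \/ L5 i gamma p | L6a i p \/ L6b i p].
Proof.
rewrite line_scheme_curves; split.
  move=> [p0 [[e1 e4 H Q]|[[e1 e2 e5 H]|[e0 e1 e3 H]]|[[e0 e2 e4 H]|[e3 e4 e5 H]]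
    |[[e2 e3 H H']|[e2 e3 H H']]]].
  - by apply: Or41; apply/L1P.
  - by apply: Or42; left; apply/L2P.
  - by apply: Or42; right; apply/L3P.
  - by apply: Or43; left; apply/L4P.
  - by apply: Or43; right; apply/L5P.
  - by apply: Or44; left; apply/L6aP.
  - by apply: Or44; right; apply/L6bP.
move=> [/L1P [p0 e1 e4 H Q]|[/L2P [p0 e1 e2 e5 H]|/L3P [p0 e0 e1 e3 H]]
  |[/L4P [p0 e0 e2 e4 H]|/L5P [p0 e3 e4 e5 H]]
  |[/L6aP [p0 e2 e3 H H']|/L6bP [p0 e2 e3 H H']]]; split=> //.
- exact: Or41.
- by apply: Or42; left.
- by apply: Or42; right.
- by apply: Or43; left.
- by apply: Or43; right.
- by apply: Or44; left.
- by apply: Or44; right.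
Qed.

(** When [gamma = 4] the second quadric through the first curve differs from
    [(M12 - M34)^2 - (M14 - M23)^2] by a multiple of the first one. *)
Lemma L1_splits p : gamma = 4%:R -> L1 gamma p <-> L1a k p \/ L1b k p.
Proof.
move=> g4; rewrite g4; split=> [/L1P [p0 e1 e4 H Q]|].
  have : (p 0 o60 + p 0 o62 - p 0 o63 - p 0 o65) * (p 0 o60 - p 0 o62 + p 0 o63 - p 0 o65) = 0.
    by apply: (@combine2 _ _ 1 (- 2%:R) _ _ Q H); ring.
  by move/eqP; rewrite mulf_eq0 => /orP [] /eqP z0; [left; apply/L1aP | right; apply/L1bP].
by case=> [/L1aP|/L1bP] [p0 e1 e4 H Q]; apply/L1P; split=> //;
  [ apply: (@combine2 _ _ (p 0 o60 - p 0 o62 + p 0 o63 - p 0 o65) 2%:R _ _ Q H)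
  | apply: (@combine2 _ _ (p 0 o60 + p 0 o62 - p 0 o63 - p 0 o65) 2%:R _ _ Q H)]; ring.
Qed.

(** The coordinates M12, M13, M14, M23, M24, M34, and four forms that tell the two
    members of a pair of conics apart. *)
Definition separating_form (t : nat) p : k :=
  nth 0 [:: p 0 o60; p 0 o61; p 0 o62; p 0 o63; p 0 o64; p 0 o65;
    p 0 o60 + i * p 0 o65; p 0 o60 - i * p 0 o65;
    p 0 o60 + p 0 o62 - p 0 o63 - p 0 o65; p 0 o60 - p 0 o62 + p 0 o63 - p 0 o65] t.

(** A certificate for telling components apart: a form in the first list of one
    component and in the second list of another one shows that they differ. *)
Definition has_pattern X (zs : seq nat * seq nat) :=
  (forall p, X p -> forall t, t \in zs.1 -> separating_form t p = 0) /\
  (exists2 p, X p & forall t, t \in zs.2 -> separating_form t p != 0).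

Definition separated (x y : seq nat * seq nat) :=
  has (mem y.2) x.1 || has (mem x.2) y.1.

Lemma separated_distinct X Y x y :
  has_pattern X x -> has_pattern Y y -> separated x y -> ~ peq X Y.
Proof.
move=> [zX [p Xp sX]] [zY [q Yq sY]] sep XY.
case/orP: sep => /hasP [t t1 t2].
  by have := sY t t2; rewrite (zX q) ?eqxx //; apply/XY.
by have := sX t t2; rewrite (zY p) ?eqxx //; apply/XY.
Qed.

Lemma curves_decompose m (C : m.-tuple (pset k 5)) (pats : seq (seq nat * seq nat)) :
  size pats = m -> pairwise separated pats ->
  (forall j, curve_like (tnth C j) /\ has_pattern (tnth C j) (nth ([::], [::]) pats j)) ->
  (forall p, reduced_line_scheme i gamma p <-> exists j, tnth C j p) ->
  decomposes_into (reduced_line_scheme i gamma) C.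
Proof.
move=> sz sep CP; apply: union_decomposes => [j|j l jl]; first exact: (CP j).1.
have eq_jl := curve_like_sub (CP j).1 (CP l).1 jl.
have in_pats (a : 'I_m) : (a : nat) \in gtn (size pats).
  by have := ltn_ord a; rewrite -[X in (_ < X)%N]sz.
apply: val_inj; have [lt_jl|lt_lj|//] := ltngtP j l.
  case: (separated_distinct (CP j).2 (CP l).2 _ eq_jl).
  exact: (pairwiseP _ sep) (in_pats _) (in_pats _) _.
have eq_lj : peq (tnth C l) (tnth C j) by move=> p; split=> /eq_jl.
case: (separated_distinct (CP l).2 (CP j).2 _ eq_lj).
exact: (pairwiseP _ sep) (in_pats _) (in_pats _) _.
Qed.

(** Gives a point with [x = 2] and [y = 1] on the cubic [x^3 = x y^2 + c y z^2]. *)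
Lemma square_quotient (c : k) : c != 0 -> exists2 x, x != 0 & c * x ^+ 2 = 6%:R.
Proof.
move=> c0; have [x xE] := square_root (6%:R / c).
have cx : c * x ^+ 2 = 6%:R by rewrite xE mulrC divfK.
exists x => //; apply: contraNneq (natr_neq0 5) => x0.
by rewrite -cx x0 expr0n mulr0.
Qed.

Lemma three_forms_pattern X p s t1 t2 t3 :
  (forall q, X q -> [/\ separating_form t1 q = 0, separating_form t2 q = 0
     & separating_form t3 q = 0]) ->
  X p -> all (fun t => separating_form t p != 0) s -> has_pattern X ([:: t1; t2; t3], s).
Proof.
move=> Xz Xp ps; split=> [q /Xz [z1 z2 z3] t|]; last by exists p => //; apply/allP.
by rewrite !inE => /or3P [] /eqP ->.
Qed.

Let unit_i : i != 0 := sqr_neg1_neq0 i2.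

Lemma L2_pattern : has_pattern (L2 i) ([:: 1; 2; 5], [:: 0; 3; 4])%N.
Proof.
have [x x0 cx] := square_quotient unit_i.
apply: (@three_forms_pattern _ (rowseq 6 [:: 2%:R; 0; 0; 1; x; 0])) => [q /L2P []//||].
  apply/L2P; rewrite !mxE /=; split=> //; last by rewrite mul1r cx; ring.
  by apply/eqP => /rowP /(_ o63); rewrite !mxE => /eqP; rewrite oner_eq0.
by rewrite /= /separating_form !mxE /= oner_neq0 x0 char2.
Qed.

Lemma L3_pattern : has_pattern (L3 i) ([:: 0; 1; 3], [:: 2; 4; 5])%N.
Proof.
have [|x x0 cx] := @square_quotient (- i); first by rewrite oppr_eq0.
have {}cx : i * x ^+ 2 = - 6%:R by rewrite -cx; ring.
apply: (@three_forms_pattern _ (rowseq 6 [:: 0; 0; 1; 0; x; 2%:R])) => [q /L3P []//||].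
  apply/L3P; rewrite !mxE /=; split=> //; last by rewrite mul1r cx; ring.
  by apply/eqP => /rowP /(_ o62); rewrite !mxE => /eqP; rewrite oner_eq0.
by rewrite /= /separating_form !mxE /= oner_neq0 x0 char2.
Qed.

Lemma L4_pattern : has_pattern (L4 i gamma) ([:: 0; 2; 4], [:: 1; 3; 5])%N.
Proof.
have [|x x0 cx] := @square_quotient (i * gamma); first by rewrite mulf_neq0.
apply: (@three_forms_pattern _ (rowseq 6 [:: 0; x; 0; 1; 0; 2%:R])) => [q /L4P []//||].
  apply/L4P; rewrite !mxE /=; split=> //; last by rewrite mulr1 cx; ring.
  by apply/eqP => /rowP /(_ o63); rewrite !mxE => /eqP; rewrite oner_eq0.
by rewrite /= /separating_form !mxE /= oner_neq0 x0 char2.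
Qed.

Lemma L5_pattern : has_pattern (L5 i gamma) ([:: 3; 4; 5], [:: 0; 1; 2])%N.
Proof.
have [|x x0 cx] := @square_quotient (- (i * gamma)); first by rewrite oppr_eq0 mulf_neq0.
have {}cx : i * gamma * x ^+ 2 = - 6%:R by rewrite -cx; ring.
apply: (@three_forms_pattern _ (rowseq 6 [:: 2%:R; x; 1; 0; 0; 0])) => [q /L5P []//||].
  apply/L5P; rewrite !mxE /=; split=> //; last by rewrite mulr1 cx; ring.
  by apply/eqP => /rowP /(_ o62); rewrite !mxE => /eqP; rewrite oner_eq0.
by rewrite /= /separating_form !mxE /= oner_neq0 x0 char2.
Qed.

Lemma L6a_pattern : has_pattern (L6a i) ([:: 2; 3; 6], [:: 0; 1; 4; 5; 7])%N.
Proof.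
apply: (@three_forms_pattern _ (rowseq 6 [:: - i; - i; 0; 0; 1; 1])) => [q /L6aP []//||].
  apply/L6aP; rewrite !mxE /=; split=> //; try ring.
  by apply/eqP => /rowP /(_ o65); rewrite !mxE => /eqP; rewrite oner_eq0.
rewrite /= /separating_form !mxE /= oner_neq0 oppr_eq0 unit_i /=.
by rewrite mulr1 -opprD oppr_eq0 -mulr2n -mulr_natl mulf_neq0.
Qed.

Lemma L6b_pattern : has_pattern (L6b i) ([:: 2; 3; 7], [:: 0; 1; 4; 5; 6])%N.
Proof.
apply: (@three_forms_pattern _ (rowseq 6 [:: i; i; 0; 0; 1; 1])) => [q /L6bP []//||].
  apply/L6bP; rewrite !mxE /=; split=> //; try ring.
  by apply/eqP => /rowP /(_ o65); rewrite !mxE => /eqP; rewrite oner_eq0.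
rewrite /= /separating_form !mxE /= oner_neq0 unit_i /=.
by rewrite mulr1 -mulr2n -mulr_natl mulf_neq0.
Qed.

Lemma L1a_pattern : has_pattern (L1a k) ([:: 1; 4; 8], [:: 9])%N.
Proof.
apply: (@three_forms_pattern _ (rowseq 6 [:: 1; 0; 0; 1; 0; 0])) => [q /L1aP []//||].
  apply/L1aP; rewrite !mxE /=; split=> //; try ring.
  by apply/eqP => /rowP /(_ o60); rewrite !mxE => /eqP; rewrite oner_eq0.
by rewrite /= /separating_form !mxE /= !subr0 -mulr2n char2.
Qed.

Lemma L1b_pattern : has_pattern (L1b k) ([:: 1; 4; 9], [:: 8])%N.
Proof.
apply: (@three_forms_pattern _ (rowseq 6 [:: 1; 0; 1; 0; 0; 0])) => [q /L1bP []//||].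
  apply/L1bP; rewrite !mxE /=; split=> //; try ring.
  by apply/eqP => /rowP /(_ o60); rewrite !mxE => /eqP; rewrite oner_eq0.
by rewrite /= /separating_form !mxE /= !subr0 -mulr2n char2.
Qed.

Lemma L1_pattern : curve_like (L1 gamma) -> has_pattern (L1 gamma) ([:: 1; 4], [::])%N.
Proof.
move=> /curve_like_irreducible [_ [p Lp] _]; split=> [q /L1P [_ e1 e4 _ _] t|].
  by rewrite !inE => /orP [] /eqP ->.
by exists p.
Qed.

End Components.

Theorem theorem3p1 (k : closedFieldType) (char0 : [pchar k] =i pred0)
    (i : k) (i2 : i ^+ 2 = -1) (gamma : k) (gamma_neq0 : gamma != 0) :
  (gamma ^+ 2 != 16%:R ->
     decomposes_into (reduced_line_scheme i gamma)
       [tuple L1 gamma; L2 i; L3 i; L4 i gamma; L5 i gamma; L6a i; L6b i]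
     /\ [/\ elliptic_curve (L1 gamma), in_linear_subspace (L1 gamma) 3
          & ~ planar (L1 gamma)]
     /\ (elliptic_curve (L2 i) /\ planar (L2 i))
     /\ (elliptic_curve (L3 i) /\ planar (L3 i))
     /\ (elliptic_curve (L4 i gamma) /\ planar (L4 i gamma))
     /\ (elliptic_curve (L5 i gamma) /\ planar (L5 i gamma))
     /\ nonsingular_conic (L6a i)
     /\ nonsingular_conic (L6b i))
  /\
  (gamma = 4%:R ->
     decomposes_into (reduced_line_scheme i gamma)
       [tuple L1a k; L1b k; L2 i; L3 i; L4 i gamma; L5 i gamma; L6a i; L6b i]
     /\ nonsingular_conic (L1a k)
     /\ nonsingular_conic (L1b k)).
Proof.
have char2 : 2%:R != 0 :> k := natr_neq0 char0 1.
have [c2 e2 p2] := L2_elliptic char2 i2; have [c3 e3 p3] := L3_elliptic char2 i2.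
have [c4 e4 p4] := L4_elliptic char2 i2 gamma_neq0.
have [c5 e5 p5] := L5_elliptic char2 i2 gamma_neq0.
have [c6a e6a] := L6a_conic char2 i2; have [c6b e6b] := L6b_conic char2 i2.
have [c1a e1a] := L1a_conic char2 i2; have [c1b e1b] := L1b_conic char2 i2.
have q2 := L2_pattern char0 i2; have q3 := L3_pattern char0 i2.
have q4 := L4_pattern char0 i2 gamma_neq0; have q5 := L5_pattern char0 i2 gamma_neq0.
have q6a := L6a_pattern char0 i2; have q6b := L6b_pattern char0 i2.
have q1a := L1a_pattern i char0; have q1b := L1b_pattern i char0.
have lsu := line_scheme_union char0 i2 gamma_neq0.
split=> [g16 | g4].
  have [c1 e1] := L1_elliptic char2 gamma_neq0 g16.
  have q1 := L1_pattern i c1.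
  split; last by [].
  (* For each component: forms that vanish on it, and forms that are nonzero at a point. *)
  apply: (@curves_decompose _ i gamma 7 _ [:: ([:: 1; 4], [::]); ([:: 1; 2; 5], [:: 0; 3; 4]);
    ([:: 0; 1; 3], [:: 2; 4; 5]); ([:: 0; 2; 4], [:: 1; 3; 5]); ([:: 3; 4; 5], [:: 0; 1; 2]);
    ([:: 2; 3; 6], [:: 0; 1; 4; 5; 7]); ([:: 2; 3; 7], [:: 0; 1; 4; 5; 6])]%N) => //.
    move=> [[|[|[|[|[|[|[|m]]]]]]] lt_m]; rewrite (tnth_nth (L1 gamma)) /=;
      [ exact (conj c1 q1) | exact (conj c2 q2) | exact (conj c3 q3) | exact (conj c4 q4)
      | exact (conj c5 q5) | exact (conj c6a q6a) | exact (conj c6b q6b) | case (notF lt_m) ].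
  move=> p; rewrite lsu; split.
    case=> [Lp|[Lp|Lp]|[Lp|Lp]|[Lp|Lp]].
    - by exists (@Ordinal 7 0 isT); rewrite (tnth_nth (L1 gamma)).
    - by exists (@Ordinal 7 1 isT); rewrite (tnth_nth (L1 gamma)).
    - by exists (@Ordinal 7 2 isT); rewrite (tnth_nth (L1 gamma)).
    - by exists (@Ordinal 7 3 isT); rewrite (tnth_nth (L1 gamma)).
    - by exists (@Ordinal 7 4 isT); rewrite (tnth_nth (L1 gamma)).
    - by exists (@Ordinal 7 5 isT); rewrite (tnth_nth (L1 gamma)).
    - by exists (@Ordinal 7 6 isT); rewrite (tnth_nth (L1 gamma)).
  case=> [[[|[|[|[|[|[|[|m]]]]]]] lt_m]]; rewrite (tnth_nth (L1 gamma)) /= => Lp; last by case (notF lt_m).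
  - exact: Or41.
  - by apply: Or42; left.
  - by apply: Or42; right.
  - by apply: Or43; left.
  - by apply: Or43; right.
  - by apply: Or44; left.
  - by apply: Or44; right.
split; last by [].
apply: (@curves_decompose _ i gamma 8 _ [:: ([:: 1; 4; 8], [:: 9]); ([:: 1; 4; 9], [:: 8]);
  ([:: 1; 2; 5], [:: 0; 3; 4]);
  ([:: 0; 1; 3], [:: 2; 4; 5]); ([:: 0; 2; 4], [:: 1; 3; 5]); ([:: 3; 4; 5], [:: 0; 1; 2]);
  ([:: 2; 3; 6], [:: 0; 1; 4; 5; 7]); ([:: 2; 3; 7], [:: 0; 1; 4; 5; 6])]%N) => //.
  move=> [[|[|[|[|[|[|[|[|m]]]]]]]] lt_m]; rewrite (tnth_nth (L1 gamma)) /=;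
    [ exact (conj c1a q1a) | exact (conj c1b q1b) | exact (conj c2 q2) | exact (conj c3 q3)
    | exact (conj c4 q4) | exact (conj c5 q5) | exact (conj c6a q6a) | exact (conj c6b q6b) | case (notF lt_m) ].
move=> p; rewrite lsu; split.
  case=> [/(L1_splits _ g4) [Lp|Lp]|[Lp|Lp]|[Lp|Lp]|[Lp|Lp]].
  - by exists (@Ordinal 8 0 isT); rewrite (tnth_nth (L1 gamma)).
  - by exists (@Ordinal 8 1 isT); rewrite (tnth_nth (L1 gamma)).
  - by exists (@Ordinal 8 2 isT); rewrite (tnth_nth (L1 gamma)).
  - by exists (@Ordinal 8 3 isT); rewrite (tnth_nth (L1 gamma)).
  - by exists (@Ordinal 8 4 isT); rewrite (tnth_nth (L1 gamma)).
  - by exists (@Ordinal 8 5 isT); rewrite (tnth_nth (L1 gamma)).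
  - by exists (@Ordinal 8 6 isT); rewrite (tnth_nth (L1 gamma)).
  - by exists (@Ordinal 8 7 isT); rewrite (tnth_nth (L1 gamma)).
case=> [[[|[|[|[|[|[|[|[|m]]]]]]]] lt_m]]; rewrite (tnth_nth (L1 gamma)) /= => Lp; last by case (notF lt_m).
- by apply: Or41; apply/(L1_splits _ g4); left.
- by apply: Or41; apply/(L1_splits _ g4); right.
- by apply: Or42; left.
- by apply: Or42; right.
- by apply: Or43; left.
- by apply: Or43; right.
- by apply: Or44; left.
- by apply: Or44; right.
Qed.
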